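(* Let $(\Omega_n)$ be a locally $m$-convex sequence of $\mathbb{C}$-proper convex open sets in $\mathbb{C}^d$ converging in the local Hausdorff topology to a $\mathbb{C}$-proper convex open set $\Omega$. Let $\varphi_n:\Delta\to\Omega_n$ be complex geodesics, and suppose there are $R>0$ and real numbers $a_n,b_n\in(-1,1)$ such that for all $n$: (1) $0\in[a_n,b_n]$; (2) $\varphi_n([a_n,b_n])\subset B_R(0)$; (3) $\lim_{n\to\infty}\|\varphi_n(a_n)-\varphi_n(b_n)\|>0$; (4) $\delta_{\Omega_n}(\varphi_n(0))=\max\{\delta_{\Omega_n}(\varphi_n(t)): t\in[a_n,b_n]\}$. Then there is a subsequence $n_k\to\infty$ such that $\varphi_{n_k}$ converges locally uniformly to a complex geodesic $\varphi:\Delta\to\Omega$.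
   Context: $\Delta$ is the unit disk with Kobayashi (Poincaré) distance $d_\Delta$; $d_\Omega$ is the Kobayashi distance. A holomorphic map $\varphi:\Delta\to\Omega$ is a complex geodesic if $d_\Omega(\varphi(p),\varphi(q))=d_\Delta(p,q)$ for all $p,q\in\Delta$. $\delta_\Omega(p)$ is the Euclidean distance from $p$ to $\mathbb{C}^d\setminus\Omega$, and $\delta_\Omega(p;v)=\inf\{\|q-p\|:q\in(p+\mathbb{C}v)\setminus\Omega\}$. $(\Omega_n)$ is a locally $m$-convex sequence if for every $R>0$ there exist $N,C>0$ with $\delta_{\Omega_n}(p;v)\le C\delta_{\Omega_n}(p)^{1/m}$ for all $n>N$, $p\in\Omega_n\cap B_R(0)$, $v\neq0$. $\mathbb{C}$-proper: contains no complex affine line. Local Hausdorff topology: convergence of closures intersected with every ball $\overline{B_R(0)}$ in Hausdorff distance. *)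

(* Defs.v *)
From mathcomp Require Import all_boot all_order all_algebra.
From mathcomp Require Import all_classical all_reals all_analysis.
From mathcomp Require Import complex.
Import Order.TTheory GRing.Theory Num.Theory Num.Def.
Import numFieldNormedType.Exports.

Set Implicit Arguments.
Unset Strict Implicit.
Unset Printing Implicit Defensive.

Local Open Scope classical_set_scope.
Local Open Scope ring_scope.
Local Open Scope complex_scope.

Section Defs.
Variable R : realType.
Local Notation C := (R[i]).

Definition cabs (z : C) : R := let: a +i* b := z in Num.sqrt (a ^+ 2 + b ^+ 2).

Definition cvec (d : nat) := 'I_d -> C.

Definition vadd d (p q : cvec d) : cvec d := fun i => p i + q i.
Definition vsub d (p q : cvec d) : cvec d := fun i => p i - q i.
Definition vscale d (l : C) (v : cvec d) : cvec d := fun i => l * v i.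
Definition vzero d : cvec d := fun _ => 0.

Definition vnorm d (v : cvec d) : R := Num.sqrt (\sum_(i < d) cabs (v i) ^+ 2).

Definition disc : set C := [set z | cabs z < 1].

(* Poincare distance on Delta: artanh of the pseudo-hyperbolic distance *)
Definition poincare (z w : C) : R :=
  let r := cabs (z - w) / cabs (1 - conjc w * z) in
  2^-1 * ln ((1 + r) / (1 - r)).

Definition eopen d (O : set (cvec d)) : Prop :=
  forall p, O p -> exists2 e : R, 0 < e &
    forall q, vnorm (vsub q p) < e -> O q.

Definition rconvex d (O : set (cvec d)) : Prop :=
  forall p q (t : R), O p -> O q -> 0 <= t <= 1 ->
    O (vadd (vscale (1 - t)%:C p) (vscale t%:C q)).

Definition C_proper d (O : set (cvec d)) : Prop :=
  ~ exists (p v : cvec d), v <> (@vzero d) /\ forall l : C, O (vadd p (vscale l v)).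

(* holomorphic maps Delta -> O (functions are total, only their values on
   Delta matter) *)
Definition holo_on_disc d (f : C -> cvec d) : Prop :=
  forall z, disc z -> forall i : 'I_d,
    derivable ((fun w : C^o => f w i) : C^o -> C^o) z 1.

Definition holo_map d (O : set (cvec d)) (f : C -> cvec d) : Prop :=
  holo_on_disc f /\ forall z, disc z -> O (f z).

Definition chain_lengths d (O : set (cvec d)) (p q : cvec d) : set (\bar R) :=
  [set x | exists (N : nat) (pts : nat -> cvec d) (f : nat -> C -> cvec d)
             (a b : nat -> C),
      [/\ pts 0%N = p, pts N = q,
          forall j, (j < N)%N ->
            [/\ holo_map O (f j), disc (a j), disc (b j),
                f j (a j) = pts j & f j (b j) = pts j.+1] &
          x = (\sum_(j < N) poincare (a j) (b j))%:E]].

Definition kobayashi d (O : set (cvec d)) (p q : cvec d) : \bar R :=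
  ereal_inf (chain_lengths O p q).

Definition complex_geodesic d (O : set (cvec d)) (phi : C -> cvec d) : Prop :=
  holo_map O phi /\
  forall z w, disc z -> disc w -> kobayashi O (phi z) (phi w) = (poincare z w)%:E.

Definition delta d (O : set (cvec d)) (p : cvec d) : R :=
  inf [set vnorm (vsub q p) | q in ~` O].

Definition delta_dir d (O : set (cvec d)) (p v : cvec d) : R :=
  inf [set vnorm (vsub q p) | q in
        [set q | (exists l : C, q = vadd p (vscale l v)) /\ ~ O q]].

Definition loc_m_convex d (m : R) (Om : nat -> set (cvec d)) : Prop :=
  forall Rad : R, 0 < Rad -> exists N : nat, exists2 K : R, 0 < K &
    forall n : nat, (N < n)%N -> forall p v : cvec d,
      Om n p -> vnorm p < Rad -> v <> (@vzero d) ->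
      delta_dir (Om n) p v <= K * powR (delta (Om n) p) m^-1.

Definition eclosure d (A : set (cvec d)) : set (cvec d) :=
  [set x | forall e : R, 0 < e -> exists2 a, A a & vnorm (vsub x a) < e].

Definition cl_ball d (A : set (cvec d)) (Rad : R) : set (cvec d) :=
  [set x | eclosure A x /\ vnorm x <= Rad].

(* Hausdorff distance between A_n and B tends to 0, written with the
   epsilon-characterisation: eventually each set lies in the
   e-neighbourhood of the other. *)
Definition hausdorff_cvg d (A : nat -> set (cvec d)) (B : set (cvec d)) : Prop :=
  forall e : R, 0 < e -> exists N : nat, forall n : nat, (N <= n)%N ->
    (forall a, A n a -> exists2 b, B b & vnorm (vsub a b) < e) /\
    (forall b, B b -> exists2 a, A n a & vnorm (vsub a b) < e).

Definition local_hausdorff_cvg d (Om : nat -> set (cvec d)) (O : set (cvec d)) : Prop :=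
  forall Rad : R, 0 < Rad ->
    hausdorff_cvg (fun n => cl_ball (Om n) Rad) (cl_ball O Rad).

Definition loc_unif_cvg d (f : nat -> C -> cvec d) (g : C -> cvec d) : Prop :=
  forall r : R, 0 < r < 1 -> forall e : R, 0 < e -> exists N : nat,
    forall k : nat, (N <= k)%N -> forall z : C, cabs z <= r ->
      vnorm (vsub (f k z) (g z)) < e.

End Defs.

(* Main.v *)
(* Each phi_n satisfies |phi_n(z) - phi_n(w)| <= 2r/(1-r) delta(phi_n(w); phi_n(z) - phi_n(w)),
   with r the pseudo-hyperbolic distance of z and w: compose with a supporting functional and
   use the Schwarz lemma for the half-plane. Since phi_n is a geodesic and chains of discs
   towards a fixed interior point bound the Kobayashi distance by a multiple of log(1/delta),
   hypothesis (4) makes delta(phi_n(t)) decay like a power of 1-|t| along [a_n, b_n]. With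
   m-convexity, |phi_n(a_n) - phi_n(b_n)| is then bounded by a convergent series each of whose
   terms tends to 0 with delta(phi_n(0)); so by (3) delta(phi_n(0)) stays bounded below. The
   first estimate now gives equicontinuity and hence a limit psi, holomorphic by Cauchy's
   formula, with values in O by the half-plane Schwarz lemma at a point where the supporting
   functional would vanish. Finally a chain of discs in O, slightly shrunk, is a chain in Om_n
   for large n, so psi cannot shorten distances. All limits are taken along one free
   ultrafilter; the subsequence is extracted only at the end. Goursat's lemma and Cauchy's
   formula for circles are proved from complex differentiability alone. *)
Require Import Defs.
From mathcomp Require Import all_boot all_order all_algebra.
From mathcomp Require Import all_classical all_reals all_analysis.
From mathcomp Require Import complex ring lra.
Import Order.TTheory GRing.Theory Num.Theory Num.Def.
Import numFieldNormedType.Exports.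
Set Implicit Arguments.
Unset Strict Implicit.
Unset Printing Implicit Defensive.
Local Open Scope classical_set_scope.
Local Open Scope ring_scope.
Local Open Scope complex_scope.
(* Num.Def also exports functions Re and Im. *)
Local Notation Re := complex.Re.
Local Notation Im := complex.Im.

(** * Limits along a free ultrafilter *)

(** The obstacle is that phi_n(0) might approach the boundary, in which case the limit need not lie
    in O. Hypothesis (4) makes 0 the deepest parameter of the segment, so any number of discs that
    reaches phi_n(t) from a fixed centre also reaches phi_n(0). A chain whose depth decreases by a
    factor tau at each disc of length (ln 3)/2 reaches depth of order tau^J in J + 1 discs. Two of
    them have total length (J+1) ln 3, while the parameters 0 and 1 - 16^-(J+1) are at distance at
    least (J+1) ln 4. So the depth at the second one is at most a multiple of tau^J, and its 1/m-th
    powers are still geometric: this is why every exponent m > 0 is covered. No lower bound for a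
    Kobayashi distance is proved directly; all of them come from the phi_n being geodesics. *)

Section Cabs.
Variable R : realType.
Implicit Types (x y z : R[i]) (a : R).

Lemma cabs0 : cabs (0 : R[i]) = 0. Proof. exact: Normc.normc0. Qed.
Lemma cabsM x y : cabs (x * y) = cabs x * cabs y. Proof. exact: Normc.normcM. Qed.
Lemma cabsV x : cabs x^-1 = (cabs x)^-1. Proof. exact: Normc.normcV. Qed.
Lemma cabsD x y : cabs (x + y) <= cabs x + cabs y. Proof. exact: le_normcD. Qed.
Lemma cabsN x : cabs (- x) = cabs x. Proof. exact: normcN. Qed.
Lemma cabs_ge0 x : 0 <= cabs x. Proof. by case: x => a b; exact: sqrtr_ge0. Qed.
Lemma cabsR a : cabs a%:C = `|a|.
Proof. by rewrite /cabs /= expr0n /= addr0 sqrtr_sqr. Qed.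
Lemma cabs1 : cabs (1 : R[i]) = 1. Proof. by rewrite (cabsR 1) normr1. Qed.
Lemma cabs_eq0 x : (cabs x == 0) = (x == 0).
Proof. by apply/eqP/eqP => [/Normc.eq0_normc //|->]; rewrite cabs0. Qed.
Lemma cabs_gt0 x : (0 < cabs x) = (x != 0).
Proof. by rewrite lt0r cabs_eq0 cabs_ge0 andbT. Qed.
Lemma cabsBC x y : cabs (x - y) = cabs (y - x).
Proof. by rewrite -cabsN opprB. Qed.
Lemma cabsJ x : cabs (conjc x) = cabs x.
Proof. by case: x => a b; rewrite /cabs /= sqrrN. Qed.
Lemma cabs_sqr x : cabs x ^+ 2 = Re x ^+ 2 + Im x ^+ 2.
Proof. by case: x => a b; rewrite /cabs /= sqr_sqrtr // addr_ge0 ?sqr_ge0. Qed.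
Lemma cabs_sqrC x : (cabs x ^+ 2)%:C = x * conjc x.
Proof.
rewrite cabs_sqr; case: x => a b /=; rewrite /GRing.mul /= /real_complex_def.
by congr (_ +i* _); ring.
Qed.
Lemma Re_le_cabs x : `|Re x| <= cabs x.
Proof.
rewrite -[leRHS]ger0_norm ?cabs_ge0 // -ler_sqr ?nnegrE // !real_normK ?num_real //.
by rewrite cabs_sqr lerDl sqr_ge0.
Qed.
Lemma Im_le_cabs x : `|Im x| <= cabs x.
Proof.
rewrite -[leRHS]ger0_norm ?cabs_ge0 // -ler_sqr ?nnegrE // !real_normK ?num_real //.
by rewrite cabs_sqr lerDr sqr_ge0.
Qed.
Lemma Re_cabs x : Re x <= cabs x.
Proof. exact: le_trans (ler_norm _) (Re_le_cabs _). Qed.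
Lemma cabs_le_ReIm x : cabs x <= `|Re x| + `|Im x|.
Proof.
rewrite -ler_sqr ?nnegrE ?addr_ge0 ?cabs_ge0 ?normr_ge0 // cabs_sqr sqrrD.
rewrite !real_normK ?num_real // -addrA lerD2l -[leLHS]add0r lerD2r.
by rewrite mulrn_wge0 // mulr_ge0.
Qed.
Lemma cabs_tri y x z : cabs (x - z) <= cabs (x - y) + cabs (y - z).
Proof. by apply: le_trans (cabsD _ _); rewrite addrA subrK. Qed.
Lemma cabsX x n : cabs (x ^+ n) = cabs x ^+ n.
Proof. by elim: n => [|n IH]; rewrite ?cabs1 // !exprS cabsM IH. Qed.
Lemma cabsi : cabs ('i : R[i]) = 1.
Proof. by rewrite /cabs /= expr0n expr1n add0r sqrtr1. Qed.
Lemma cabs_sum (I : Type) (r : seq I) (P : pred I) (F : I -> R[i]) :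
  cabs (\sum_(i <- r | P i) F i) <= \sum_(i <- r | P i) cabs (F i).
Proof.
elim/big_ind2 : _ => [|x1 x2 y1 y2 h1 h2|//]; first by rewrite cabs0.
exact: le_trans (cabsD _ _) (lerD h1 h2).
Qed.
Lemma ReD x y : Re (x + y) = Re x + Re y. Proof. by case: x; case: y. Qed.
Lemma ImD x y : Im (x + y) = Im x + Im y. Proof. by case: x; case: y. Qed.
Lemma ReN x : Re (- x) = - Re x. Proof. by case: x. Qed.
Lemma ImN x : Im (- x) = - Im x. Proof. by case: x. Qed.
Lemma ReB x y : Re (x - y) = Re x - Re y. Proof. by rewrite ReD ReN. Qed.
Lemma ReMr a x : Re (a%:C * x) = a * Re x.
Proof. by case: x => b c /=; rewrite mul0r subr0. Qed.
Lemma Re_sum (I : Type) (r : seq I) (P : pred I) (F : I -> R[i]) :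
  Re (\sum_(i <- r | P i) F i) = \sum_(i <- r | P i) Re (F i).
Proof. by apply: (big_morph (@Re R)) => //; exact: ReD. Qed.
Lemma conjcM x y : conjc (x * y) = conjc x * conjc y. Proof. exact: rmorphM. Qed.
Lemma conjcB x y : conjc (x - y) = conjc x - conjc y. Proof. exact: rmorphB. Qed.
Lemma conjcN x : conjc (- x) = - conjc x. Proof. exact: rmorphN. Qed.
Lemma conjcV x : conjc x^-1 = (conjc x)^-1. Proof. exact: fmorphV. Qed.
Lemma conjcR a : conjc a%:C = a%:C. Proof. exact: conjc_real. Qed.
Lemma ler_eps a b : (forall e, 0 < e -> a <= b + e) -> a <= b.
Proof. by move=> h; apply/ler_addgt0Pr. Qed.
End Cabs.

Section Ultra.

Lemma free_ultrafilter : exists U : set_system nat, UltraFilter U /\ \oo `<=` U.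
Proof. exact: ultraFilterLemma. Qed.

(** Fixed once and for all, so that limits taken in different lemmas are compatible and bounded
    sequences converge without extraction. *)
Definition Ufree : set_system nat := sval (cid free_ultrafilter).

Global Instance Ufree_ultra : UltraFilter Ufree.
Proof. by rewrite /Ufree; case: cid => U []. Qed.

Global Instance Ufree_proper : ProperFilter Ufree.
Proof. exact: ultra_proper. Qed.

Lemma Ufree_inf (P : nat -> Prop) (N : nat) :
  (forall n, (N <= n)%N -> P n) -> \forall n \near Ufree, P n.
Proof.
move=> h; have : \oo `<=` Ufree by rewrite /Ufree; case: cid => U [].
by apply; exists N => // n /= /h.
Qed.

(** Arguments by contradiction rest on this: the negation of an eventual property is itself
    eventual, so there is no passage to a subsequence. *)
Lemma Ufree_em (P : nat -> Prop) :
  (\forall n \near Ufree, P n) \/ (\forall n \near Ufree, ~ P n).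
Proof. exact: (in_ultra_setVsetC [set n | P n] Ufree_ultra). Qed.

Lemma Ufree_unbounded (P : nat -> Prop) (N : nat) :
  (\forall n \near Ufree, P n) -> exists n, (N <= n)%N /\ P n.
Proof.
move=> h; have h2 : \forall n \near Ufree, (N <= n)%N by exact: (@Ufree_inf _ N).
by have [n [? ?]] := filter_ex (filterI h2 h); exists n.
Qed.

Variable R : realType.
Implicit Types (x y : nat -> R[i]) (l m : R[i]).

Definition ucvg x l : Prop :=
  forall e : R, 0 < e -> \forall n \near Ufree, cabs (x n - l) < e.

(** The limit is the supremum of the numbers that are eventually lower bounds. *)
Lemma ucvg_real_ex (x : nat -> R) (M : R) :
  (\forall n \near Ufree, `|x n| <= M) ->
  exists l : R, forall e, 0 < e -> \forall n \near Ufree, `|x n - l| < e.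
Proof.
move=> bx; pose A := [set a : R | \forall n \near Ufree, a <= x n].
have sA : has_sup A.
  split; first by exists (- M); apply: filterS bx => n; rewrite ler_norml => /andP[].
  exists M => a Aa; have [n [/= h1 h2]] := filter_ex (filterI Aa bx).
  by apply: le_trans h1 (le_trans (ler_norm _) h2).
exists (sup A) => e e0.
have [a Aa ha] := sup_adherent e0 sA.
(* Otherwise [sup A + e] is eventually a lower bound, hence an element of [A]. *)
have h2 : \forall n \near Ufree, x n < sup A + e.
  case: (Ufree_em (fun n => x n < sup A + e)) => // h.
  have : A (sup A + e) by apply: filterS h => n /negP; rewrite -leNgt.
  by move=> /(sup_upper_bound sA); rewrite gerDl leNgt e0.
apply: filterS2 Aa h2 => n h3 h4; rewrite ltr_norml ltrBlDl h4 andbT ltrBrDl.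
exact: lt_le_trans ha h3.
Qed.

Lemma ucvg_ex x (M : R) : (\forall n \near Ufree, cabs (x n) <= M) ->
  exists l, ucvg x l.
Proof.
move=> bx.
have [|a ha] := @ucvg_real_ex (fun n => Re (x n)) M.
  by apply: filterS bx => n; apply: le_trans (Re_le_cabs _).
have [|b hb] := @ucvg_real_ex (fun n => Im (x n)) M.
  by apply: filterS bx => n; apply: le_trans (Im_le_cabs _).
exists (a +i* b) => e e0; have e20 : 0 < e / 2 by rewrite divr_gt0.
apply: filterS2 (ha _ e20) (hb _ e20) => n h1 h2.
apply: le_lt_trans (cabs_le_ReIm _) _; rewrite ReD ImD ReN ImN /=.
by rewrite [ltRHS](splitr e) ltrD.
Qed.

Lemma ucvg_unique x l m : ucvg x l -> ucvg x m -> l = m.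
Proof.
move=> xl xm; apply/eqP; rewrite -subr_eq0 -cabs_eq0 eq_le cabs_ge0 andbT.
apply/ler_eps => e e0; rewrite add0r.
have e20 : 0 < e / 2 by rewrite divr_gt0.
have [n [/= h1 h2]] := filter_ex (filterI (xl _ e20) (xm _ e20)).
apply: le_trans (cabs_tri (x n) _ _) _; rewrite cabsBC [leRHS](splitr e).
by rewrite ltW // ltrD.
Qed.

Lemma ucvg_cst l : ucvg (fun=> l) l.
Proof. by move=> e e0; apply: filterS filterT => n _; rewrite subrr cabs0. Qed.

Lemma ucvgD x y l m : ucvg x l -> ucvg y m -> ucvg (fun n => x n + y n) (l + m).
Proof.
move=> xl ym e e0; have e20 : 0 < e / 2 by rewrite divr_gt0.
apply: filterS2 (xl _ e20) (ym _ e20) => n h1 h2.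
rewrite opprD addrACA; apply: le_lt_trans (cabsD _ _) _.
by rewrite [ltRHS](splitr e) ltrD.
Qed.

Lemma ucvgZ c x l : ucvg x l -> ucvg (fun n => c * x n) (c * l).
Proof.
move=> xl e e0; have d0 : 0 < e / (cabs c + 1).
  by rewrite divr_gt0 // ltr_pwDr // cabs_ge0.
apply: filterS (xl _ d0) => n h; rewrite -mulrBr cabsM.
apply: le_lt_trans (_ : (cabs c + 1) * cabs (x n - l) < _).
  by rewrite ler_wpM2r ?cabs_ge0 // lerDl.
by rewrite mulrC -ltr_pdivlMr // ltr_pwDr // cabs_ge0.
Qed.

Lemma ucvgN x l : ucvg x l -> ucvg (fun n => - x n) (- l).
Proof. by move=> /(ucvgZ (-1)) + e e0 => /(_ _ e0); under eq_near do rewrite !mulN1r. Qed.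

Lemma ucvgB x y l m : ucvg x l -> ucvg y m -> ucvg (fun n => x n - y n) (l - m).
Proof. by move=> xl /ucvgN; exact: ucvgD. Qed.

Lemma ucvgJ x l : ucvg x l -> ucvg (fun n => conjc (x n)) (conjc l).
Proof.
by move=> xl e /xl; apply: filterS => n; rewrite -rmorphB cabsJ.
Qed.

Lemma ucvg_bounded x l : ucvg x l -> \forall n \near Ufree, cabs (x n) <= cabs l + 1.
Proof.
move=> /(_ _ ltr01); apply: filterS => n h.
rewrite -[x n](subrK l) addrC; apply: le_trans (cabsD _ _) _.
by rewrite lerD2l ltW.
Qed.

Lemma ucvgM x y l m : ucvg x l -> ucvg y m -> ucvg (fun n => x n * y n) (l * m).
Proof.
move=> xl ym.
have h1 : ucvg (fun n => x n * y n - l * y n) 0.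
  move=> e e0; have d0 : 0 < e / (cabs m + 2) by rewrite divr_gt0 // ltr_wpDl // cabs_ge0.
  apply: filterS2 (xl _ d0) (ucvg_bounded ym) => n h1 h2.
  rewrite subr0 -mulrBl cabsM; apply: le_lt_trans (_ : cabs (x n - l) * (cabs m + 1) < _).
    by rewrite ler_wpM2l ?cabs_ge0.
  apply: le_lt_trans (_ : cabs (x n - l) * (cabs m + 2) < _).
    by rewrite ler_wpM2l ?cabs_ge0 // lerD2l ler1n.
  by rewrite -ltr_pdivlMr // ltr_wpDl // cabs_ge0.
have := ucvgD h1 (ucvgZ l ym); rewrite add0r => h e /h.
by apply: filterS => n; rewrite subrK.
Qed.

(** A real majorant is carried as the real part of a complex sequence, so that the same complex
    integral serves integrands and their bounds. *)
Lemma ucvg_le x y l m : ucvg x l -> ucvg y m ->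
  (\forall n \near Ufree, cabs (x n) <= Re (y n)) -> cabs l <= Re m.
Proof.
move=> xl ym h; apply/ler_eps => e e0.
have e20 : 0 < e / 2 by rewrite divr_gt0.
have [n [/= h1 [/= h2 h3]]] := filter_ex (filterI (xl _ e20) (filterI (ym _ e20) h)).
have h4 := cabs_tri (x n) l 0; rewrite !subr0 cabsBC in h4.
have h5 := le_lt_trans (Re_cabs _) h2; rewrite ReB in h5.
lra.
Qed.

Lemma ucvg_cabs x l (M : R) : ucvg x l -> (\forall n \near Ufree, cabs (x n) <= M) -> cabs l <= M.
Proof. by move=> xl; apply: (ucvg_le xl (ucvg_cst M%:C)). Qed.

Lemma ucvg_Re_le x l (M : R) : ucvg x l -> (\forall n \near Ufree, Re (x n) <= M) -> Re l <= M.
Proof.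
move=> xl h; apply/ler_eps => e e0.
have [n [/= h1 h2]] := filter_ex (filterI (xl _ e0) h).
rewrite cabsBC in h1.
have := le_lt_trans (Re_cabs _) h1; rewrite ReB; lra.
Qed.

Lemma ucvg_ev x l : (forall e : R, 0 < e -> exists N, forall n, (N <= n)%N -> cabs (x n - l) < e) ->
  ucvg x l.
Proof. by move=> h e /h [N hN]; exact: (Ufree_inf hN). Qed.

End Ultra.

(** * A finitely additive integral *)

Section Integral.
Variable R : realType.
Implicit Types (u v : R -> R[i]) (a b c x y t : R).

(* Limits of Riemann sums along the ultrafilter give an additive integral of every bounded
   function, so that no regularity of the integrands has to be tracked. The nodes are the
   points k/(N+1) of (a, b]; for negative a or b the truncations make rsum meaningless. *)
Definition rsum (N : nat) a b u : R[i] :=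
  (N.+1%:R^-1)%:C * \sum_((trunc (a * N.+1%:R)).+1 <= k < (trunc (b * N.+1%:R)).+1)
     u (k%:R / N.+1%:R).

Definition bdd a b u : Prop := exists M : R, forall x, a < x <= b -> cabs (u x) <= M.

(** The value 0 is a default for the case without a limit; [integ_cvg] shows that bounded functions
    have one. *)
Definition integ a b u : R[i] := xget 0 [set I | ucvg (fun N => rsum N a b u) I].

Lemma rsum_pt (N k : nat) a b : 0 <= a -> 0 <= b ->
  ((trunc (a * N.+1%:R)).+1 <= k < (trunc (b * N.+1%:R)).+1)%N ->
  a < k%:R / N.+1%:R <= b.
Proof.
move=> a0 b0 /andP[h1 h2]; rewrite ltr_pdivlMr ?ltr0Sn // ler_pdivrMr ?ltr0Sn //.
rewrite ltnS truncn_ge_nat ?mulr_ge0 // in h2; rewrite h2 andbT.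
by apply: lt_le_trans (truncnS_gt _) _; rewrite ler_nat.
Qed.

Lemma rsumD N a b u v : rsum N a b (fun x => u x + v x) = rsum N a b u + rsum N a b v.
Proof. by rewrite /rsum big_split /= mulrDr. Qed.

Lemma rsumZ N a b (c : R[i]) u : rsum N a b (fun x => c * u x) = c * rsum N a b u.
Proof. by rewrite /rsum -mulr_sumr mulrCA. Qed.

Lemma rsumJ N a b u : rsum N a b (fun x => conjc (u x)) = conjc (rsum N a b u).
Proof. by rewrite /rsum rmorphM rmorph_sum /= oppr0. Qed.

Lemma rsum_ext N a b u v : 0 <= a -> 0 <= b -> (forall x, a < x <= b -> u x = v x) ->
  rsum N a b u = rsum N a b v.
Proof.
move=> a0 b0 h; congr (_ * _); rewrite big_nat_cond [RHS]big_nat_cond; apply: eq_bigr => k.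
by rewrite andbT => /rsum_pt -/(_ a0 b0) /h.
Qed.

Lemma rsum_le N a b u v : 0 <= a -> 0 <= b ->
  (forall x, a < x <= b -> cabs (u x) <= Re (v x)) ->
  cabs (rsum N a b u) <= Re (rsum N a b v).
Proof.
move=> a0 b0 h; rewrite /rsum cabsM ReMr cabsR ger0_norm ?invr_ge0 //.
rewrite ler_wpM2l ?invr_ge0 // Re_sum; apply: le_trans (cabs_sum _ _ _) _.
rewrite big_nat_cond [leRHS]big_nat_cond; apply: ler_sum => k.
by rewrite andbT => /rsum_pt -/(_ a0 b0) /h.
Qed.

Lemma trunc_mono (N : nat) a b : a <= b -> (trunc (a * N.+1%:R) <= trunc (b * N.+1%:R))%N.
Proof. by move=> ab; apply: le_truncn; rewrite ler_wpM2r. Qed.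

Lemma rsum_cat N a b c u : a <= b -> b <= c ->
  rsum N a c u = rsum N a b u + rsum N b c u.
Proof.
move=> ab bc; rewrite /rsum -mulrDr; congr (_ * _).
by rewrite -big_cat_nat ?ltnS ?trunc_mono.
Qed.

(** The number of nodes in (a, b] differs from (b - a)(N + 1) by at most 1. *)
Lemma rsum1 N a b : 0 <= a -> a <= b ->
  cabs (rsum N a b (fun=> 1) - (b - a)%:C) <= N.+1%:R^-1.
Proof.
move=> a0 ab; have b0 := le_trans a0 ab.
rewrite /rsum sumr_const_nat subSS natrB ?trunc_mono //.
have n0 : (0 : R) < N.+1%:R by [].
have -> : (N.+1%:R^-1)%:C * ((trunc (b * N.+1%:R))%:R - (trunc (a * N.+1%:R))%:R) - (b - a)%:C
  = (N.+1%:R^-1 * ((trunc (b * N.+1%:R))%:R - (trunc (a * N.+1%:R))%:R - (b - a) * N.+1%:R))%:C :> R[i].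
  rewrite !(rmorphM, rmorphB, fmorphV, rmorph_nat).
  have : (N.+1%:R : R[i]) != 0 by rewrite pnatr_eq0.
  by move: N.+1%:R => z z0; field.
rewrite cabsR normrM gtr0_norm ?invr_gt0 // -[leRHS]mulr1 ler_wpM2l ?invr_ge0 //.
move: N.+1%:R n0 => n n0.
have /andP[h1 h2] := truncn_itv (mulr_ge0 a0 (ltW n0)).
have /andP[h3 h4] := truncn_itv (mulr_ge0 b0 (ltW n0)).
rewrite -natr1 in h2; rewrite -natr1 in h4.
move: h1 h2 h3 h4; set ta := (trunc (a * _))%:R; set tb := (trunc (b * _))%:R.
by move=> *; rewrite ler_norml; apply/andP; split; lra.
Qed.

Lemma rsum1_cvg a b : 0 <= a -> a <= b ->
  ucvg (fun N => rsum N a b (fun=> 1)) (b - a)%:C.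
Proof.
move=> a0 ab; apply: ucvg_ev => e e0; exists (trunc e^-1) => n hn.
apply: le_lt_trans (rsum1 _ a0 ab) _.
rewrite -[e]invrK ltf_pV2 ?posrE ?invr_gt0 //.
by apply: lt_le_trans (truncnS_gt _) _; rewrite ler_nat ltnS.
Qed.

Lemma rsum_cst_cvg a b (c : R[i]) : 0 <= a -> a <= b ->
  ucvg (fun N => rsum N a b (fun=> c)) (c * (b - a)%:C).
Proof.
move=> a0 ab e e0; have := ucvgZ c (rsum1_cvg a0 ab) e0.
by apply: filterS => n; rewrite -rsumZ /= mulr1.
Qed.

Lemma integ_cvg a b u : 0 <= a -> a <= b -> bdd a b u ->
  ucvg (fun N => rsum N a b u) (integ a b u).
Proof.
move=> a0 ab [M hM]; apply: xgetPex.
have h1 := rsum_cst_cvg M%:C a0 ab.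
apply: (@ucvg_ex _ _ (cabs (M%:C * (b - a)%:C) + 1)).
apply: filterS (ucvg_bounded h1) => n h2.
apply: le_trans h2; apply: le_trans (Re_cabs _).
exact: (rsum_le _ a0 (le_trans a0 ab)).
Qed.

Lemma integ_uniq a b u I : ucvg (fun N => rsum N a b u) I -> integ a b u = I.
Proof. by move=> h; apply: xget_unique => // J hJ; exact: ucvg_unique hJ h. Qed.

Lemma bddD a b u v : bdd a b u -> bdd a b v -> bdd a b (fun x => u x + v x).
Proof.
move=> [M hM] [K hK]; exists (M + K) => x hx.
by apply: le_trans (cabsD _ _) (lerD (hM _ hx) (hK _ hx)).
Qed.

Lemma bddM a b u v : bdd a b u -> bdd a b v -> bdd a b (fun x => u x * v x).
Proof.
move=> [M hM] [K hK]; exists (M * K) => x hx.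
by rewrite cabsM ler_pM ?cabs_ge0 ?hM ?hK.
Qed.

Lemma bdd_cst a b (c : R[i]) : bdd a b (fun=> c).
Proof. by exists (cabs c). Qed.

Lemma bddN a b u : bdd a b u -> bdd a b (fun x => - u x).
Proof. by move=> [M hM]; exists M => x hx; rewrite cabsN hM. Qed.

Lemma bddB a b u v : bdd a b u -> bdd a b v -> bdd a b (fun x => u x - v x).
Proof. by move=> hu /bddN; exact: bddD. Qed.

Lemma bddJ a b u : bdd a b u -> bdd a b (fun x => conjc (u x)).
Proof. by move=> [M hM]; exists M => x hx; rewrite cabsJ hM. Qed.

Lemma bdd_sub a b c d u : c <= a -> b <= d -> bdd c d u -> bdd a b u.
Proof.
move=> ca bd [M hM]; exists M => x /andP[h1 h2]; apply: hM.
by rewrite (le_lt_trans ca h1) (le_trans h2 bd).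
Qed.

Section Fixed.
Variables (a b : R).
Hypotheses (a0 : 0 <= a) (ab : a <= b).
Let b0 := le_trans a0 ab.

Lemma integD u v : bdd a b u -> bdd a b v ->
  integ a b (fun x => u x + v x) = integ a b u + integ a b v.
Proof.
move=> hu hv; apply: integ_uniq => e e0.
have := ucvgD (integ_cvg a0 ab hu) (integ_cvg a0 ab hv) e0.
by apply: filterS => n; rewrite rsumD.
Qed.

Lemma integZ (c : R[i]) u : bdd a b u -> integ a b (fun x => c * u x) = c * integ a b u.
Proof.
move=> hu; apply: integ_uniq => e e0.
by have := ucvgZ c (integ_cvg a0 ab hu) e0; apply: filterS => n; rewrite rsumZ.
Qed.

Lemma integJ u : bdd a b u -> integ a b (fun x => conjc (u x)) = conjc (integ a b u).
Proof.
move=> hu; apply: integ_uniq => e e0.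
by have := ucvgJ (integ_cvg a0 ab hu) e0; apply: filterS => n; rewrite rsumJ.
Qed.

Lemma integ_ext u v : (forall x, a < x <= b -> u x = v x) -> integ a b u = integ a b v.
Proof.
move=> h; rewrite /integ.
have -> // : (fun N => rsum N a b u) = (fun N => rsum N a b v).
by apply/funext => N; exact: (rsum_ext N a0 b0 h).
Qed.

Lemma integB u v : bdd a b u -> bdd a b v ->
  integ a b (fun x => u x - v x) = integ a b u - integ a b v.
Proof.
move=> hu hv; rewrite integD //; last exact: bddN.
by rewrite -(mulN1r (integ a b v)) -integZ //; congr (_ + _); apply: integ_ext => x _; rewrite mulN1r.
Qed.

Lemma integ_cst (c : R[i]) : integ a b (fun=> c) = c * (b - a)%:C.
Proof. by apply: integ_uniq; exact: rsum_cst_cvg. Qed.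

Lemma integ_le u v : bdd a b v -> (forall x, a < x <= b -> cabs (u x) <= Re (v x)) ->
  cabs (integ a b u) <= Re (integ a b v).
Proof.
move=> hv huv; have hu : bdd a b u.
  by case: hv => M hM; exists M => x hx; apply: le_trans (huv _ hx) (le_trans (Re_cabs _) (hM _ hx)).
apply: (ucvg_le (integ_cvg a0 ab hu) (integ_cvg a0 ab hv)).
by apply: filterS filterT => n _; exact: (rsum_le n a0 b0 huv).
Qed.

Lemma integ_bound u (M : R) : (forall x, a < x <= b -> cabs (u x) <= M) ->
  cabs (integ a b u) <= M * (b - a).
Proof.
move=> hM; have := @integ_le u (fun=> M%:C) (bdd_cst _ _ _) hM.
by rewrite integ_cst -rmorphM.
Qed.
End Fixed.

Lemma integ_cat a b c u : 0 <= a -> a <= b -> b <= c -> bdd a c u ->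
  integ a c u = integ a b u + integ b c u.
Proof.
move=> a0 ab bc hu; apply: integ_uniq => e e0.
have h1 := integ_cvg a0 ab (bdd_sub (lexx _) bc hu).
have h2 := integ_cvg (le_trans a0 ab) bc (bdd_sub ab (lexx _) hu).
by have := ucvgD h1 h2 e0; apply: filterS => n; rewrite -rsum_cat.
Qed.

(** The error on an interval is quadratic in its length, so each bisection halves the sum of the
    errors; n bisections leave a factor 2^-n. *)
Lemma integ_FTC a b (F : R -> R[i]) u (C : R) : 0 <= a -> a <= b -> bdd a b u ->
  (forall x t y, a <= x -> x <= t -> t <= y -> y <= b ->
     cabs (F y - F x - u t * (y - x)%:C) <= C * (y - x) ^+ 2) ->
  integ a b u = F b - F a.
Proof.
move=> a0 ab hu hF.
suff H n x y : a <= x -> x <= y -> y <= b ->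
    cabs (integ x y u - (F y - F x)) <= C * (y - x) ^+ 2 / 2 ^+ n.
  apply/eqP; rewrite -subr_eq0 -cabs_eq0 eq_le cabs_ge0 andbT.
  apply/ler_eps => e e0; rewrite add0r.
  set K := C * (b - a) ^+ 2.
  have K0 : 0 <= K by have := H 0%N a b (lexx _) ab (lexx _); rewrite divr1; apply: le_trans (cabs_ge0 _).
  pose n := trunc (K / e); apply: le_trans (H n a b (lexx _) ab (lexx _)) _.
  rewrite -/K ler_pdivrMr ?exprn_gt0 // -ler_pdivrMl // mulrC.
  apply: ltW; apply: lt_le_trans (truncnS_gt _) _.
  by rewrite -natrX ler_nat -/n ltn_expl.
elim: n x y => [|n IH] x y ax xy yb.
  rewrite divr1; have [->|ne] := eqVneq x y.
    have := integ_bound (le_trans a0 (le_trans ax xy)) (lexx y) (u := u) (M := 0).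
    rewrite !subrr mul0r subr0 expr0n mulr0; apply => t /andP[h1 h2].
    by have := lt_le_trans h1 h2; rewrite ltxx.
  have yx : 0 < y - x by rewrite subr_gt0 lt_neqAle ne.
  have x0 := le_trans a0 ax.
  have w0 : (y - x)%:C != 0 :> R[i] by rewrite -cabs_eq0 cabsR gtr0_norm // gt_eqF.
  (* The increment is the integral of the mean slope, which leaves a pointwise bound on [u] minus
     that slope. *)
  have -> : F y - F x = integ x y (fun=> (F y - F x) / (y - x)%:C).
    by rewrite integ_cst // divfK.
  rewrite -integB //; [|exact: bdd_sub hu|exact: bdd_cst].
  rewrite expr2 mulrA; apply: integ_bound => // t /andP[h1 h2].
  have := hF x t y ax (ltW h1) h2 yb.
  have -> : u t - (F y - F x) / (y - x)%:C = - (F y - F x - u t * (y - x)%:C) * ((y - x)^-1)%:C.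
    by rewrite fmorphV /=; move: w0; move: (_ - _)%:C => w w0; field.
  rewrite cabsM cabsN cabsR gtr0_norm ?invr_gt0 // => h.
  by rewrite ler_pdivrMr // -mulrA -expr2.
pose m := (x + y) / 2.
have xm : x <= m by rewrite /m; lra.
have my : m <= y by rewrite /m; lra.
rewrite (integ_cat (le_trans a0 ax) xm my); last exact: bdd_sub hu.
have -> : integ x m u + integ m y u - (F y - F x) =
  (integ x m u - (F m - F x)) + (integ m y u - (F y - F m)) by ring.
apply: le_trans (cabsD _ _) _.
apply: le_trans (lerD (IH x m ax xm (le_trans my yb)) (IH m y (le_trans ax xm) my yb)) _.
rewrite -mulrDl [2 ^+ n.+1]exprS invfM [leRHS]mulrA ler_wpM2r ?invr_ge0 ?exprn_ge0 //.
by rewrite le_eqVlt; apply/orP; left; apply/eqP; rewrite /m; field.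
Qed.

End Integral.

(** * Bisection and complex differentiability *)

Section Bisection.
Variable R : realType.

(* E is the absolute value of an additive function of rectangles (corner x, y, sides s, t). *)
Lemma bisection (E : R -> R -> R -> R -> R) (x0 y0 h k : R) :
  0 <= h -> 0 <= k ->
  (forall x y s t, x0 <= x -> y0 <= y -> 0 <= s -> 0 <= t ->
     x + s <= x0 + h -> y + t <= y0 + k ->
     E x y s t <= E x y (s / 2) (t / 2) + E (x + s / 2) y (s / 2) (t / 2)
        + E x (y + t / 2) (s / 2) (t / 2) + E (x + s / 2) (y + t / 2) (s / 2) (t / 2)) ->
  (forall px py, x0 <= px <= x0 + h -> y0 <= py <= y0 + k -> forall e, 0 < e ->
     exists2 d, 0 < d & forall x y t, 0 < t -> t < d ->
       x0 <= x -> y0 <= y -> x + h * t <= x0 + h -> y + k * t <= y0 + k ->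
       x <= px <= x + h * t -> y <= py <= y + k * t ->
       E x y (h * t) (k * t) <= e * t ^+ 2) ->
  E x0 y0 h k <= 0.
Proof.
move=> h0 k0 sub loc; rewrite leNgt; apply/negP; set E0 := E x0 y0 h k => E0_gt0.
pose c n : R := (2 ^+ n)^-1.
have c0 n : 0 < c n by rewrite invr_gt0 exprn_gt0.
have cS n : c n / 2 = c n.+1 by rewrite /c exprS invfM mulrC.
(* A rectangle of level n is big if it carries at least its share by area, 4^-n, of [E0]. *)
pose big n (p : R * R) := E0 * c n ^+ 2 <= E p.1 p.2 (h * c n) (k * c n).
(* The fourth quarter is taken without a test: by [sub] it is big when the other three are not. *)
pose step n (p : R * R) : R * R :=
  if big n.+1 p then p else
  if big n.+1 (p.1 + h * c n.+1, p.2) then (p.1 + h * c n.+1, p.2) else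
  if big n.+1 (p.1, p.2 + k * c n.+1) then (p.1, p.2 + k * c n.+1) else
  (p.1 + h * c n.+1, p.2 + k * c n.+1).
pose u := fix u n := if n is m.+1 then step m (u m) else (x0, y0).
have hc n : 0 <= h * c n by rewrite mulr_ge0 // ltW.
have kc n : 0 <= k * c n by rewrite mulr_ge0 // ltW.
have hS n : h * c n = h * c n.+1 + h * c n.+1 by rewrite -cS; field.
have kS n : k * c n = k * c n.+1 + k * c n.+1 by rewrite -cS; field.
have u1 n : (u n).1 <= (u n.+1).1 /\ (u n.+1).1 + h * c n.+1 <= (u n).1 + h * c n.
  have := hc n.+1; rewrite (hS n) /= /step; set X := h * c n.+1; move=> X0.
  by do 3?case: ifP => _ /=; split; lra.
have u2 n : (u n).2 <= (u n.+1).2 /\ (u n.+1).2 + k * c n.+1 <= (u n).2 + k * c n.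
  have := kc n.+1; rewrite (kS n) /= /step; set X := k * c n.+1; move=> X0.
  by do 3?case: ifP => _ /=; split; lra.
have mono1 n m : (u n).1 <= (u (n + m)%N).1 /\ (u (n + m)%N).1 + h * c (n + m)%N <= (u n).1 + h * c n.
  elim: m => [|m [i1 i2]]; first by rewrite addn0.
  by rewrite addnS; have [j1 j2] := u1 (n + m)%N; split; [exact: le_trans j1|exact: le_trans i2].
have mono2 n m : (u n).2 <= (u (n + m)%N).2 /\ (u (n + m)%N).2 + k * c (n + m)%N <= (u n).2 + k * c n.
  elim: m => [|m [i1 i2]]; first by rewrite addn0.
  by rewrite addnS; have [j1 j2] := u2 (n + m)%N; split; [exact: le_trans j1|exact: le_trans i2].
have c00 : c 0%N = 1 by rewrite /c expr0 invr1.
have dom n : [/\ x0 <= (u n).1, y0 <= (u n).2, (u n).1 + h * c n <= x0 + h & (u n).2 + k * c n <= y0 + k].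
  have [a1 a2] := mono1 0%N n; have [b1 b2] := mono2 0%N n.
  by rewrite add0n c00 /= !mulr1 in a1 a2 b1 b2; split.
have bigu n : big n (u n).
  elim: n => [|n IH]; first by rewrite /big c00 expr1n !mulr1.
  have [d1 d2 d3 d4] := dom n.
  have := sub _ _ _ _ d1 d2 (hc n) (kc n) d3 d4.
  rewrite -!mulrA cS /= => ES.
  rewrite /= /step; case: ifP => //= /negbT; rewrite /big -ltNge /= => B1.
  case: ifP => //= /negbT; rewrite -ltNge /= => B2.
  case: ifP => //= /negbT; rewrite -ltNge /= => B3.
  rewrite leNgt; apply/negP => B4.
  have : E0 * c n ^+ 2 <= E (u n).1 (u n).2 (h * c n) (k * c n) by [].
  have -> : E0 * c n ^+ 2 = E0 * c n.+1 ^+ 2 + E0 * c n.+1 ^+ 2 + E0 * c n.+1 ^+ 2 + E0 * c n.+1 ^+ 2.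
    by rewrite -cS; field.
  by rewrite /= in ES B4 *; lra.
have lim (v w : nat -> R) : (forall n m, v n <= v (n + m)%N /\ v (n + m)%N + w (n + m)%N <= v n + w n) ->
    (forall n, 0 <= w n) -> exists p, forall n, v n <= p <= v n + w n.
  move=> vm w0; have ub n m : v n <= v m + w m.
    have [nm|/ltnW mn] := leqP n m.
      by have [] := vm n (m - n)%N; rewrite subnKC // => i1 _; apply: le_trans i1 _; rewrite lerDl.
    have [_] := vm m (n - m)%N; rewrite subnKC // => i1.
    by apply: le_trans i1; rewrite lerDl.
  have hs : has_sup (range v).
    by split; [exists (v 0%N); exists 0%N|exists (v 0%N + w 0%N) => _ [n _ <-]].
  exists (sup (range v)) => n; apply/andP; split.
    by apply: sup_upper_bound => //; exists n.
  by apply: ge_sup; [exists (v 0%N); exists 0%N|move=> _ [m _ <-]].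
have [px hpx] := lim (fun n => (u n).1) (fun n => h * c n) mono1 hc.
have [py hpy] := lim (fun n => (u n).2) (fun n => k * c n) mono2 kc.
have px0 := hpx 0%N; have py0 := hpy 0%N; rewrite c00 /= !mulr1 in px0 py0.
have e0 : 0 < E0 / 2 by rewrite divr_gt0.
have [d d0 H] := loc px py px0 py0 _ e0.
(* Then 1/d < n + 1 <= 2^n. At this scale the local estimate with [E0 / 2] contradicts bigness. *)
pose n := trunc d^-1.
have cd : c n < d.
  rewrite /c -[d]invrK ltf_pV2 ?posrE ?invr_gt0 ?exprn_gt0 //.
  apply: lt_le_trans (truncnS_gt _) _; rewrite -natrX ler_nat -/n; exact: ltn_expl.
have [d1 d2 d3 d4] := dom n.
have := H _ _ _ (c0 n) cd d1 d2 d3 d4 (hpx n) (hpy n).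
apply/negP; rewrite -ltNge; apply: lt_le_trans (bigu n).
by rewrite ltr_pM2r ?exprn_gt0 // ltr_pdivrMr // ltr_pMr // ltr1n.
Qed.

End Bisection.

(** * Complex differentiability as a first-order expansion *)

Section LocalExpansion.
Variable R : realType.
Local Notation C := (R[i]).
Implicit Types (f : C -> C) (z w : C).

(** On a one-dimensional space this is equivalent to [derivable], used in [holo_on_disc]; sums,
    products, inverses and compositions are then covered by the differential calculus. *)
Definition hol f z : Prop := differentiable (f : C^o -> C^o) (z : C^o).

(** The norm on [R[i]] takes complex values; here radii and errors become real numbers measured by
    [cabs]. *)
Lemma hol_local f z : hol f z ->
  exists c : C, forall e : R, 0 < e -> exists2 d : R, 0 < d &
    forall w, cabs (w - z) < d -> cabs (f w - f z - c * (w - z)) <= e * cabs (w - z).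
Proof.
move=> /derivable1_diffP /cvg_ex [c hc]; exists c => e e0.
have e0' : (0 : C) < e%:C by rewrite ltcR.
move: hc => /cvgrPdist_lt /(_ _ e0') /=.
move=> /nbhs_ballP [d /= d0 hd].
have dR : d = (Re d)%:C by move: d0; rewrite ltcE /= => /andP[/eqP]; case: (d) => a b /= ->.
exists (Re d); first by move: d0; rewrite dR ltcR.
move=> w hw; have [->|ne] := eqVneq w z; first by rewrite !subrr mulr0 subrr cabs0 mulr0.
have h0 : w - z != 0 by rewrite subr_eq0.
have hb : ball (0 : C^o) d (w - z : C^o).
  by rewrite -ball_normE /ball_ /= sub0r normrN normc_def dR ltcR; move: hw; case: (w - z).
have := hd (w - z) hb h0.
rewrite /= scaler1 /GRing.scale /= subrK normc_def ltcR.
set A := c - _ => hA.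
have {hA} hA : cabs A < e by move: hA; case: A.
have -> : f w - f z - c * (w - z) = - (w - z) * A.
  by rewrite /A; move: h0; set t : C := w - z => t0; field.
by rewrite cabsM cabsN mulrC ler_wpM2r ?cabs_ge0 // ltW.
Qed.

(** The quadratic remainder is what an explicit kernel provides, see [cauchy_integral_hol]. *)
Lemma local_hol f z (c : C) (K d : R) : 0 < d ->
  (forall w, cabs (w - z) < d -> cabs (f w - f z - c * (w - z)) <= K * cabs (w - z) ^+ 2) ->
  hol f z.
Proof.
move=> d0 H; apply/derivable1_diffP/cvg_ex; exists c; apply/cvgrPdist_lt => e e0.
have eR : e = (Re e)%:C by move: e0; rewrite ltcE /= => /andP[/eqP]; case: (e) => a b /= ->.
have e1 : 0 < Re e by move: e0; rewrite eR ltcR.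
pose d' := Num.min d (Re e / (`|K| + 1)).
have K1 : 0 < `|K| + 1 by rewrite ltr_wpDl.
have d'0 : 0 < d' by rewrite lt_min d0 divr_gt0.
apply/nbhs_ballP; exists (d'%:C); first by rewrite /= ltcR.
move=> h; rewrite -ball_normE /ball_ /= sub0r normrN normc_def ltcR => hh h0.
have {hh} : cabs h < d' by move: hh; case: (h).
rewrite lt_min => /andP[hd1 hd2].
rewrite scaler1 /GRing.scale /= normc_def eR ltcR.
have := H (h + z); rewrite addrK => /(_ hd1) Hh.
set A := c - _; suff : cabs A < Re e by case: A.
have -> : A = - (f (h + z) - f z - c * h) * h^-1 by rewrite /A; field.
rewrite cabsM cabsN cabsV ltr_pdivrMr ?cabs_gt0 //.
apply: le_lt_trans Hh _; rewrite expr2 mulrA ltr_pM2r ?cabs_gt0 //.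
apply: le_lt_trans (_ : (`|K| + 1) * cabs h < _).
  by rewrite ler_wpM2r ?cabs_ge0 // (le_trans (ler_norm _)) // lerDl.
by rewrite mulrC -ltr_pdivlMr.
Qed.

Lemma hol_lip f z : hol f z -> exists2 K : R, 0 < K & exists2 d : R, 0 < d &
    forall w, cabs (w - z) < d -> cabs (f w - f z) <= K * cabs (w - z).
Proof.
move=> /hol_local [c /(_ _ ltr01) [d d0 H]].
exists (cabs c + 1); first by rewrite ltr_wpDl ?cabs_ge0.
exists d => // w /H h; have -> : f w - f z = c * (w - z) + (f w - f z - c * (w - z)) by ring.
by apply: le_trans (cabsD _ _) _; rewrite cabsM mulrDl lerD2l.
Qed.

Lemma hol_cont f z : hol f z -> forall e, 0 < e -> exists2 d : R, 0 < d &
    forall w, cabs (w - z) < d -> cabs (f w - f z) < e.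
Proof.
move=> /hol_lip [K K0 [d d0 H]] e e0; exists (Num.min d (e / K)).
  by rewrite lt_min d0 divr_gt0.
move=> w; rewrite lt_min => /andP[/H h1 h2]; apply: le_lt_trans h1 _.
by rewrite mulrC -ltr_pdivlMr.
Qed.

Lemma ucvg_comp f z (x : nat -> C) : hol f z -> ucvg x z -> ucvg (fun n => f (x n)) (f z).
Proof.
move=> hf xz e e0; have [d d0 H] := hol_cont hf e0.
by apply: filterS (xz _ d0) => n; exact: H.
Qed.

(** Compactness of the closed disc: points where |f| exceeds n + 1 would have a limit along the
    ultrafilter, where f is continuous. *)
Lemma hol_bounded f (r : R) : (forall w, cabs w <= r -> hol f w) ->
  exists2 M : R, 0 < M & forall w, cabs w <= r -> cabs (f w) <= M.
Proof.
move=> hf; apply: contrapT => nM.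
have H n : exists w, cabs w <= r /\ n.+1%:R < cabs (f w).
  apply: contrapT => h; apply: nM; exists (n.+1%:R) => // w wr.
  by rewrite leNgt; apply/negP => h2; apply: h; exists w.
have [x hx] := choice H.
have [|l xl] := @ucvg_ex _ x r; first by apply: filterS filterT => n _; case: (hx n).
have lr : cabs l <= r by apply: (ucvg_cabs xl); apply: filterS filterT => n _; case: (hx n).
have b := ucvg_bounded (ucvg_comp (hf _ lr) xl).
have [n [h1 h2]] := Ufree_unbounded (trunc (cabs (f l) + 1)) b.
have [_ h3] := hx n.
have h4 := truncnS_gt (cabs (f l) + 1).
have h5 : ((trunc (cabs (f l) + 1)).+1%:R : R) <= n.+1%:R by rewrite ler_nat ltnS.
by have := lt_trans (lt_le_trans h4 h5) (lt_le_trans h3 h2); rewrite ltxx.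
Qed.

Lemma hol_cst c z : hol (fun=> c) z. Proof. exact: differentiable_cst. Qed.
Lemma hol_id z : hol id z.
Proof. by apply: (@local_hol id z 1 0 1) => // w _; rewrite mul1r subrr cabs0 mul0r. Qed.
Lemma holD f g z : hol f z -> hol g z -> hol (fun w => f w + g w) z.
Proof. exact: differentiableD. Qed.
Lemma holN f z : hol f z -> hol (fun w => - f w) z.
Proof. exact: differentiableN. Qed.
Lemma holB f g z : hol f z -> hol g z -> hol (fun w => f w - g w) z.
Proof. exact: differentiableB. Qed.
Lemma holM f g z : hol f z -> hol g z -> hol (fun w => f w * g w) z.
Proof. exact: differentiableM. Qed.
Lemma holV f z : hol f z -> f z != 0 -> hol (fun w => (f w)^-1) z.
Proof. exact: differentiableV. Qed.
Lemma hol_comp f g z : hol g z -> hol f (g z) -> hol (fun w => f (g w)) z.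
Proof. 
move=> hg hf.
exact: (@differentiable_comp _ (C^o) (C^o) (C^o) g f z hg hf). Qed.
Lemma hol_sum (I : Type) (s : seq I) (F : I -> C -> C) z :
  (forall i, hol (F i) z) -> hol (fun w => \sum_(i <- s) F i w) z.
Proof.
move=> h; elim: s => [|i s IH].
  by have -> : (fun w => \sum_(i <- [::]) F i w) = (fun=> 0) by apply/funext => w; rewrite big_nil.
have -> : (fun w => \sum_(j <- i :: s) F j w) = (fun w => F i w + \sum_(j <- s) F j w).
  by apply/funext => w; rewrite big_cons.
exact: holD.
Qed.
End LocalExpansion.

(** * Goursat's argument in polar coordinates *)

Section Circle.
Variable R : realType.
Local Notation C := (R[i]).

Definition cis (t : R) : C := cos t +i* sin t.

Lemma cabs_cis t : cabs (cis t) = 1.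
Proof. by rewrite /cabs /cis cos2Dsin2 sqrtr1. Qed.

Lemma cos_sub_le (x y : R) : `|cos y - cos x| <= `|y - x|.
Proof.
wlog xy : x y / x <= y.
  by move=> H; have [/H //|/ltW /H] := leP x y; rewrite distrC [leRHS]distrC.
have [|c _ ->] := @MVT_segment R cos (fun t => - sin t) x y xy.
  exact/continuous_subspaceT/continuous_cos.
by rewrite normrM normrN ler_piMl ?normr_ge0 // ler_norml sin_geN1 sin_le1.
Qed.

Lemma sin_sub_le (x y : R) : `|sin y - sin x| <= `|y - x|.
Proof.
wlog xy : x y / x <= y.
  by move=> H; have [/H //|/ltW /H] := leP x y; rewrite distrC [leRHS]distrC.
have [|c _ ->] := @MVT_segment R sin cos x y xy.
  exact/continuous_subspaceT/continuous_sin.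
by rewrite normrM ler_piMl ?normr_ge0 // ler_norml cos_geN1 cos_le1.
Qed.

Lemma cis_lip x y : cabs (cis y - cis x) <= 2 * `|y - x|.
Proof.
apply: le_trans (cabs_le_ReIm _) _; rewrite mulr_natl mulr2n.
by rewrite lerD // ?cos_sub_le ?sin_sub_le.
Qed.

(** The mean value theorem applies to each coordinate separately, and moving from its intermediate
    points to t costs another factor y - x. *)
Lemma cis_FTC (x t y : R) : x <= t -> t <= y ->
  cabs (cis y - cis x - 'i * cis t * (y - x)%:C) <= 2 * (y - x) ^+ 2.
Proof.
move=> xt ty; have xy := le_trans xt ty.
have [|c1 c1xy e1] := @MVT_segment R cos (fun t => - sin t) x y xy.
  exact/continuous_subspaceT/continuous_cos.
have [|c2 c2xy e2] := @MVT_segment R sin cos x y xy.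
  exact/continuous_subspaceT/continuous_sin.
have -> : cis y - cis x - 'i * cis t * (y - x)%:C =
   ((sin t - sin c1) * (y - x)) +i* ((cos c2 - cos t) * (y - x)).
  apply/eqP; rewrite eq_complex /=; apply/andP; split; apply/eqP.
    rewrite -[X in X + _]/(cos y - cos x) e1; ring.
  rewrite -[X in X + _]/(sin y - sin x) e2; ring.
apply: le_trans (cabs_le_ReIm _) _ => /=.
move: c1xy c2xy; rewrite !in_itv /= => /andP[a1 a2] /andP[b1 b2].
rewrite !normrM -mulrDl (ger0_norm (_ : 0 <= y - x)) ?subr_ge0 // expr2 mulrA.
rewrite ler_wpM2r ?subr_ge0 // mulr_natl mulr2n; apply: lerD.
  by apply: le_trans (sin_sub_le _ _) _; rewrite ler_norml; apply/andP; split; lra.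
by apply: le_trans (cos_sub_le _ _) _; rewrite ler_norml; apply/andP; split; lra.
Qed.

Local Notation tpi := (pi *+ 2 : R).

Lemma tpi_gt0 : 0 < tpi. Proof. by rewrite mulrn_wgt0 // pi_gt0. Qed.
Let tpi0 := ltW tpi_gt0.

Lemma cis_tpi : cis tpi = cis 0.
Proof. by rewrite /cis cos2pi sin2pi cos0 sin0. Qed.

Section Goursat.
Variables (r : R) (z : C).
Hypotheses (r0 : 0 < r) (zr : cabs z < r).
Implicit Types (g : C -> C) (x y s t : R).
Let zeta t : C := r%:C * cis t.
Let W s t : C := z + s%:C * (zeta t - z).
(** In the coordinates [W] the form dw / (w - z) is ds / s + [kap t] dt: the factor s cancels in the
    angular part. *)
Let kap t : C := 'i * zeta t / (zeta t - z).
Let K : R := r / (r - cabs z).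

Let cabs_zeta t : cabs (zeta t) = r.
Proof. by rewrite cabsM cabs_cis mulr1 cabsR gtr0_norm. Qed.

Let zeta_z t : r - cabs z <= cabs (zeta t - z).
Proof. by have := cabs_tri z (zeta t) 0; rewrite !subr0 cabs_zeta lerBlDr. Qed.

Let rz0 : 0 < r - cabs z. Proof. by rewrite subr_gt0. Qed.

Let zeta_z0 t : zeta t - z != 0.
Proof. by rewrite -cabs_gt0 (lt_le_trans rz0). Qed.

Let kapK t : cabs (kap t) <= K.
Proof.
rewrite /kap (cabsM ('i * zeta t)) (cabsM 'i) cabsi mul1r cabsV cabs_zeta ler_pM2l // lef_pV2 ?posrE //.
exact: lt_le_trans (zeta_z t).
Qed.

Let K0 : 0 <= K. Proof. by rewrite divr_ge0 // ltW. Qed.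

Let Wr s t : 0 <= s <= 1 -> cabs (W s t) <= r.
Proof.
move=> /andP[s0 s1].
have -> : W s t = (1 - s)%:C * z + s%:C * zeta t by rewrite /W rmorphB /=; ring.
apply: le_trans (cabsD _ _) _; rewrite (cabsM (1 - s)%:C) (cabsM s%:C) cabs_zeta !cabsR !ger0_norm ?subr_ge0 //.
have : (1 - s) * cabs z <= (1 - s) * r by rewrite ler_wpM2l ?subr_ge0 // ltW.
lra.
Qed.

Let W_lip s t s' t' : 0 <= s' <= 1 ->
  cabs (W s t - W s' t') <= 2 * r * (`|s - s'| + `|t - t'|).
Proof.
move=> /andP[s0 s1].
have -> : W s t - W s' t' = (s - s')%:C * (zeta t - z) + s'%:C * (r%:C * (cis t - cis t')).
  by rewrite /W /zeta rmorphB /=; ring.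
apply: le_trans (cabsD _ _) _; rewrite [leRHS]mulrDr; apply: lerD.
  rewrite (cabsM (s - s')%:C) cabsR mulrC ler_wpM2r //; apply: le_trans (cabsD _ _) _.
  by rewrite cabsN cabs_zeta mulr_natl mulr2n lerD2l ltW.
rewrite (cabsM s'%:C) (cabsM r%:C) !cabsR (ger0_norm s0) (gtr0_norm r0) -[leRHS]mul1r.
have h : r * cabs (cis t - cis t') <= 2 * r * `|t - t'|.
  by rewrite (mulrC 2) -mulrA ler_pM2l // cis_lip.
by apply: ler_pM h => //; rewrite mulr_ge0 ?cabs_ge0 // ltW.
Qed.

(* EE is the integral of g(w) dw / (w - z) around the boundary of a rectangle in the
   coordinates w = W s t = z + s (zeta t - z). The radial kernel is 1/s, so s stays
   away from 0. *)
Let EE g x1 x2 y1 y2 : C :=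
  integ y1 y2 (fun t => (g (W x2 t) - g (W x1 t)) * kap t)
  - integ x1 x2 (fun s => (g (W s y2) - g (W s y1)) * (s^-1)%:C).

Let bnd g := exists M : R, forall w, cabs w <= r -> cabs (g w) <= M.

Let bdd1 g x1 x2 y1 y2 : bnd g -> 0 <= x1 <= 1 -> 0 <= x2 <= 1 ->
  bdd y1 y2 (fun t => (g (W x2 t) - g (W x1 t)) * kap t).
Proof.
move=> [M hM] h1 h2; apply: bddM; last by exists K.
by apply: bddB; exists M => t _; apply: hM; exact: Wr.
Qed.

Let bdd2 g x1 x2 y1 y2 : bnd g -> 0 < x1 -> x2 <= 1 ->
  bdd x1 x2 (fun s => (g (W s y2) - g (W s y1)) * (s^-1)%:C).
Proof.
move=> [M hM] h1 h2; apply: bddM.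
  by apply: bddB; exists M => s /andP[a b]; apply: hM; apply: Wr;
    rewrite (le_trans b h2) (ltW (lt_trans h1 a)).
exists x1^-1 => s /andP[a b]; rewrite cabsR ger0_norm ?invr_ge0 ?(ltW (lt_trans h1 a)) //.
by rewrite lef_pV2 ?posrE // ?ltW // (lt_trans h1).
Qed.

Let EE_D g1 g2 x1 x2 y1 y2 : bnd g1 -> bnd g2 -> 0 < x1 -> x1 <= x2 -> x2 <= 1 ->
  0 <= y1 -> y1 <= y2 ->
  EE (fun w => g1 w + g2 w) x1 x2 y1 y2 = EE g1 x1 x2 y1 y2 + EE g2 x1 x2 y1 y2.
Proof.
move=> b1 b2 x10 x12 x21 y10 y12; have x10' := ltW x10.
have x1i : 0 <= x1 <= 1 by rewrite x10' (le_trans x12).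
have x2i : 0 <= x2 <= 1 by rewrite x21 (le_trans x10').
have e1 := integD y10 y12 (bdd1 y1 y2 b1 x1i x2i) (bdd1 y1 y2 b2 x1i x2i).
have e2 := integD x10' x12 (bdd2 y1 y2 b1 x10 x21) (bdd2 y1 y2 b2 x10 x21).
rewrite /EE; apply: etrans (_ : _ = _ - _) _; last first.
  rewrite addrACA -opprD -e1 -e2; reflexivity.
by congr (_ - _); apply: integ_ext => // t _; ring.
Qed.

(* An affine integrand has an explicit primitive: this is what makes the local term of
   Goursat's argument of second order. *)
Let EE_affine (A B : C) x1 x2 y1 y2 : 0 < x1 -> x1 <= x2 -> x2 <= 1 -> 0 <= y1 -> y1 <= y2 ->
  EE (fun w => A + B * w) x1 x2 y1 y2 = 0.
Proof.
move=> x10 x12 x21 y10 y12; have x10' := ltW x10.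
have e1 : integ y1 y2 (fun t => 'i * zeta t) = zeta y2 - zeta y1.
  apply: (@integ_FTC _ _ _ zeta _ (r * 2)) => //.
    by apply: bddM; [exact: bdd_cst|exists r => x _; rewrite cabs_zeta].
  move=> x t y _ xt ty _; have -> : zeta y - zeta x - 'i * zeta t * (y - x)%:C =
     r%:C * (cis y - cis x - 'i * cis t * (y - x)%:C) by rewrite /zeta; ring.
  by rewrite (cabsM r%:C) cabsR gtr0_norm // -[leRHS]mulrA ler_pM2l // cis_FTC.
rewrite /EE (@integ_ext _ _ _ y10 y12 _ (fun t => (B * (x2 - x1)%:C) * ('i * zeta t))); last first.
  move=> t _; rewrite /kap /W rmorphB /=; have := zeta_z0 t.
  by move: (zeta t) => c c0; field.
rewrite (integZ y10 y12) //; last by apply: bddM; [exact: bdd_cst|exists r => x _; rewrite cabs_zeta].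
rewrite e1 (@integ_ext _ _ _ x10' x12 _ (fun t => B * (zeta y2 - zeta y1))); last first.
  move=> s /andP[s1 _]; have s0 : s%:C != 0 :> C by rewrite -cabs_eq0 cabsR normr_eq0 gt_eqF // (lt_trans x10).
  by rewrite fmorphV /= /W; move: s0; move: s%:C => c c0; field.
by rewrite integ_cst //; ring.
Qed.

Let EE_bound g x1 x2 y1 y2 (m s0 : R) : 0 < s0 -> s0 <= x1 -> x1 <= x2 -> 0 <= y1 -> y1 <= y2 ->
  (forall s t, x1 <= s <= x2 -> y1 <= t <= y2 -> cabs (g (W s t)) <= m) ->
  cabs (EE g x1 x2 y1 y2) <= 2 * m * (K * (y2 - y1) + s0^-1 * (x2 - x1)).
Proof.
move=> s0_gt0 s0x x12 y10 y12 H; have x10 := lt_le_trans s0_gt0 s0x.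
have m0 : 0 <= m by apply: le_trans (cabs_ge0 _) (H x1 y1 _ _); rewrite lexx.
have b2 (a b : C) : cabs a <= m -> cabs b <= m -> cabs (a - b) <= 2 * m.
  by move=> h1 h2; rewrite mulr_natl mulr2n; apply: le_trans (cabsD _ _) _; rewrite cabsN lerD.
apply: le_trans (cabsD _ _) _; rewrite cabsN mulrDr; apply: lerD.
  rewrite mulrA; apply: integ_bound => // t /andP[t1 t2]; rewrite cabsM.
  by apply: ler_pM; rewrite ?cabs_ge0 // b2 // H ?lexx ?x12 ?(ltW t1).
rewrite mulrA; apply: integ_bound => //; first exact: ltW.
move=> s /andP[s1 s2]; rewrite cabsM cabsR.
apply: ler_pM; rewrite ?cabs_ge0 ?b2 ?H ?lexx ?y12 ?s2 ?(ltW s1) //.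
have ss := lt_trans x10 s1.
by rewrite ger0_norm ?invr_ge0 ?(ltW ss) // lef_pV2 ?posrE // (le_trans s0x) // ltW.
Qed.

(** The inner edge s = x2 is traversed in both directions and cancels. *)
Let EE_catx g x1 x2 x3 y1 y2 : bnd g -> 0 < x1 -> x1 <= x2 -> x2 <= x3 -> x3 <= 1 ->
  0 <= y1 -> y1 <= y2 -> EE g x1 x3 y1 y2 = EE g x1 x2 y1 y2 + EE g x2 x3 y1 y2.
Proof.
move=> bg x10 x12 x23 x31 y10 y12; have x10' := ltW x10.
have x20 := lt_le_trans x10 x12.
have x1i : 0 <= x1 <= 1 by rewrite x10' (le_trans x12) // (le_trans x23).
have x2i : 0 <= x2 <= 1 by rewrite (ltW x20) (le_trans x23).
have x3i : 0 <= x3 <= 1 by rewrite x31 (le_trans _ x23) // ltW.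
rewrite /EE (integ_cat x10' x12 x23 (bdd2 y1 y2 bg x10 x31)).
rewrite (@integ_ext _ _ _ y10 y12 _ (fun t => (g (W x2 t) - g (W x1 t)) * kap t + (g (W x3 t) - g (W x2 t)) * kap t)).
  by rewrite (integD y10 y12 (bdd1 y1 y2 bg x1i x2i) (bdd1 y1 y2 bg x2i x3i)); ring.
by move=> t _; ring.
Qed.

Let EE_caty g x1 x2 y1 y2 y3 : bnd g -> 0 < x1 -> x1 <= x2 -> x2 <= 1 ->
  0 <= y1 -> y1 <= y2 -> y2 <= y3 -> EE g x1 x2 y1 y3 = EE g x1 x2 y1 y2 + EE g x1 x2 y2 y3.
Proof.
move=> bg x10 x12 x21 y10 y12 y23; have x10' := ltW x10.
have x1i : 0 <= x1 <= 1 by rewrite x10' (le_trans x12).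
have x2i : 0 <= x2 <= 1 by rewrite x21 (le_trans x10').
rewrite /EE (integ_cat y10 y12 y23 (bdd1 y1 y3 bg x1i x2i)).
rewrite (@integ_ext _ _ _ x10' x12 _ (fun s => (g (W s y2) - g (W s y1)) * (s^-1)%:C + (g (W s y3) - g (W s y2)) * (s^-1)%:C)).
  by rewrite (integD x10' x12 (bdd2 y1 y2 bg x10 x21) (bdd2 y2 y3 bg x10 x21)); ring.
by move=> t _; ring.
Qed.

Variable f : C -> C.
Hypothesis holf : forall w, cabs w <= r -> hol f w.

Let bf : bnd f.
Proof. by have [M _ hM] := hol_bounded holf; exists M. Qed.

(** On a rectangle of size t, f differs from its tangent map by o(t) and the boundary has length
    O(t), which is the o(t^2) that [bisection] asks for. *)
Let goursat s0 : 0 < s0 -> s0 <= 1 -> EE f s0 1 0 tpi = 0.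
Proof.
move=> s0_gt0 s01; apply/eqP; rewrite -cabs_eq0 eq_le cabs_ge0 andbT.
have h0 : 0 <= 1 - s0 by rewrite subr_ge0.
have H2 (s : R) : s / 2 + s / 2 = s by rewrite -splitr.
have Hh (s : R) : 0 <= s -> 0 <= s / 2 by move=> s00; rewrite divr_ge0.
have := @bisection R (fun x y s t => cabs (EE f x (x + s) y (y + t))) s0 0 (1 - s0) tpi h0 tpi0.
rewrite subrKC add0r; apply.
- move=> x y s t sx y0 s_0 t_0 xs yt; have x0 := lt_le_trans s0_gt0 sx.
  have := Hh s s_0; have := Hh t t_0; have := H2 s; have := H2 t.
  move: (s / 2) (t / 2) => s' t' t2 s2 t'0 s'0.
  rewrite -{1}t2 -{1}s2 !addrA.
  rewrite (@EE_catx f x (x + s') (x + s' + s')) ?bf //; try lra.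
  rewrite !(@EE_caty f _ _ y (y + t') (y + t' + t')) ?bf //; try lra.
  set a := EE _ _ _ _ _; set b := EE _ _ _ _ _; set c := EE _ _ _ _ _; set d := EE _ _ _ _ _.
  rewrite (addrAC (cabs a)) -[leRHS]addrA.
  by apply: le_trans (cabsD _ _) _; apply: lerD; exact: cabsD.
move=> px py /andP[p1 p2] /andP[p3 p4] e e0.
have pxi : 0 <= px <= 1 by rewrite p2 (le_trans _ p1) // ltW.
have [c Hc] := hol_local (holf (Wr py pxi)).
(* [W] moves by at most [B * t] within a subrectangle of scale t. *)
set B : R := 2 * r * ((1 - s0) + tpi).
have B0 : 0 < B by rewrite !mulr_gt0 // ltr_wpDl // tpi_gt0.
(* One more than the constant coming from [EE_bound]: this keeps D positive and the final factor (D
   - 1) / D at most 1. *)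
set D : R := 2 * B * (K * tpi + s0^-1 * (1 - s0)) + 1.
have D0 : 0 < D.
  have K2 : 0 <= K * tpi + s0^-1 * (1 - s0).
    by apply: addr_ge0; apply: mulr_ge0 => //; rewrite invr_ge0 ltW.
  by rewrite ltr_wpDl // mulr_ge0 // mulr_ge0 // ltW.
have [d d0 Hd] := Hc (e / D) (divr_gt0 e0 D0).
exists (d / B); first by rewrite divr_gt0.
move=> x y t t0 td sx y0 xt yt /andP[x1 x2] /andP[y1 y2].
have td' : B * t < d by rewrite mulrC -ltr_pdivlMr.
(* [A0 + c * w] is the tangent map of f at the point (px, py); [EE_affine] lets it be subtracted. *)
pose A0 := f (W px py) - c * W px py.
pose rho w := f w - (A0 + c * w).
have baff : bnd (fun w => A0 + c * w).
  exists (cabs A0 + cabs c * r) => w hw; apply: le_trans (cabsD _ _) _.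
  by rewrite lerD2l cabsM ler_wpM2l ?cabs_ge0.
have brho : bnd rho.
  case: bf => M1 h1; case: baff => M2 h2; exists (M1 + M2) => w hw.
  by apply: le_trans (cabsD _ _) _; rewrite cabsN lerD ?h1 ?h2.
have ht : 0 <= (1 - s0) * t by rewrite mulr_ge0 // ltW.
have kt : 0 <= tpi * t by rewrite mulr_ge0 // ltW.
have x0 : 0 < x := lt_le_trans s0_gt0 sx.
have -> : EE f x (x + (1 - s0) * t) y (y + tpi * t) = EE rho x (x + (1 - s0) * t) y (y + tpi * t).
  have -> : f = (fun w => rho w + (A0 + c * w)) by apply/funext => w; rewrite /rho subrK.
  by rewrite EE_D ?EE_affine ?addr0 //; lra.
apply: le_trans (@EE_bound rho _ _ _ _ (e / D * (B * t)) s0 _ _ _ _ _ _) _ => //; try lra.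
  move=> s u /andP[s1 s2] /andP[u1 u2].
  have hW : cabs (W s u - W px py) <= B * t.
    apply: le_trans (W_lip _ _ _ pxi) _; rewrite /B -[leRHS]mulrA ler_wpM2l //.
      by rewrite mulr_ge0 // ltW.
    rewrite [leRHS]mulrDl; apply: lerD; rewrite ler_norml; apply/andP; split; lra.
  have -> : rho (W s u) = f (W s u) - f (W px py) - c * (W s u - W px py).
    by rewrite /rho /A0; ring.
  apply: le_trans (Hd _ (le_lt_trans hW td')) _.
  by rewrite ler_wpM2l // divr_ge0 ?ltW.
have -> : 2 * (e / D * (B * t)) * (K * (y + tpi * t - y) + s0^-1 * (x + (1 - s0) * t - x)) =
  e * t ^+ 2 * ((D - 1) / D).
  rewrite [D - 1]addrK; have := gt_eqF D0; move: (D) (s0^-1) => D' s' /negbT D'0.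
  by field.
have et : 0 <= e * t ^+ 2 by rewrite mulr_ge0 ?sqr_ge0 // ltW.
have D1 : (D - 1) / D <= 1 by rewrite ler_pdivrMr // mul1r gerBl.
by rewrite -[leRHS]mulr1; apply: ler_wpM2l.
Qed.

(** The edges t = 0 and t = 2 pi coincide, so [goursat] makes the integral over the curve [W s0]
    independent of s0. As s0 tends to 0, f along this curve tends to f z. *)
Let cauchy_kap : integ 0 tpi (fun t => f (zeta t) * kap t) = f z * integ 0 tpi kap.
Proof.
have bk : bdd 0 tpi kap by exists K.
have bfk s : 0 <= s <= 1 -> bdd 0 tpi (fun t => f (W s t)).
  by case: bf => M hM si; exists M => t _; rewrite hM // Wr.
have W1 t : W 1 t = zeta t by rewrite /W mul1r; ring.
have key s0 : 0 < s0 -> s0 <= 1 ->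
    integ 0 tpi (fun t => f (zeta t) * kap t) = integ 0 tpi (fun t => f (W s0 t) * kap t).
  move=> h0 h1; have := goursat h0 h1; rewrite /EE.
  have s0i : 0 <= s0 <= 1 by rewrite h1 ltW.
  rewrite [X in _ - X](_ : _ = 0); last first.
    rewrite (@integ_ext _ _ _ (ltW h0) h1 _ (fun=> 0)) ?integ_cst ?mul0r //; first exact: ltW.
    by move=> s _; rewrite /W /zeta cis_tpi subrr mul0r.
  rewrite subr0 (@integ_ext _ _ _ (lexx 0) tpi0 _ (fun t => f (zeta t) * kap t - f (W s0 t) * kap t)).
    rewrite (integB (lexx 0) tpi0) //; [by move/eqP; rewrite subr_eq0 => /eqP| |exact: bddM (bfk _ s0i) bk].
    apply: bddM bk; have := @bfk 1; rewrite ler01 lexx => /(_ isT) [M hM].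
    by exists M => t /hM; rewrite W1.
  by move=> t _; rewrite W1 mulrBl.
apply/eqP; rewrite -subr_eq0 -cabs_eq0 eq_le cabs_ge0 andbT.
apply/ler_eps => e e0; rewrite add0r.
have D0 : 0 < K * tpi + 1 by rewrite ltr_wpDl // mulr_ge0.
have z_r : cabs z <= r by rewrite ltW.
have [d d0 Hd] := hol_cont (holf z_r) (divr_gt0 e0 D0).
(* Since |zeta t - z| < 4 r, the curve [W s0] stays within d of z. *)
pose s0 := Num.min 1 (d / (4 * r)).
have s0_gt0 : 0 < s0 by rewrite lt_min ltr01 divr_gt0 // mulr_gt0.
have s01 : s0 <= 1 by rewrite ge_min lexx.
have s0i : 0 <= s0 <= 1 by rewrite s01 ltW.
rewrite (key _ s0_gt0 s01) -(integZ (lexx 0) tpi0) // -(integB (lexx 0) tpi0) //; [|exact: bddM (bfk _ s0i) bk|exact: bddM (bdd_cst _ _ _) bk].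
apply: le_trans (integ_bound (M := e / (K * tpi + 1) * K) _ tpi0 _) _ => //.
  move=> t _; rewrite -mulrBl cabsM ler_pM ?cabs_ge0 //.
  apply/ltW/Hd; rewrite /W addrAC subrr add0r cabsM cabsR (gtr0_norm s0_gt0).
  have h1 : cabs (zeta t - z) < 4 * r.
    apply: le_lt_trans (cabsD _ _) _; rewrite cabsN cabs_zeta.
    apply: (@lt_trans _ _ (r + r)); first by rewrite ltrD2l.
    have r4 : r + r < 4 * r by rewrite (_ : 4 * r = r + r + (r + r)) ?ltrDl ?addr_gt0 //; ring.
    exact: r4.
  have h2 : s0 * (4 * r) <= d by rewrite -ler_pdivlMr ?mulr_gt0 // ge_min lexx orbT.
  by apply: lt_le_trans h2; rewrite ltr_pM2l.
have D1 : K * tpi / (K * tpi + 1) <= 1 by rewrite ler_pdivrMr // mul1r lerDl.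
have -> : e / (K * tpi + 1) * K * (tpi - 0) = e * (K * tpi / (K * tpi + 1)) by ring.
by rewrite -[leRHS]mulr1; apply: ler_wpM2l => //; exact: ltW.
Qed.

(** The integral of the kernel is left unevaluated here; [cmean_cauchy_kernel] computes it. *)
Lemma cauchy_kernel : integ 0 tpi (fun t => f (r%:C * cis t) * (r%:C * cis t / (r%:C * cis t - z)))
  = f z * integ 0 tpi (fun t => r%:C * cis t / (r%:C * cis t - z)).
Proof.
have bk : bdd 0 tpi (fun t => r%:C * cis t / (r%:C * cis t - z)).
  have bk' : bdd 0 tpi kap by exists K.
  case: bk' => M hM; by exists M => t /hM; rewrite /kap -mulrA (cabsM 'i) cabsi mul1r.
have bfz : bdd 0 tpi (fun t => f (zeta t)) by case: bf => M hM; exists M => t _; rewrite hM // cabs_zeta.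
have i0 : 'i != 0 :> C by rewrite -cabs_eq0 cabsi oner_eq0.
apply: (mulfI i0).
rewrite -(integZ (lexx 0) tpi0 'i (bddM bfz bk)) mulrCA -(integZ (lexx 0) tpi0 'i bk).
have -> : (fun x : R => 'i * (r%:C * cis x / (r%:C * cis x - z))) = kap by apply/funext => t; rewrite /kap mulrA.
by rewrite -cauchy_kap; apply: integ_ext => // t _; rewrite mulrCA /kap !mulrA.
Qed.

End Goursat.
End Circle.

(** * Cauchy's formula and the half-plane Schwarz lemma *)

Section Cauchy.
Variable R : realType.
Local Notation C := (R[i]).
Local Notation tpi := (pi *+ 2 : R).
Let tpi0 : 0 <= tpi := ltW (tpi_gt0 R).
Let lx0 : (0 : R) <= 0 := lexx 0.

Definition cmean (u : R -> C) : C := integ 0 tpi u / tpi%:C.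

Let tpiC0 : tpi%:C != 0 :> C.
Proof. by rewrite -cabs_eq0 cabsR normr_eq0 gt_eqF // tpi_gt0. Qed.

Lemma cmean_cst c : cmean (fun=> c) = c.
Proof. by rewrite /cmean (integ_cst lx0 tpi0) subr0 mulfK. Qed.

Lemma cmean_ext u v : u =1 v -> cmean u = cmean v.
Proof. by move=> /funext ->. Qed.

Lemma cmeanD u v : bdd 0 tpi u -> bdd 0 tpi v ->
  cmean (fun t => u t + v t) = cmean u + cmean v.
Proof. by move=> hu hv; rewrite /cmean (integD lx0 tpi0 hu hv) mulrDl. Qed.

Lemma cmeanB u v : bdd 0 tpi u -> bdd 0 tpi v ->
  cmean (fun t => u t - v t) = cmean u - cmean v.
Proof. by move=> hu hv; rewrite /cmean (integB lx0 tpi0 hu hv) mulrBl. Qed.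

Lemma cmeanZ c u : bdd 0 tpi u -> cmean (fun t => c * u t) = c * cmean u.
Proof. by move=> hu; rewrite /cmean (integZ lx0 tpi0 c hu) mulrA. Qed.

Lemma cmeanJ u : bdd 0 tpi u -> cmean (fun t => conjc (u t)) = conjc (cmean u).
Proof.
by move=> hu; rewrite /cmean (integJ lx0 tpi0 hu) conjcM conjcV conjcR.
Qed.

Lemma cmean_le u v : bdd 0 tpi v -> (forall t, cabs (u t) <= Re (v t)) ->
  cabs (cmean u) <= Re (cmean v).
Proof.
move=> hv huv; have := @integ_le _ _ _ lx0 tpi0 u v hv (fun t _ => huv t).
have -> : Re (cmean v) = tpi^-1 * Re (integ 0 tpi v).
  by rewrite /cmean -fmorphV mulrC ReMr.
rewrite /cmean cabsM cabsV cabsR (ger0_norm tpi0) mulrC => h.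
by rewrite ler_wpM2l // invr_ge0.
Qed.

Lemma cmean_bound u (M : R) : (forall t, cabs (u t) <= M) -> cabs (cmean u) <= M.
Proof.
move=> hM; have := @cmean_le u (fun=> M%:C) (bdd_cst _ _ _) hM.
by rewrite cmean_cst.
Qed.

Lemma hol_circle_bdd (r : R) (f : C -> C) : 0 < r -> (forall w, cabs w <= r -> hol f w) ->
  bdd 0 tpi (fun t => f (r%:C * cis t)).
Proof.
move=> r0 holf; have [M _ hM] := hol_bounded holf.
by exists M => t _; rewrite hM // (cabsM r%:C) cabs_cis mulr1 cabsR gtr0_norm.
Qed.

Lemma mean_value (r : R) (f : C -> C) : 0 < r -> (forall w, cabs w <= r -> hol f w) ->
  cmean (fun t => f (r%:C * cis t)) = f 0.
Proof.
move=> r0 holf; have c0 : cabs (0 : C) < r by rewrite cabs0.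
have := cauchy_kernel r0 c0 holf.
have e t : r%:C * cis t / (r%:C * cis t - 0) = 1.
  rewrite subr0 divff // -cabs_eq0 (cabsM r%:C) cabs_cis mulr1 cabsR gtr0_norm //.
  by rewrite gt_eqF.
rewrite (integ_ext lx0 tpi0 (v := fun t => f (r%:C * cis t))); last first.
  by move=> t _; rewrite e mulr1.
rewrite [in RHS](integ_ext lx0 tpi0 (v := fun=> 1)); last by move=> t _; rewrite e.
by rewrite (integ_cst lx0 tpi0) subr0 mul1r /cmean => ->; rewrite mulfK.
Qed.

Lemma circle_norm (r t : R) : 0 < r -> cabs (r%:C * cis t) = r.
Proof. by move=> r0; rewrite (cabsM r%:C) cabs_cis mulr1 cabsR gtr0_norm. Qed.

Lemma circle_sub (r t : R) (z : C) : 0 < r -> cabs z < r ->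
  r - cabs z <= cabs (r%:C * cis t - z).
Proof.
by move=> r0 zr; have := cabs_tri z (r%:C * cis t) 0; rewrite !subr0 circle_norm // lerBlDr.
Qed.

Lemma circle_sub0 (r t : R) (z : C) : 0 < r -> cabs z < r -> r%:C * cis t - z != 0.
Proof.
move=> r0 zr; rewrite -cabs_gt0; apply: lt_le_trans (circle_sub t r0 zr).
by rewrite subr_gt0.
Qed.

Lemma circleJ (r t : R) : 0 < r -> (r%:C * cis t) * conjc (r%:C * cis t) = (r ^+ 2)%:C.
Proof. by move=> r0; rewrite -cabs_sqrC circle_norm. Qed.

Lemma refl_neq0 (r : R) (z w : C) : 0 < r -> cabs z < r -> cabs w <= r ->
  (r ^+ 2)%:C - conjc z * w != 0.
Proof.
move=> r0 zr wr; rewrite -cabs_gt0.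
have h : cabs (conjc z * w) < r ^+ 2.
  rewrite cabsM cabsJ expr2; apply: le_lt_trans (_ : cabs z * r < _).
    by rewrite ler_wpM2l ?cabs_ge0.
  by rewrite ltr_pM2r.
have := cabs_tri (conjc z * w) (r ^+ 2)%:C 0.
by rewrite !subr0 cabsR ger0_norm ?sqr_ge0 //; lra.
Qed.

(** On |w| = r the conjugate of w is r^2 / w, so the conjugate of 1 / (w - z) is w times this
    function, which is holomorphic inside the disc. *)
Lemma hol_refl (r : R) (z w : C) : 0 < r -> cabs z < r -> cabs w <= r ->
  hol (fun w => ((r ^+ 2)%:C - conjc z * w)^-1) w.
Proof.
move=> r0 zr wr; apply: holV; last exact: refl_neq0.
by apply: holB; [exact: hol_cst|apply: holM; [exact: hol_cst|exact: hol_id]].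
Qed.

Lemma cauchy_kernel_bdd (r : R) (z : C) : 0 < r -> cabs z < r ->
  bdd 0 tpi (fun t => r%:C * cis t / (r%:C * cis t - z)).
Proof.
move=> r0 zr; exists (r / (r - cabs z)) => t _.
rewrite (cabsM (r%:C * cis t)) cabsV circle_norm //.
have h := circle_sub t r0 zr; have rz : 0 < r - cabs z by rewrite subr_gt0.
by rewrite ler_pM2l // lef_pV2 ?posrE // (lt_le_trans rz).
Qed.

Lemma cmean_cauchy_kernel (r : R) (z : C) : 0 < r -> cabs z < r ->
  cmean (fun t => r%:C * cis t / (r%:C * cis t - z)) = 1.
Proof.
move=> r0 zr.
pose g w : C := (r ^+ 2)%:C * ((r ^+ 2)%:C - conjc z * w)^-1.
have hg w : cabs w <= r -> hol g w.
  by move=> wr; apply: holM; [exact: hol_cst|exact: hol_refl].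
have r2 : (r ^+ 2)%:C != 0 :> C.
  by rewrite -cabs_eq0 cabsR normr_eq0 expf_neq0 // gt_eqF.
have := mean_value r0 hg; rewrite /g mulr0 subr0 divff // => /(congr1 conjc).
rewrite conjc1 => <-; rewrite -cmeanJ; last exact: (hol_circle_bdd r0 hg).
apply: cmean_ext => t; set s := r%:C * cis t.
have h1 : s - z != 0 by exact: circle_sub0.
have h2 := circleJ t r0; rewrite -/s in h2.
rewrite conjcM conjcV conjcB conjcM conjcK !conjcR -h2.
have s0 : conjc s != 0.
  by apply/eqP => e; move: r2; rewrite -h2 e mulr0 eqxx.
rewrite -mulrBl; move: (conjc s) (s - z) s0 h1 => a b a0 b0; field.
by rewrite a0 b0.
Qed.

Lemma cauchy_formula (r : R) (z : C) (f : C -> C) : 0 < r -> cabs z < r ->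
  (forall w, cabs w <= r -> hol f w) ->
  cmean (fun t => f (r%:C * cis t) * (r%:C * cis t / (r%:C * cis t - z))) = f z.
Proof.
move=> r0 zr holf; rewrite /cmean (cauchy_kernel r0 zr holf) -mulrA.
have := cmean_cauchy_kernel r0 zr; rewrite /cmean => ->.
by rewrite mulr1.
Qed.

(* With k the Cauchy kernel z / (zeta - z), F z - F 0 is the mean of F k. On the circle the
   conjugate of k is the restriction of a holomorphic function vanishing at 0, so conj F has
   mean zero against k, and F may be replaced by 2 Re F, whose sign is known. *)
Lemma halfplane_ball (r : R) (z : C) (F : C -> C) : 0 < r -> cabs z < r ->
  (forall w, cabs w <= r -> hol F w) -> (forall w, cabs w <= r -> 0 <= Re (F w)) ->
  cabs (F z - F 0) <= 2 * cabs z / (r - cabs z) * Re (F 0).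
Proof.
move=> r0 zr holF posF.
pose s t : C := r%:C * cis t.
have s0 t : s t - z != 0 by exact: circle_sub0.
have rz0 : 0 < r - cabs z by rewrite subr_gt0.
pose k t : C := z / (s t - z).
have kle t : cabs (k t) <= cabs z / (r - cabs z).
  rewrite /k (cabsM z) cabsV ler_wpM2l ?cabs_ge0 // lef_pV2 ?posrE //.
    exact: circle_sub.
  by rewrite (lt_le_trans rz0) // circle_sub.
have bk : bdd 0 tpi k by exists (cabs z / (r - cabs z)).
have bF : bdd 0 tpi (fun t => F (s t)) by exact: (hol_circle_bdd r0 holF).
have bks : bdd 0 tpi (fun t => s t / (s t - z)) by exact: cauchy_kernel_bdd.
have e1 : F z - F 0 = cmean (fun t => F (s t) * k t).
  rewrite -(cauchy_formula r0 zr holF) -(mean_value r0 holF) -cmeanB //; last first.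
    exact: bddM bF bks.
  apply: cmean_ext => t; rewrite -/(s t) /k; have := s0 t.
  by move: (F (s t)) => a; move: (s t) => b b0; field.
pose q w : C := conjc z * w * ((r ^+ 2)%:C - conjc z * w)^-1.
have hq w : cabs w <= r -> hol (fun w => F w * q w) w.
  move=> wr; apply: holM; first exact: holF.
  apply: holM; last exact: hol_refl.
  by apply: holM; [exact: hol_cst|exact: hol_id].
have qk t : q (s t) = conjc (k t).
  rewrite /q /k -(circleJ t r0) -/(s t) (conjcM z) conjcV (conjcB (s t)).
  have sn : s t != 0 by rewrite -cabs_gt0 circle_norm.
  have : conjc (s t - z) != 0 by rewrite conjc_eq0.
  rewrite (conjcB (s t)) => h.
  rewrite (_ : s t * conjc (s t) - conjc z * s t = s t * (conjc (s t) - conjc z)); last by ring.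
  by rewrite invfM mulrA mulfK.
have e2 : cmean (fun t => conjc (F (s t)) * k t) = 0.
  have := mean_value r0 hq; rewrite {2}/q mulr0 mul0r mulr0 => /(congr1 conjc).
  rewrite conjc0 => <-; rewrite -cmeanJ; last exact: (hol_circle_bdd r0 hq).
  by apply: cmean_ext => t; rewrite -/(s t) qk conjcM conjcK.
have e3 : F z - F 0 = cmean (fun t => (F (s t) + conjc (F (s t))) * k t).
  rewrite e1 -[LHS]addr0 -[X in _ + X = _]e2 -cmeanD; [|exact: bddM bF bk|exact: bddM (bddJ bF) bk].
  by apply: cmean_ext => t; rewrite mulrDl.
pose c := 2 * cabs z / (r - cabs z).
have -> : c * Re (F 0) = Re (cmean (fun t => c%:C * F (s t))).
  by rewrite cmeanZ // (mean_value r0 holF) ReMr.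
rewrite e3; apply: cmean_le; first exact: bddM (bdd_cst _ _ _) bF.
move=> t; rewrite ReMr cabsM /c.
have F0 : 0 <= Re (F (s t)) by apply: posF; rewrite circle_norm.
rewrite addcJ cabsM !cabsR (_ : cabs 2%:R = 2) ?ger0_norm //; last first.
  by rewrite -(rmorph_nat (real_complex R) 2) cabsR ger0_norm.
have -> : 2 * cabs z / (r - cabs z) * Re (F (s t)) = 2 * Re (F (s t)) * (cabs z / (r - cabs z)) by ring.
by rewrite ler_wpM2l // mulr_ge0.
Qed.

(** This is [halfplane_ball] on radius 1 - t, as t tends to 0. *)
Lemma halfplane_disc (z : C) (F : C -> C) : cabs z < 1 ->
  (forall w, cabs w < 1 -> hol F w) -> (forall w, cabs w < 1 -> 0 <= Re (F w)) ->
  cabs (F z - F 0) <= 2 * cabs z / (1 - cabs z) * Re (F 0).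
Proof.
move=> z1 holF posF; set X := cabs (F z - F 0); set B := Re (F 0).
have X0 : 0 <= X by exact: cabs_ge0.
have d0 : 0 < 1 - cabs z by rewrite subr_gt0.
rewrite mulrAC ler_pdivlMr //; apply/ler_eps => e e0.
(* The first bound keeps z in the smaller disc, the second makes the error [X * t] at most e. *)
pose t := Num.min ((1 - cabs z) / 2) (e / (X + 1)).
have X1 : 0 < X + 1 by rewrite ltr_wpDl.
have t0 : 0 < t by rewrite lt_min !divr_gt0.
have t1 : t < 1 - cabs z.
  by apply: le_lt_trans (_ : (1 - cabs z) / 2 < _); [rewrite ge_min lexx|lra].
have t2 : X * t <= e.
  apply: le_trans (_ : (X + 1) * t <= _); first by rewrite ler_wpM2r ?lerDl // ltW.
  by rewrite mulrC -ler_pdivlMr // ge_min lexx orbT.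
have r0 : 0 < 1 - t by have := cabs_ge0 z; lra.
have zr : cabs z < 1 - t by lra.
have := @halfplane_ball (1 - t) z F r0 zr.
have lt1 w : cabs w <= 1 - t -> cabs w < 1 by lra.
move=> /(_ (fun w h => holF w (lt1 w h)) (fun w h => posF w (lt1 w h))).
rewrite mulrAC ler_pdivlMr -/X -/B; last by lra.
by rewrite (_ : 1 - t - cabs z = (1 - cabs z) - t) ?[X * _]mulrBr; [lra|ring].
Qed.

Definition pseudohyp (z w : C) : R := cabs (z - w) / cabs (1 - conjc w * z).

(** The difference of the squares is (1 - |z|^2)(1 - |w|^2). *)
Lemma pseudohyp_num (z w : C) : cabs z < 1 -> cabs w < 1 -> cabs (z - w) < cabs (1 - conjc w * z).
Proof.
move=> z1 w1; rewrite -ltr_sqr ?nnegrE ?cabs_ge0 //.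
rewrite -ltcR !cabs_sqrC !conjcB conjcM conjcK conjc1.
have h : 0 < (1 - cabs z ^+ 2) * (1 - cabs w ^+ 2).
  by rewrite mulr_gt0 // subr_gt0 expr_lt1 ?cabs_ge0.
move: h; rewrite -ltcR rmorphM !rmorphB /= !cabs_sqrC rmorph1 rmorph0 => h.
rewrite -subr_gt0; apply: lt_le_trans h _.
by rewrite le_eqVlt; apply/orP; left; apply/eqP; ring.
Qed.

Lemma pseudohyp_den0 (z w : C) : cabs z < 1 -> cabs w < 1 -> 1 - conjc w * z != 0.
Proof.
by move=> z1 w1; rewrite -cabs_gt0; apply: le_lt_trans (pseudohyp_num z1 w1); exact: cabs_ge0.
Qed.

Lemma pseudohyp_lt1 (z w : C) : cabs z < 1 -> cabs w < 1 -> pseudohyp z w < 1.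
Proof.
move=> z1 w1; rewrite /pseudohyp ltr_pdivrMr ?mul1r ?pseudohyp_num //.
by rewrite cabs_gt0 pseudohyp_den0.
Qed.

Lemma pseudohyp_ge0 (z w : C) : 0 <= pseudohyp z w.
Proof. by rewrite divr_ge0 ?cabs_ge0. Qed.

(** The disc automorphism [mu] sends 0 to w and a point of modulus [pseudohyp z w] to z, which
    reduces the claim to base point 0. *)
Lemma halfplane_schwarz (z w : C) (F : C -> C) : cabs z < 1 -> cabs w < 1 ->
  (forall w, cabs w < 1 -> hol F w) -> (forall w, cabs w < 1 -> 0 <= Re (F w)) ->
  cabs (F z - F w) <= 2 * pseudohyp z w / (1 - pseudohyp z w) * Re (F w).
Proof.
move=> z1 w1 holF posF.
have w1' : cabs (- w) < 1 by rewrite cabsN.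
pose mu x : C := (x + w) * (1 + conjc w * x)^-1.
have den x : cabs x < 1 -> 1 + conjc w * x != 0.
  by move=> x1; have := pseudohyp_den0 x1 w1'; rewrite conjcN mulNr opprK.
have mu1 x : cabs x < 1 -> cabs (mu x) < 1.
  move=> x1; rewrite /mu cabsM cabsV ltr_pdivrMr ?mul1r ?cabs_gt0 ?den //.
  by have := pseudohyp_num x1 w1'; rewrite conjcN mulNr !opprK.
pose x0 := (z - w) / (1 - conjc w * z).
have x0E : cabs x0 = pseudohyp z w by rewrite /x0 cabsM cabsV.
have x01 : cabs x0 < 1 by rewrite x0E pseudohyp_lt1.
have muz : mu x0 = z.
  have h1 := pseudohyp_den0 z1 w1; have h2 := den _ x01.
  have h3 : 1 - conjc w * w != 0 by exact: pseudohyp_den0.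
  rewrite /mu; apply: (mulIf h2); rewrite mulfVK // /x0.
  by field.
have H := @halfplane_disc x0 (fun x => F (mu x)) x01.
have mu0 : mu 0 = w by rewrite /mu mulr0 addr0 invr1 mulr1 add0r.
rewrite muz x0E mu0 in H; apply: H.
  move=> x x1; apply: (@hol_comp _ F mu); last exact/holF/mu1.
  apply: holM; first by apply: holD; [exact: hol_id|exact: hol_cst].
  apply: holV; last exact: den.
  by apply: holD; [exact: hol_cst|apply: holM; [exact: hol_cst|exact: hol_id]].
by move=> x x1; exact/posF/mu1.
Qed.

(** Writing s for the point of the circle, the kernel 1/(s - w) differs from its first-order
    expansion at z by (w - z)^2 / ((s - z)^2 (s - w)), which is bounded by d^-3 |w - z|^2. *)
Lemma cauchy_integral_hol (r : R) (g : R -> C) (G : C -> C) (M : R) (z : C) : 0 < r ->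
  (forall t, cabs (g t) <= M) ->
  (forall z, cabs z < r -> G z = cmean (fun t => g t * (r%:C * cis t / (r%:C * cis t - z)))) ->
  cabs z < r -> hol G z.
Proof.
move=> r0 gM hG zr; pose s t : C := r%:C * cis t.
have rz0 : 0 < r - cabs z by rewrite subr_gt0.
(* Half the distance to the circle, so that every w within d of z is still at distance at least d
   from the circle. *)
pose d := (r - cabs z) / 2.
have d0 : 0 < d by rewrite divr_gt0.
have bg : bdd 0 tpi g by exists M.
have M0 : 0 <= M by exact: le_trans (cabs_ge0 _) (gM 0).
have b1 x : cabs x < r -> bdd 0 tpi (fun t => g t * (s t / (s t - x))).
  by move=> xr; apply: bddM bg _; exact: cauchy_kernel_bdd.
have inv_le x t : cabs x < r -> cabs (s t - x)^-1 <= (r - cabs x)^-1.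
  move=> xr; rewrite cabsV lef_pV2 ?posrE ?subr_gt0 //; first exact: circle_sub.
  by rewrite cabs_gt0 circle_sub0.
have b2 : bdd 0 tpi (fun t => g t * (s t / (s t - z) * (s t - z)^-1)).
  apply: bddM bg _; apply: bddM; first exact: cauchy_kernel_bdd.
  by exists ((r - cabs z)^-1) => t _; exact: inv_le.
apply: (@local_hol _ G z (cmean (fun t => g t * (s t / (s t - z) * (s t - z)^-1)))
   (M * (r * (d^-1 * (d^-1 * d^-1)))) d) => // w wd.
have wr : cabs w < r - d.
  have := cabs_tri z w 0; rewrite !subr0 /d; move: wd; rewrite /d; lra.
have wr' : cabs w < r by lra.
have inv_le' x t : cabs x <= r - d -> cabs (s t - x)^-1 <= d^-1.
  move=> xr; have xr' : cabs x < r by lra.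
  by apply: le_trans (inv_le x t xr') _; rewrite lef_pV2 ?posrE ?subr_gt0 //; lra.
rewrite (hG _ wr') (hG _ zr) -(cmeanB (b1 _ wr') (b1 _ zr)).
rewrite [X in _ - X]mulrC -(cmeanZ (w - z) b2).
rewrite -(cmeanB (bddB (b1 _ wr') (b1 _ zr)) (bddM (bdd_cst _ _ _) b2)).
apply: cmean_bound => t; rewrite -/(s t).
have h1 : s t - z != 0 by exact: circle_sub0.
have h2 : s t - w != 0 by exact: circle_sub0.
have -> : g t * (s t / (s t - w)) - g t * (s t / (s t - z)) -
   (w - z) * (g t * (s t / (s t - z) / (s t - z))) =
   g t * (s t * ((s t - z)^-1 * ((s t - z)^-1 * (s t - w)^-1))) * (w - z) ^+ 2.
  by move: (g t) (s t) h1 h2 => a b b1' b2'; field; rewrite b1' b2'.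
rewrite cabsM cabsX ler_wpM2r ?sqr_ge0 // cabsM ler_pM ?cabs_ge0 //.
rewrite (cabsM (s t)) circle_norm // ler_pM2l // cabsM ler_pM ?cabs_ge0 //.
  by apply: inv_le'; rewrite /d; lra.
rewrite cabsM ler_pM ?cabs_ge0 //; apply: inv_le'; rewrite ?ltW // /d; lra.
Qed.

(** Cauchy's formula survives the uniform limit, and a Cauchy integral of bounded data is
    holomorphic. *)
Lemma hol_ulim (r : R) (f : nat -> C -> C) (psi : C -> C) (z : C) : 0 < r ->
  (\forall n \near Ufree, forall w, cabs w <= r -> hol (f n) w) ->
  (forall e, 0 < e -> \forall n \near Ufree, forall w, cabs w <= r -> cabs (f n w - psi w) <= e) ->
  cabs z < r -> hol psi z.
Proof.
move=> r0 hf unif.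
have [M M0 hM] : exists2 M, 0 < M & forall w, cabs w <= r -> cabs (psi w) <= M.
  have [n [/= h1 h2]] := filter_ex (filterI hf (unif 1 ltr01)).
  have [M M0 hM] := hol_bounded h1; exists (1 + M); first by rewrite ltr_wpDl.
  move=> w wr; have := cabs_tri (f n w) (psi w) 0; rewrite !subr0 cabsBC => h.
  by apply: le_trans h _; rewrite lerD ?h2 ?hM.
apply: (@cauchy_integral_hol r (fun t => psi (r%:C * cis t)) psi M) => //.
  by move=> t; rewrite hM // circle_norm.
move=> {}z zr; pose s t : C := r%:C * cis t.
have bk := cauchy_kernel_bdd r0 zr.
have bp : bdd 0 tpi (fun t => psi (s t)) by exists M => t _; rewrite hM // circle_norm.
have kle t : cabs (s t / (s t - z)) <= r / (r - cabs z).
  have rz : 0 < r - cabs z by rewrite subr_gt0.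
  rewrite (cabsM (s t)) cabsV circle_norm // ler_pM2l // lef_pV2 ?posrE ?circle_sub //.
  by rewrite cabs_gt0 circle_sub0.
set c := r / (r - cabs z) in kle *.
have c0 : 0 <= c by exact: le_trans (cabs_ge0 _) (kle 0).
apply/eqP; rewrite -subr_eq0 -cabs_eq0 eq_le cabs_ge0 andbT.
apply/ler_eps => e e0; rewrite add0r.
have e1 : 0 < e / (1 + c) by rewrite divr_gt0 // ltr_pwDl.
have [n [/= h1 h2]] := filter_ex (filterI hf (unif _ e1)).
apply: le_trans (cabs_tri (f n z) _ _) _.
have -> : e = e / (1 + c) + e / (1 + c) * c by field; rewrite gt_eqF // ltr_pwDl.
rewrite cabsBC; apply: lerD; first by apply: h2; rewrite ltW.
have bfn := hol_circle_bdd r0 h1.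
rewrite -(cauchy_formula r0 zr h1) -cmeanB; [|exact: bddM bfn bk|exact: bddM bp bk].
apply: cmean_bound => t; rewrite -mulrBl cabsM ler_pM ?cabs_ge0 //; last exact: kle.
by apply: h2; rewrite circle_norm.
Qed.

End Cauchy.

(** * Hermitian vectors *)

Ltac vec_ring := apply/funext => ?; rewrite /vadd /vsub /vscale /vzero; ring.

Lemma le_of_eq (R : realType) (a b : R) : a = b -> a <= b. Proof. by move->. Qed.

Section Vectors.
Variable R : realType.
Local Notation C := (R[i]).
Variable d : nat.
Implicit Types (u v w x y c : cvec R d).

Definition hdot u c : C := \sum_(i < d) u i * conjc (c i).
(** The real inner product underlying [hdot]: convex sets are separated by real hyperplanes, but
    each is the zero set of the real part of a complex affine functional. *)
Definition rdot u c : R := Re (hdot u c).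

Lemma vnorm_ge0 v : 0 <= vnorm v. Proof. exact: sqrtr_ge0. Qed.

Lemma vnorm_sqr v : vnorm v ^+ 2 = \sum_(i < d) cabs (v i) ^+ 2.
Proof. by rewrite /vnorm sqr_sqrtr // sumr_ge0 // => i _; exact: sqr_ge0. Qed.

Lemma hdotvv v : hdot v v = (vnorm v ^+ 2)%:C.
Proof.
rewrite vnorm_sqr /hdot rmorph_sum /=; apply: eq_bigr => i _.
by rewrite cabs_sqrC.
Qed.

Lemma rdotvv v : rdot v v = vnorm v ^+ 2. Proof. by rewrite /rdot hdotvv. Qed.

(** The sum of the squares (X b_i - B a_i)^2 equals X (X Y - B^2); if X = 0 all a_i vanish. *)
Lemma cauchy_schwarz_sum (a b : 'I_d -> R) :
  (\sum_i a i * b i) ^+ 2 <= (\sum_i a i ^+ 2) * (\sum_i b i ^+ 2).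
Proof.
set X := \sum_i a i ^+ 2; set Y := \sum_i b i ^+ 2; set B := \sum_i a i * b i.
have X0 : 0 <= X by apply: sumr_ge0 => i _; exact: sqr_ge0.
have : 0 <= \sum_i (X * b i - B * a i) ^+ 2 by apply: sumr_ge0 => i _; exact: sqr_ge0.
have -> : \sum_i (X * b i - B * a i) ^+ 2 = X ^+ 2 * Y - 2 * (X * B) * B + B ^+ 2 * X.
  rewrite [X ^+ 2 * Y]mulr_sumr [X in _ - X]mulr_sumr [X in _ + X]mulr_sumr -sumrB -big_split /=.
  by apply: eq_bigr => i _; ring.
have -> : X ^+ 2 * Y - 2 * (X * B) * B + B ^+ 2 * X = X * (X * Y - B ^+ 2) by ring.
have [X0'|] := eqVneq X 0; last first.
  by move=> Xn; rewrite pmulr_rge0 ?subr_ge0 // lt_neqAle eq_sym Xn.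
move=> _; suff -> : B = 0 by rewrite expr0n X0' mul0r.
apply: big1 => i _; have : a i ^+ 2 == 0.
  move/eqP: X0'; rewrite psumr_eq0 => [/allP /(_ i)|j _]; last exact: sqr_ge0.
  by rewrite mem_index_enum => /(_ isT).
by rewrite sqrf_eq0 => /eqP ->; rewrite mul0r.
Qed.

Lemma hdot_le u c : cabs (hdot u c) <= vnorm u * vnorm c.
Proof.
apply: le_trans (cabs_sum _ _ _) _.
rewrite -ler_sqr ?nnegrE ?mulr_ge0 ?vnorm_ge0 //; last first.
  by apply: sumr_ge0 => i _; exact: cabs_ge0.
rewrite exprMn !vnorm_sqr; apply: le_trans (cauchy_schwarz_sum _ _).
by rewrite le_eqVlt; apply/orP; left; apply/eqP; congr (_ ^+ 2); apply: eq_bigr => i _; rewrite cabsM cabsJ.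
Qed.

Lemma rdot_le u c : `|rdot u c| <= vnorm u * vnorm c.
Proof. exact: le_trans (Re_le_cabs _) (hdot_le _ _). Qed.

Lemma hdotDl u v c : hdot (vadd u v) c = hdot u c + hdot v c.
Proof. by rewrite /hdot -big_split; apply: eq_bigr => i _; rewrite mulrDl. Qed.
Lemma hdotZl (l : C) u c : hdot (vscale l u) c = l * hdot u c.
Proof. by rewrite /hdot mulr_sumr; apply: eq_bigr => i _; rewrite mulrA. Qed.
Lemma hdotBl u v c : hdot (vsub u v) c = hdot u c - hdot v c.
Proof. by rewrite /hdot -sumrB; apply: eq_bigr => i _; rewrite mulrBl. Qed.
Lemma hdotC u c : hdot c u = conjc (hdot u c).
Proof.
rewrite /hdot; transitivity (\sum_(i < d) conjc (u i * conjc (c i))); last by rewrite rmorph_sum.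
by apply: eq_bigr => i _; rewrite conjcM conjcK mulrC.
Qed.
Lemma rdotC u c : rdot c u = rdot u c.
Proof. by rewrite /rdot hdotC; case: (hdot u c). Qed.
Lemma rdotDl u v c : rdot (vadd u v) c = rdot u c + rdot v c.
Proof. by rewrite /rdot hdotDl ReD. Qed.
Lemma rdotBl u v c : rdot (vsub u v) c = rdot u c - rdot v c.
Proof. by rewrite /rdot hdotBl ReB. Qed.
Lemma rdotZl (t : R) u c : rdot (vscale t%:C u) c = t * rdot u c.
Proof. by rewrite /rdot hdotZl ReMr. Qed.

Lemma vnormD_sqr u v : vnorm (vadd u v) ^+ 2 = vnorm u ^+ 2 + 2 * rdot u v + vnorm v ^+ 2.
Proof.
rewrite -!rdotvv rdotDl (rdotC (vadd u v) u) (rdotC (vadd u v) v) !rdotDl (rdotC u v); ring.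
Qed.

Lemma vnormZ (l : C) v : vnorm (vscale l v) = cabs l * vnorm v.
Proof.
apply/eqP; rewrite -(@eqrXn2 _ 2) ?vnorm_ge0 ?mulr_ge0 ?cabs_ge0 ?vnorm_ge0 //.
rewrite exprMn !vnorm_sqr mulr_sumr; apply/eqP; apply: eq_bigr => i _.
by rewrite cabsM exprMn.
Qed.

Lemma vnormD u v : vnorm (vadd u v) <= vnorm u + vnorm v.
Proof.
rewrite -ler_sqr ?nnegrE ?addr_ge0 ?vnorm_ge0 // vnormD_sqr sqrrD.
rewrite lerD2r lerD2l -[leRHS]mulr_natl ler_wpM2l //.
exact: le_trans (ler_norm _) (rdot_le _ _).
Qed.

Lemma vsubC u v : vsub u v = vscale (-1) (vsub v u).
Proof. by vec_ring. Qed.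

Lemma vnormBC u v : vnorm (vsub u v) = vnorm (vsub v u).
Proof. by rewrite vsubC vnormZ cabsN cabs1 mul1r. Qed.

Lemma vnorm_tri y x z : vnorm (vsub x z) <= vnorm (vsub x y) + vnorm (vsub y z).
Proof. by apply: le_trans (vnormD _ _); apply: le_of_eq; congr vnorm; vec_ring. Qed.

Lemma vnorm_triD x y : vnorm x <= vnorm (vsub x y) + vnorm y.
Proof. by apply: le_trans (vnormD _ _); apply: le_of_eq; congr vnorm; vec_ring. Qed.

Lemma vnorm_subD u v : vnorm (vsub u v) <= vnorm u + vnorm v.
Proof.
apply: le_trans (_ : vnorm (vadd u (vscale (-1) v)) <= _).
  by apply: le_of_eq; congr vnorm; vec_ring.
by apply: le_trans (vnormD _ _) _; rewrite vnormZ cabsN cabs1 mul1r.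
Qed.

Lemma vnorm0 : vnorm (@vzero R d) = 0.
Proof. by rewrite /vnorm big1 ?sqrtr0 // => i _; rewrite cabs0 expr0n. Qed.

Lemma vsubvv v : vsub v v = @vzero R d. Proof. by vec_ring. Qed.

Lemma vcomp_le v i : cabs (v i) <= vnorm v.
Proof.
rewrite -ler_sqr ?nnegrE ?cabs_ge0 ?vnorm_ge0 // vnorm_sqr (bigD1 i) //= lerDl.
by apply: sumr_ge0 => j _; exact: sqr_ge0.
Qed.

Lemma vnorm_le_sum v : vnorm v <= \sum_i cabs (v i).
Proof.
rewrite -ler_sqr ?nnegrE ?vnorm_ge0 ?sumr_ge0 //; last by move=> i _; exact: cabs_ge0.
rewrite vnorm_sqr.
have H (s : seq 'I_d) : \sum_(i <- s) cabs (v i) ^+ 2 <= (\sum_(i <- s) cabs (v i)) ^+ 2.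
  elim: s => [|a s IH]; first by rewrite !big_nil expr0n.
  rewrite !big_cons sqrrD; have h : 0 <= \sum_(j <- s) cabs (v j) by apply: sumr_ge0 => j _; exact: cabs_ge0.
  have h2 : 0 <= cabs (v a) * (\sum_(j <- s) cabs (v j)) *+ 2 by rewrite mulrn_wge0 // mulr_ge0 ?cabs_ge0.
  by rewrite -addrA lerD2l; apply: le_trans IH _; rewrite lerDr.
exact: H.
Qed.

Definition vcvg (x : nat -> cvec R d) (l : cvec R d) : Prop :=
  forall e, 0 < e -> \forall n \near Ufree, vnorm (vsub (x n) l) < e.

Lemma filter_forall_ord (P : 'I_d -> nat -> Prop) :
  (forall i, \forall n \near Ufree, P i n) -> \forall n \near Ufree, forall i, P i n.
Proof. by move=> h; apply: filter_forall. Qed.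

Lemma vcvgP (x : nat -> cvec R d) l : vcvg x l <-> forall i, ucvg (fun n => x n i) (l i).
Proof.
split=> [h i e /h|h e e0].
  by apply: filterS => n; apply: le_lt_trans; exact: (vcomp_le (vsub (x n) l)).
have e1 : 0 < e / (d.+1%:R) by rewrite divr_gt0.
have : \forall n \near Ufree, forall i, cabs (x n i - l i) < e / d.+1%:R.
  by apply: filter_forall_ord => i; exact: h.
apply: filterS => n H; apply: le_lt_trans (vnorm_le_sum _) _.
apply: le_lt_trans (_ : \sum_(i < d) e / d.+1%:R < _).
  by apply: ler_sum => i _; exact/ltW/H.
rewrite sumr_const card_ord -[ltLHS]mulr_natl mulrCA gtr_pMr // ltr_pdivrMr ?ltr0Sn //.
by rewrite mul1r ltr_nat.
Qed.

Lemma vcvg_ex (x : nat -> cvec R d) (M : R) : (\forall n \near Ufree, vnorm (x n) <= M) ->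
  exists l, vcvg x l.
Proof.
move=> h; have H i : exists l, ucvg (fun n => x n i) l.
  by apply: (ucvg_ex (M := M)); apply: filterS h => n; apply: le_trans; exact: vcomp_le.
by have [l hl] := choice H; exists l; apply/vcvgP.
Qed.

Lemma vcvg_cst (l : cvec R d) : vcvg (fun=> l) l.
Proof. by apply/vcvgP => i; exact: ucvg_cst. Qed.

Lemma vcvgD (x y : nat -> cvec R d) l m : vcvg x l -> vcvg y m -> vcvg (fun n => vadd (x n) (y n)) (vadd l m).
Proof. by move=> /vcvgP h1 /vcvgP h2; apply/vcvgP => i; exact: ucvgD. Qed.

Lemma vcvgB (x y : nat -> cvec R d) l m : vcvg x l -> vcvg y m -> vcvg (fun n => vsub (x n) (y n)) (vsub l m).
Proof. by move=> /vcvgP h1 /vcvgP h2; apply/vcvgP => i; exact: ucvgB. Qed.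

Lemma vcvgZ (a : C) (x : nat -> cvec R d) l : vcvg x l -> vcvg (fun n => vscale a (x n)) (vscale a l).
Proof. by move=> /vcvgP h; apply/vcvgP => i; exact: ucvgZ. Qed.

Lemma vcvg_norm (x : nat -> cvec R d) l e : vcvg x l -> 0 < e ->
  \forall n \near Ufree, `|vnorm (x n) - vnorm l| < e.
Proof.
move=> h e0; apply: filterS (h _ e0) => n h1.
have := vnorm_triD (x n) l; have := vnorm_triD l (x n); rewrite vnormBC => h2 h3.
by rewrite ltr_norml; apply/andP; split; lra.
Qed.

Lemma vcvg_norm_le (x : nat -> cvec R d) l (M : R) : vcvg x l -> (\forall n \near Ufree, vnorm (x n) <= M) -> vnorm l <= M.
Proof.
move=> xl h; apply/ler_eps => e e0.
have [n [/= ]] := filter_ex (filterI (vcvg_norm xl e0) h).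
by rewrite ltr_norml => /andP[]; lra.
Qed.

Lemma vcvg_norm_ge (x : nat -> cvec R d) l (M : R) : vcvg x l -> (\forall n \near Ufree, M <= vnorm (x n)) -> M <= vnorm l.
Proof.
move=> xl h; apply/ler_eps => e e0.
have [n [/= ]] := filter_ex (filterI (vcvg_norm xl e0) h).
by rewrite ltr_norml => /andP[]; lra.
Qed.

Lemma ucvg_sum (F : 'I_d -> nat -> C) (l : 'I_d -> C) :
  (forall i, ucvg (F i) (l i)) -> ucvg (fun n => \sum_i F i n) (\sum_i l i).
Proof.
move=> h; elim: (index_enum _) => [|i s IH].
  have -> : (fun n => \sum_(i <- [::]) F i n) = fun=> 0 by apply/funext => n; rewrite big_nil.
  by rewrite big_nil; exact: ucvg_cst.
have -> : (fun n => \sum_(j <- i :: s) F j n) = fun n => F i n + \sum_(j <- s) F j n.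
  by apply/funext => n; rewrite big_cons.
by rewrite big_cons; exact: ucvgD.
Qed.

Lemma ucvg_hdot (x y : nat -> cvec R d) l m : vcvg x l -> vcvg y m -> ucvg (fun n => hdot (x n) (y n)) (hdot l m).
Proof.
move=> /vcvgP h1 /vcvgP h2; apply: ucvg_sum => i.
by apply: ucvgM => //; exact: ucvgJ.
Qed.

End Vectors.

(** * Separation and the distance estimate *)

Section Separation.
Variable R : realType.
Local Notation C := (R[i]).
Variable d : nat.
Implicit Types (O : set (cvec R d)) (u v w x y p q c : cvec R d).

Lemma le0_of_small (a b : R) : 0 <= b -> (forall t, 0 < t -> t <= 1 -> a <= t * b) -> a <= 0.
Proof.
move=> b0 h; apply/ler_eps => e e0; rewrite add0r.
have b1 : 0 < b + 1 by rewrite ltr_wpDl.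
pose t := Num.min 1 (e / (b + 1)).
have t0 : 0 < t by rewrite lt_min ltr01 divr_gt0.
have t1 : t <= 1 by rewrite ge_min lexx.
apply: le_trans (h t t0 t1) _; apply: le_trans (_ : t * (b + 1) <= _).
  by rewrite ler_wpM2l ?lerDl // ltW.
by rewrite -ler_pdivlMr // ge_min lexx orbT.
Qed.

Lemma inf_ge0 (S : set R) : (forall s, S s -> 0 <= s) -> 0 <= inf S.
Proof.
move=> h; have [[s Ss]|/set0P/negP] := pselect (S !=set0).
  by apply: lb_le_inf => //; exists s.
by rewrite negbK => /eqP ->; rewrite inf0.
Qed.

Lemma inv_succ_small (e : R) : 0 < e -> exists N : nat, forall n, (N <= n)%N -> (n.+1%:R^-1 : R) < e.
Proof.
move=> e0; exists (trunc e^-1) => n hn.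
rewrite -[e]invrK ltf_pV2 ?posrE ?invr_gt0 //.
by apply: lt_le_trans (truncnS_gt _) _; rewrite ler_nat ltnS.
Qed.

(** The normal is x - l, where l is a limit of a minimising sequence for the distance from x to O.
    Moving from l towards q does not decrease the distance, which to first order is the inequality
    for q. *)
Lemma sep_closure O x : rconvex O -> O !=set0 -> ~ eclosure O x ->
  exists c, vnorm c = 1 /\ forall q, O q -> rdot (vsub q x) c <= 0.
Proof.
move=> cvO [z0 Oo] ncl.
pose S := [set vnorm (vsub x y) | y in O].
have S0 : has_inf S.
  by split; [exists (vnorm (vsub x z0)); exists z0|exists 0 => _ [y _ <-]; exact: vnorm_ge0].
have SD y : O y -> inf S <= vnorm (vsub x y).
  by move=> Oy; apply: ge_inf; [case: S0|exists y].
have [e0 e00 he0] : exists2 e, 0 < e & forall y, O y -> e <= vnorm (vsub x y).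
  apply: contrapT => h; apply: ncl => e e_gt0; apply: contrapT => h2; apply: h.
  exists e => // y Oy; rewrite leNgt; apply/negP => h3; apply: h2; exists y => //.
have H n : exists y, O y /\ vnorm (vsub x y) < inf S + n.+1%:R^-1.
  have n0 : (0 : R) < n.+1%:R^-1 by rewrite invr_gt0.
  by have [_ [y Oy <-] hy] := inf_adherent n0 S0; exists y.
have {H} [y hy] := choice H.
have xyb n : vnorm (vsub x (y n)) <= inf S + 1.
  have [_ h] := hy n; apply: le_trans (ltW h) _.
  by rewrite lerD2l invf_le1 ?ltr0Sn // ler1n.
have [|l yl] := @vcvg_ex _ _ y (inf S + 1 + vnorm x).
  apply: filterS filterT => n _; apply: le_trans (vnorm_triD (y n) x) _.
  by rewrite lerD2r vnormBC.
have lD : vnorm (vsub x l) <= inf S.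
  apply/ler_eps => e e_gt0.
  apply: (vcvg_norm_le (vcvgB (vcvg_cst x) yl)).
  have [N HN] := inv_succ_small e_gt0.
  apply: (@Ufree_inf _ N) => n nN; have [_ h] := hy n.
  by apply: le_trans (ltW h) _; rewrite lerD2l ltW // HN.
have lp : 0 < vnorm (vsub x l).
  apply: lt_le_trans e00 _; apply: (vcvg_norm_ge (vcvgB (vcvg_cst x) yl)).
  by apply: filterS filterT => n _; have [/he0] := hy n.
set c0 := vsub x l in lp lD.
have key q : O q -> rdot (vsub q l) c0 <= 0.
  move=> Oq; apply: (@le0_of_small _ (2^-1 * vnorm (vsub q l) ^+ 2)).
    by rewrite mulr_ge0 ?sqr_ge0 // invr_ge0.
  move=> t t0 t1.
  have h1 : inf S <= vnorm (vsub x (vadd (vscale (1 - t)%:C l) (vscale t%:C q))).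
    apply: (vcvg_norm_ge (vcvgB (vcvg_cst x) (vcvgD (vcvgZ _ yl) (vcvg_cst _)))).
    apply: filterS filterT => n _; apply: SD; apply: cvO => //; first by have [] := hy n.
    by rewrite t1 ltW.
  have h2 := le_trans lD h1.
  have -> : t * (2^-1 * vnorm (vsub q l) ^+ 2) = (t * vnorm (vsub q l)) ^+ 2 / (2 * t).
    by field; rewrite gt_eqF.
  rewrite ler_pdivlMr ?mulr_gt0 //.
  have : vnorm c0 ^+ 2 <= vnorm (vsub x (vadd (vscale (1 - t)%:C l) (vscale t%:C q))) ^+ 2.
    by rewrite ler_sqr ?nnegrE ?vnorm_ge0.
  have -> : vsub x (vadd (vscale (1 - t)%:C l) (vscale t%:C q)) = vadd c0 (vscale (- t)%:C (vsub q l)).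
    by rewrite /c0 rmorphB rmorphN; vec_ring.
  rewrite vnormD_sqr rdotC rdotZl vnormZ cabsR normrN (gtr0_norm t0); lra.
exists (vscale ((vnorm c0)^-1)%:C c0); split.
  by rewrite vnormZ cabsR ger0_norm ?invr_ge0 ?vnorm_ge0 // mulVf // gt_eqF.
move=> q Oq; rewrite rdotC rdotZl rdotC.
have -> : vsub q x = vsub (vsub q l) c0 by rewrite /c0; vec_ring.
rewrite rdotBl rdotvv pmulr_rle0 ?invr_gt0 //; have := key _ Oq.
have := sqr_ge0 (vnorm c0); lra.
Qed.

(** If the point beyond x were a limit of points a of O, x would lie on the segment from such an a
    to a point o' of the ball around o, hence in O. *)
Lemma not_closure_beyond O x o (t : R) : eopen O -> rconvex O -> O o -> ~ O x -> 0 < t ->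
  ~ eclosure O (vadd x (vscale t%:C (vsub x o))).
Proof.
move=> opO cvO Oo nx t0 cl; have [rho rho0 hrho] := opO _ Oo.
have [a Oa ha] := cl (rho * t) (mulr_gt0 rho0 t0).
set xn := vadd x _ in cl ha.
pose o' := vadd o (vscale (t^-1)%:C (vsub xn a)).
have Oo' : O o'.
  apply: hrho; have -> : vsub o' o = vscale (t^-1)%:C (vsub xn a) by rewrite /o'; vec_ring.
  by rewrite vnormZ cabsR ger0_norm ?invr_ge0 ?ltW // mulrC ltr_pdivrMr.
apply: nx; have t1 : 0 < 1 + t by rewrite ltr_wpDr // ltW.
have -> : x = vadd (vscale (1 - t / (1 + t))%:C a) (vscale (t / (1 + t))%:C o').
  have n1 : (1 + t)%:C != 0 :> C by rewrite -cabs_eq0 cabsR normr_eq0 gt_eqF.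
  have n2 : t%:C != 0 :> C by rewrite -cabs_eq0 cabsR normr_eq0 gt_eqF.
  have e0 : (1 + t)%:C = 1 + t%:C :> C by rewrite rmorphD.
  have e1 : (1 - t / (1 + t))%:C = 1 - t%:C / (1 + t)%:C :> C.
    by rewrite rmorphB rmorphM fmorphV.
  have e2 : (t / (1 + t))%:C = t%:C / (1 + t)%:C :> C by rewrite rmorphM fmorphV.
  have e3 : (t^-1)%:C = t%:C^-1 :> C by rewrite fmorphV.
  apply/funext => i; rewrite /o' /xn /vadd /vsub /vscale e1 e2 e3 e0.
  rewrite e0 in n1; field.
  by rewrite n1 n2.
apply: cvO => //; apply/andP; split; first by apply: divr_ge0; exact: ltW.
by rewrite ler_pdivrMr // mul1r lerDr.
Qed.

(** As x may be a boundary point, points [xn] beyond it are separated first and their unit normals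
    pass to the limit. Openness of O makes the inequality strict. *)
Lemma sep_open O x : eopen O -> rconvex O -> O !=set0 -> ~ O x ->
  exists c, vnorm c = 1 /\ forall q, O q -> rdot (vsub q x) c < 0.
Proof.
move=> opO cvO [z0 Oo] nx.
pose xn n := vadd x (vscale (n.+1%:R^-1)%:C (vsub x z0)).
have H n : exists c, vnorm c = 1 /\ forall q, O q -> rdot (vsub q (xn n)) c <= 0.
  apply: sep_closure => //; first by exists z0.
  by apply: not_closure_beyond => //; rewrite invr_gt0.
have [c hc] := choice H.
have [|l cl] := @vcvg_ex _ _ c 1.
  by apply: filterS filterT => n _; have [->] := hc n.
have l1 : vnorm l = 1.
  apply/eqP; rewrite eq_le; apply/andP; split.
    by apply: (vcvg_norm_le cl); apply: filterS filterT => n _; have [->] := hc n.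
  by apply: (vcvg_norm_ge cl); apply: filterS filterT => n _; have [->] := hc n.
have xl : vcvg xn x.
  move=> e e0; have V0 : 0 < vnorm (vsub x z0) + 1 by rewrite ltr_wpDl ?vnorm_ge0.
  have [N HN] := inv_succ_small (divr_gt0 e0 V0).
  apply: (@Ufree_inf _ N) => n nN.
  have -> : vsub (xn n) x = vscale (n.+1%:R^-1)%:C (vsub x z0) by rewrite /xn; vec_ring.
  rewrite vnormZ cabsR ger0_norm ?invr_ge0 //.
  apply: le_lt_trans (_ : n.+1%:R^-1 * (vnorm (vsub x z0) + 1) < _).
    by rewrite ler_wpM2l ?lerDl.
  by rewrite -ltr_pdivlMr // HN.
have weak q : O q -> rdot (vsub q x) l <= 0.
  move=> Oq; apply: (ucvg_Re_le (ucvg_hdot (vcvgB (vcvg_cst q) xl) cl)).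
  by apply: filterS filterT => n _; have [_] := hc n; exact.
exists l; split=> // q Oq.
have [e e0 he] := opO _ Oq.
have : O (vadd q (vscale (e / 2)%:C l)).
  apply: he; have -> : vsub (vadd q (vscale (e / 2)%:C l)) q = vscale (e / 2)%:C l by vec_ring.
  by rewrite vnormZ l1 mulr1 cabsR gtr0_norm ?divr_gt0 // ltr_pdivrMr // ltr_pMr // ltr1n.
move=> /weak; have -> : vsub (vadd q (vscale (e / 2)%:C l)) x = vadd (vsub q x) (vscale (e / 2)%:C l) by vec_ring.
rewrite rdotDl rdotZl rdotvv l1 expr1n mulr1; lra.
Qed.

Lemma holo_comp_hol O (f : C -> cvec R d) (z : C) i : holo_map O f -> disc z -> hol (fun w : C => f w i) z.
Proof. by move=> [hf _] dz; apply/derivable1_diffP; exact: hf. Qed.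

Lemma hol_hdot (f : C -> cvec R d) (x c : cvec R d) (z : C) : (forall i, hol (fun w : C => f w i) z) ->
  hol (fun w : C => hdot (vsub (f w) x) c) z.
Proof.
move=> h; apply: (@hol_sum _ _ _ (fun i (w : C) => (f w i - x i) * conjc (c i))) => i.
apply: holM; last exact: hol_cst.
by apply: holB; [exact: h|exact: hol_cst].
Qed.

(* Composing with the functional that supports O at a point of the complex line through
   f z and f w reduces the estimate to the half-plane. *)
Lemma holo_dist_le O (f : C -> cvec R d) (z w : C) : eopen O -> rconvex O -> C_proper O -> holo_map O f ->
  disc z -> disc w ->
  vnorm (vsub (f z) (f w)) <= 2 * pseudohyp z w / (1 - pseudohyp z w) * delta_dir O (f w) (vsub (f z) (f w)).
Proof.
move=> opO cvO prO hf dz dw.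
have p1 := pseudohyp_lt1 dz dw; have p0 := pseudohyp_ge0 z w.
set k := 2 * pseudohyp z w / (1 - pseudohyp z w); set v := vsub (f z) (f w).
have k0 : 0 <= k.
  by apply: divr_ge0; [exact: mulr_ge0|rewrite subr_ge0 ltW].
have Ofw : O (f w) by case: hf => _; exact.
have [v0|v0] := pselect (v = @vzero R d).
  by rewrite v0 vnorm0 mulr_ge0 //; apply: inf_ge0 => _ [q _ <-]; exact: vnorm_ge0.
rewrite /delta_dir; set S := (X in inf X).
(* An empty set has infimum 0 here, so [delta_dir] is a true distance only because O contains no
   complex line. *)
have Sne : S !=set0.
  apply: contrapT => h; apply: prO; exists (f w), v; split => // l.
  apply: contrapT => nO; apply: h; exists (vnorm (vsub (vadd (f w) (vscale l v)) (f w))).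
  by exists (vadd (f w) (vscale l v)) => //; split=> //; exists l.
have Sle s : S s -> vnorm v <= k * s.
  move=> [q [[l ->] nO] <-].
  have -> : vsub (vadd (f w) (vscale l v)) (f w) = vscale l v by vec_ring.
  rewrite vnormZ mulrA -[leLHS]mul1r ler_wpM2r ?vnorm_ge0 //.
  have [c [c1 hc]] := sep_open opO cvO (ex_intro _ _ Ofw) nO.
  set x := vadd (f w) (vscale l v) in nO hc.
  pose F (y : C) := - hdot (vsub (f y) x) c.
  have holF (y : C) : cabs y < 1 -> hol F y.
    by move=> y1; apply: holN; apply: hol_hdot => i; exact: (holo_comp_hol i hf).
  have posF (y : C) : cabs y < 1 -> 0 < Re (F y).
    move=> y1; rewrite /F ReN oppr_gt0; apply: hc; by case: hf => _; exact.
  have := halfplane_schwarz dz dw holF (fun (y : C) h => ltW (posF y h)); rewrite -/k.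
  have -> : F z - F w = - hdot v c.
    by rewrite /F /v !hdotBl; ring.
  have Fw : F w = l * hdot v c.
    rewrite /F -hdotZl /x /hdot -sumrN; apply: eq_bigr => i _.
    by rewrite /vsub /vadd /vscale; ring.
  (* [F w] is [l * hdot v c] and has positive real part, so |hdot v c| can be cancelled in |hdot v
     c| <= k |l| |hdot v c|. *)
  have hv : 0 < cabs (hdot v c).
    rewrite cabs_gt0; apply/eqP => h0; have := posF w dw.
    by rewrite Fw h0 mulr0 ltxx.
  rewrite cabsN => h; rewrite -(ler_pM2r hv) mul1r -mulrA -cabsM -Fw.
  by apply: le_trans h _; rewrite ler_wpM2l // Re_cabs.
have [k00|kn] := eqVneq k 0.
  by case: Sne => s /Sle; rewrite k00 !mul0r.
have kp : 0 < k by rewrite lt_neqAle eq_sym kn.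
rewrite mulrC -ler_pdivrMr //; apply: lb_le_inf => // s /Sle.
by rewrite ler_pdivrMr // mulrC.
Qed.

End Separation.

(** * Local Hausdorff limits and chains of discs *)

Section Domains.
Variable R : realType.
Local Notation C := (R[i]).
Variable d : nat.
Implicit Types (O : set (cvec R d)) (u v x y p q c : cvec R d).

Definition vball p (rho : R) : set (cvec R d) := [set y | vnorm (vsub y p) < rho].

Lemma delta_le O p q : ~ O q -> delta O p <= vnorm (vsub q p).
Proof. by move=> nq; apply: ge_inf; [exists 0 => _ [y _ <-]; exact: vnorm_ge0|exists q]. Qed.

Lemma delta_ball O p : vball p (delta O p) `<=` O.
Proof.
move=> q hq; apply: contrapT => /(@delta_le O p); apply/negP; rewrite -ltNge; exact: hq.
Qed.

(** The homothety with centre q and ratio t maps the ball around p onto this one. *)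
Lemma convex_ball O p q (rho t : R) : rconvex O -> vball p rho `<=` O -> O q -> 0 < t -> t <= 1 ->
  vball (vadd q (vscale t%:C (vsub p q))) (t * rho) `<=` O.
Proof.
move=> cvO hp Oq t0 t1 y; rewrite /vball /= => hy.
pose p' := vadd p (vscale (t^-1)%:C (vsub y (vadd q (vscale t%:C (vsub p q))))).
have tn : t%:C != 0 :> C by rewrite -cabs_eq0 cabsR normr_eq0 gt_eqF.
have -> : y = vadd (vscale (1 - t)%:C q) (vscale t%:C p').
  have e1 : (1 - t)%:C = 1 - t%:C :> C by rewrite rmorphB.
  have e2 : (t^-1)%:C = t%:C^-1 :> C by rewrite fmorphV.
  by apply/funext => i; rewrite /p' /vadd /vscale /vsub e1 e2; field.
apply: cvO => //; last by rewrite t1 ltW.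
apply: hp; rewrite /vball /=.
have -> : vsub p' p = vscale (t^-1)%:C (vsub y (vadd q (vscale t%:C (vsub p q)))) by rewrite /p'; vec_ring.
by rewrite vnormZ cabsR gtr0_norm ?invr_gt0 // mulrC ltr_pdivrMr // mulrC.
Qed.

Lemma in_eclosure O p : O p -> eclosure O p.
Proof. by move=> Op e e0; exists p => //; rewrite vsubvv vnorm0. Qed.

(** * Passing between the Om n and O *)

Section Hausdorff.
Variables (Om : nat -> set (cvec R d)) (O : set (cvec R d)).
Hypothesis hOm : forall n, [/\ eopen (Om n), rconvex (Om n) & Om n !=set0].
Hypotheses (opO : eopen O) (cvO : rconvex O) (O0 : O !=set0).
Hypothesis cvg : local_hausdorff_cvg Om O.

(** A point q outside [Om n] has a supporting hyperplane; the ball around q reaches beyond it into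
    O, too far from [Om n] for the Hausdorff distance. The index N is uniform in q. *)
Lemma hausdorff_inner (Rad eta : R) : 0 < Rad -> 0 < eta -> exists N, forall n, (N <= n)%N ->
  forall q, vball q eta `<=` O -> vnorm q <= Rad -> Om n q.
Proof.
move=> R0 e0; have Re0 : 0 < Rad + eta by rewrite addr_gt0.
have e20 : 0 < eta / 2 by rewrite divr_gt0.
have [N HN] := cvg Re0 e20.
exists N => n /HN [_ H] q hq qR; apply: contrapT => nq.
have [u1 c1 n1] := hOm n.
have [c [cn hc]] := sep_open u1 c1 n1 nq.
(* The margin beyond the hyperplane stays positive: 3/4 - 1/2 - 1/8 = 1/8, in units of eta. *)
pose t := eta * 3 / 4.
pose b := vadd q (vscale t%:C c).
have bq : vsub b q = vscale t%:C c by rewrite /b; vec_ring.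
have t0 : 0 < t by rewrite /t; lra.
have nbq : vnorm (vsub b q) = t by rewrite bq vnormZ cn mulr1 cabsR gtr0_norm.
have Ob : O b by apply: hq; rewrite /vball /= nbq /t; lra.
have [|a [acl aR] ab] := H b.
  split; first exact: in_eclosure.
  by apply: le_trans (vnorm_triD b q) _; rewrite nbq addrC /t; lra.
have [a' Oa' aa'] := acl (eta / 8) (divr_gt0 e0 (ltr0Sn _ _)).
have h1 := hc _ Oa'.
have : vsub a' q = vadd (vadd (vsub a' a) (vsub a b)) (vsub b q) by vec_ring.
move=> h2; move: h1; rewrite h2 bq 2!rdotDl rdotZl rdotvv cn expr1n mulr1.
have := rdot_le (vsub a' a) c; have := rdot_le (vsub a b) c.
rewrite cn !mulr1 vnormBC [vnorm (vsub a' a)]vnormBC !ler_norml => /andP[h3 _] /andP[h4 _].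
by rewrite vnormBC in ab; rewrite /t; lra.
Qed.

(** The same argument as in [hausdorff_inner] with the roles of O and [Om n] exchanged. *)
Lemma hausdorff_outer x (eta : R) : 0 < eta ->
  (\forall n \near Ufree, vball x eta `<=` Om n) -> O x.
Proof.
move=> e0 hU; apply: contrapT => nx.
have [c [cn hc]] := sep_open opO cvO O0 nx.
pose b := vadd x (vscale (eta / 2)%:C c).
have bx : vsub b x = vscale (eta / 2)%:C c by rewrite /b; vec_ring.
have e20 : 0 < eta / 2 by rewrite divr_gt0.
have nbx : vnorm (vsub b x) = eta / 2 by rewrite bx vnormZ cn mulr1 cabsR gtr0_norm.
have e80 : 0 < eta / 8 by rewrite divr_gt0.
have R0 : 0 < vnorm x + eta by rewrite ltr_wpDl ?vnorm_ge0.
have [N HN] := cvg R0 e80.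
have [n [/HN [H _] hn]] := Ufree_unbounded N hU.
have Ob : Om n b by apply: hn; rewrite /vball /= nbx; lra.
have [|a [acl aR] ab] := H b.
  split; first exact: in_eclosure.
  by apply: le_trans (vnorm_triD b x) _; rewrite nbx addrC; lra.
have [a' Oa' aa'] := acl _ e80.
have h1 := hc _ Oa'.
have : vsub a' x = vadd (vadd (vsub a' a) (vsub a b)) (vsub b x) by vec_ring.
move=> h2; move: h1; rewrite h2 bx 2!rdotDl rdotZl rdotvv cn expr1n mulr1.
have := rdot_le (vsub a' a) c; have := rdot_le (vsub a b) c.
rewrite cn !mulr1 vnormBC [vnorm (vsub a' a)]vnormBC !ler_norml => /andP[h3 _] /andP[h4 _]; lra.
Qed.

(** Limits may land on the boundary, so this gives only the closure; [psi_in] recovers O itself. *)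
Lemma hausdorff_closure (xn : nat -> cvec R d) x : (\forall n \near Ufree, Om n (xn n)) ->
  vcvg xn x -> eclosure O x.
Proof.
move=> hx xl e e0; have e30 : 0 < e / 3 by rewrite divr_gt0.
have R0 : 0 < vnorm x + e by rewrite ltr_wpDl ?vnorm_ge0.
have [N HN] := cvg R0 e30.
have [n [/HN [H _] [h1 h2]]] := Ufree_unbounded N (filterI hx (xl _ e30)).
have [|a [acl _] ab] := H (xn n).
  split; first exact: in_eclosure.
  by have := vnorm_triD (xn n) x; lra.
have [a' Oa' aa'] := acl _ e30; exists a' => //.
have := vnorm_tri a x a'; have := vnorm_tri (xn n) x a; rewrite vnormBC in h2.
lra.
Qed.
End Hausdorff.

(** An inductive form of [chain_lengths], on which concatenation, reversal and shrinking are
    inductions. *)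
Inductive disc_chain O : cvec R d -> cvec R d -> R -> Prop :=
| disc_chain_nil p : disc_chain O p p 0
| disc_chain_cons (f : C -> cvec R d) (a b : C) q (l : R) : holo_map O f -> disc a -> disc b ->
    disc_chain O (f b) q l -> disc_chain O (f a) q (poincare a b + l).

Lemma disc_chainP O p q (x : R) : disc_chain O p q x <-> chain_lengths O p q x%:E.
Proof.
split.
  elim=> {p q x} [p|f a b q x hf da db _ [N [pts [g [a' [b' [e1 e2 H e3]]]]]]].
    exists 0%N, (fun=> p), (fun=> fun=> p), (fun=> 0), (fun=> 0); split => //.
    by rewrite big_ord0.
  exists N.+1, (fun n => if n is k.+1 then pts k else f a), (fun n => if n is k.+1 then g k else f),
    (fun n => if n is k.+1 then a' k else a), (fun n => if n is k.+1 then b' k else b).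
  split => //.
    by case=> [|j] /=; [split=> //; rewrite e1|rewrite ltnS => /H].
  by rewrite big_ord_recl /=; case: e3 => ->.
move=> [N [pts [g [a' [b' [e1 e2 H [->]]]]]]].
elim: N p pts g a' b' e1 e2 H => [|N IH] p pts g a' b' e1 e2 H.
  by rewrite big_ord0 -e1 e2; exact: disc_chain_nil.
have [h1 h2 h3 h4 h5] := H 0%N isT.
rewrite big_ord_recl /= -e1 -h4; apply: disc_chain_cons => //.
apply: (IH _ (fun n => pts n.+1) (fun n => g n.+1) (fun n => a' n.+1) (fun n => b' n.+1)) => //.
by move=> j jN; exact: (H j.+1).
Qed.

Lemma disc_chain_kob O p q (x : R) : disc_chain O p q x -> (kobayashi O p q <= x%:E)%E.
Proof. by move=> /disc_chainP; exact: ereal_inf_lbound. Qed.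

Lemma disc_chain_cat O p q r (x y : R) : disc_chain O p q x -> disc_chain O q r y -> disc_chain O p r (x + y).
Proof.
move=> h; elim: h r y => {p q x} [p|f a b q x hf da db h IH] r y h2; first by rewrite add0r.
by rewrite -addrA; apply: disc_chain_cons => //; exact: IH.
Qed.

Lemma disc_chain1 O (f : C -> cvec R d) (a b : C) : holo_map O f -> disc a -> disc b -> disc_chain O (f a) (f b) (poincare a b).
Proof. by move=> hf da db; rewrite -[poincare a b]addr0; apply: disc_chain_cons => //; exact: disc_chain_nil. Qed.

(** The inverse hyperbolic tangent, which turns pseudo-hyperbolic into Poincare distance. *)
Definition pdist (t : R) : R := 2^-1 * ln ((1 + t) / (1 - t)).

Lemma poincareE (z w : C) : poincare z w = pdist (pseudohyp z w). Proof. by []. Qed.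

Lemma pseudohypC (z w : C) : pseudohyp z w = pseudohyp w z.
Proof.
rewrite /pseudohyp cabsBC -[X in _ / X]cabsJ; congr (_ / cabs _).
by rewrite conjcB conjcM conjcK conjc1 mulrC.
Qed.

Lemma poincareC (z w : C) : poincare z w = poincare w z.
Proof. by rewrite !poincareE pseudohypC. Qed.

Lemma disc_chain_sym O p q (x : R) : disc_chain O p q x -> disc_chain O q p x.
Proof.
elim=> {p q x} [p|f a b q x hf da db h IH]; first exact: disc_chain_nil.
by rewrite addrC poincareC; apply: disc_chain_cat IH _; exact: disc_chain1.
Qed.

Lemma geodesic_le O (phi : C -> cvec R d) (z w : C) (x : R) : complex_geodesic O phi -> disc z -> disc w ->
  disc_chain O (phi z) (phi w) x -> poincare z w <= x.
Proof.
move=> [_ H] dz dw /disc_chain_kob; by rewrite H // lee_fin.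
Qed.

Lemma pseudohyp0 (t : C) : pseudohyp 0 t = cabs t.
Proof. by rewrite /pseudohyp mulr0 subr0 cabs1 divr1 sub0r cabsN. Qed.

(** A single affine disc suffices: centred at p, it passes through q at parameter t and has radius
    |q - p| / t < rho. *)
Lemma disc_chain_ball O p q (rho t : R) : 0 < t -> t < 1 -> vball p rho `<=` O ->
  vnorm (vsub q p) < t * rho -> disc_chain O p q (pdist t).
Proof.
move=> t0 t1 hp hq.
pose f (z : C) : cvec R d := vadd p (vscale (z * (t^-1)%:C) (vsub q p)).
have dt : cabs t%:C < 1 by rewrite cabsR gtr0_norm.
have d0 : cabs (0 : C) < 1 by rewrite cabs0.
have hf : holo_map O f.
  split=> [z dz i|z dz].
    apply/derivable1_diffP; change (hol (fun w : C => p i + (w * (t^-1)%:C) * (q i - p i)) z).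
    apply: holD; first exact: hol_cst.
    by apply: holM; [apply: holM; [exact: hol_id|exact: hol_cst]|exact: hol_cst].
  apply: hp; rewrite /vball /=.
  have -> : vsub (f z) p = vscale (z * (t^-1)%:C) (vsub q p) by rewrite /f; vec_ring.
  rewrite vnormZ cabsM cabsR gtr0_norm ?invr_gt0 //.
  apply: le_lt_trans (_ : 1 * t^-1 * vnorm (vsub q p) < _).
    rewrite ler_wpM2r ?vnorm_ge0 // ler_wpM2r ?invr_ge0 ?ltW //.
  by rewrite mul1r mulrC ltr_pdivrMr // mulrC.
have tn : t%:C != 0 :> C by rewrite -cabs_eq0 cabsR normr_eq0 gt_eqF.
have f0 : f 0 = p by rewrite /f mul0r; vec_ring.
have ft : f t%:C = q by rewrite /f fmorphV divff //; vec_ring.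
have := disc_chain1 hf d0 dt; rewrite f0 ft poincareE pseudohyp0 cabsR gtr0_norm //.
Qed.

(** The points [x j] contract towards q. By convexity O contains the ball of radius tau^j rho around
    [x j], and the next point is less than half that radius away, whence J discs of length
    [pdist 2^-1]. The last disc is centred at q, in the ball of radius [delta O q]. *)
Lemma disc_chain_center O (b q : cvec R d) (rho D tau : R) (J : nat) :
  rconvex O -> vball b rho `<=` O -> O q -> vnorm (vsub b q) <= D ->
  0 < tau -> tau < 1 -> (1 - tau) * D < rho / 2 -> 2 * D * tau ^+ J < delta O q ->
  disc_chain O b q (J.+1%:R * pdist 2^-1).
Proof.
move=> cvO hb Oq hD tau0 tau1 htau hJ.
pose x j := vadd q (vscale (tau ^+ j)%:C (vsub b q)).
have h2 : (0 : R) < 2^-1 by rewrite invr_gt0.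
have h21 : (2^-1 : R) < 1 by rewrite invf_lt1 // ltr1n.
have xj j : disc_chain O b (x j) (j%:R * pdist 2^-1).
  elim: j => [|j IH].
    have -> : x 0%N = b by rewrite /x expr0; vec_ring.
    by rewrite mul0r; exact: disc_chain_nil.
  rewrite -natr1 mulrDl mul1r; apply: disc_chain_cat IH _.
  apply: (@disc_chain_ball _ _ _ (tau ^+ j * rho)) => //.
    by apply: convex_ball => //; [rewrite exprn_gt0|rewrite exprn_ile1 // ltW].
  have -> : vsub (x j.+1) (x j) = vscale (tau ^+ j * (tau - 1))%:C (vsub b q).
    have -> : (tau ^+ j * (tau - 1))%:C = (tau ^+ j.+1)%:C - (tau ^+ j)%:C :> C.
      by rewrite -rmorphB exprS; congr (_%:C); ring.
    by rewrite /x; vec_ring.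
  rewrite vnormZ cabsR normrM (gtr0_norm (exprn_gt0 _ tau0)) distrC gtr0_norm ?subr_gt0 //.
  rewrite -[ltLHS]mulrA [ltRHS]mulrCA ltr_pM2l ?exprn_gt0 // [ltRHS]mulrC.
  by apply: le_lt_trans htau; rewrite ler_wpM2l // subr_ge0 ltW.
rewrite -natr1 mulrDl mul1r; apply: disc_chain_cat (xj J) _.
apply: disc_chain_sym; apply: (@disc_chain_ball _ _ _ (delta O q)) => //; first exact: delta_ball.
have -> : vsub (x J) q = vscale (tau ^+ J)%:C (vsub b q) by rewrite /x; vec_ring.
rewrite vnormZ cabsR gtr0_norm ?exprn_gt0 // mulrC.
apply: le_lt_trans (_ : D * tau ^+ J < _).
  by rewrite ler_wpM2r // exprn_ge0 // ltW.
by rewrite ltr_pdivlMl // mulrA.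
Qed.

(* Consecutive points are at pseudo-hyperbolic distance at most 15/16. *)
Definition ray_pt (k : nat) : R := 1 - (16%:R ^+ k)^-1.

Lemma ray_pt_ge0 k : 0 <= ray_pt k.
Proof. by rewrite subr_ge0 invf_le1 ?exprn_gt0 // exprn_ege1 // ler1n. Qed.

Lemma ray_pt_lt1 k : ray_pt k < 1.
Proof. by rewrite gtrBl invr_gt0 exprn_gt0. Qed.

Lemma pdist_ray_pt k : k%:R * ln 16%:R <= 2 * pdist (ray_pt k).
Proof.
rewrite /pdist mulrA divff // mul1r mulr_natl -lnXn //.
have x0 : (0 : R) < 16%:R ^+ k by rewrite exprn_gt0.
have -> : 1 - ray_pt k = (16%:R ^+ k)^-1 by rewrite /ray_pt; ring.
have t1 : 0 < 1 + ray_pt k by rewrite ltr_pwDl // ray_pt_ge0.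
rewrite invrK ler_ln ?posrE ?mulr_gt0 // ler_pMl // lerDl; exact: ray_pt_ge0.
Qed.

(** Here [pdist 2^-1] is (ln 3)/2, so the comparison is 9 < 16; this gap fixes the base 16 of
    [ray_pt]. *)
Lemma pdist_half : 4 * pdist 2^-1 < ln 16%:R.
Proof.
rewrite /pdist; have -> : (1 + 2^-1) / (1 - 2^-1) = 3 :> R by field.
have -> : 4 * (2^-1 * ln 3) = ln 3 *+ 2 :> R by field.
by rewrite -lnXn // ltr_ln ?posrE // -natrX ltr_nat.
Qed.

(* Joining both points to the centre b by J+1 discs of length (ln 3)/2 each would make the
   chain shorter than the distance from 0 to 1 - 16^-(J+1). *)
Lemma geodesic_delta O (phi : C -> cvec R d) (b : cvec R d) (rho D tau s : R) (J : nat) :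
  rconvex O -> complex_geodesic O phi -> vball b rho `<=` O ->
  `|s| = ray_pt J.+1 ->
  vnorm (vsub b (phi 0)) <= D -> vnorm (vsub b (phi s%:C)) <= D ->
  0 < tau -> tau < 1 -> (1 - tau) * D < rho / 2 ->
  delta O (phi s%:C) <= delta O (phi 0) ->
  delta O (phi s%:C) <= 2 * D * tau ^+ J.
Proof.
move=> cvO geo hb hs D0 Ds tau0 tau1 htau hd; rewrite leNgt; apply/negP => h1.
have d0 : cabs (0 : C) < 1 by rewrite cabs0.
have ds : cabs s%:C < 1 by rewrite cabsR hs ray_pt_lt1.
have O0 : O (phi 0) by case: geo => [[_ +] _]; exact.
have Os : O (phi s%:C) by case: geo => [[_ +] _]; exact.
(* By [hd] the point phi 0 is at least as deep as phi s, so the same J serves for both. *)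
have c1 := disc_chain_center cvO hb O0 D0 tau0 tau1 htau (lt_le_trans h1 hd).
have c2 := disc_chain_center cvO hb Os Ds tau0 tau1 htau h1.
have := geodesic_le geo d0 ds (disc_chain_cat (disc_chain_sym c1) c2).
rewrite poincareE pseudohyp0 cabsR hs => h2.
have h3 := pdist_ray_pt J.+1; have h4 := pdist_half.
have h5 : J.+1%:R * (4 * pdist 2^-1) < J.+1%:R * ln 16%:R by rewrite ltr_pM2l.
by move: (J.+1%:R * pdist 2^-1) (J.+1%:R * ln 16%:R) h2 h3 h5 (mulrCA (J.+1%:R) 4 (pdist 2^-1)) => X Y; lra.
Qed.

End Domains.

(** * Summation along a ray *)

Section Ray.
Variable R : realType.
Local Notation C := (R[i]).
Variable d : nat.

Lemma geometric_small (A q eta : R) : 0 <= A -> 0 <= q -> q < 1 -> 0 < eta ->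
  exists J, A * q ^+ J <= eta.
Proof.
move=> A0 q0 q1 e0.
have q1' : `|q| < 1 by rewrite ger0_norm.
have A1 : 0 < A + 1 by rewrite ltr_wpDl.
have := cvg_expr q1' => /cvgrPdist_lt /(_ _ (divr_gt0 e0 A1)) [N _ /(_ N (leqnn N))] /=.
rewrite sub0r normrN ger0_norm ?exprn_ge0 // => h; exists N.
apply: le_trans (_ : (A + 1) * q ^+ N <= _).
  by rewrite ler_wpM2r ?exprn_ge0 // lerDl.
by rewrite mulrC -ler_pdivlMr // ltW.
Qed.

(** The geometric majorant makes the tail beyond some J small uniformly in x, and the bound e
    controls the J + 1 terms before it. The shift in the majorant leaves [x 0] to e alone. *)
Lemma small_sum (A q eta : R) : 0 <= A -> 0 <= q -> q < 1 -> 0 < eta ->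
  exists2 e : R, 0 < e & forall x : nat -> R, (forall j, 0 <= x j) -> (forall j, x j <= e) ->
    (forall j, x j.+1 <= A * q ^+ j) -> forall n, \sum_(j < n) x j <= eta.
Proof.
move=> A0 q0 q1 eta0; have q1' : 0 < 1 - q by rewrite subr_gt0.
have eta2 : 0 < eta / 2 by rewrite divr_gt0.
have [J hJ] := geometric_small (divr_ge0 A0 (ltW q1')) q0 q1 eta2.
exists (eta / 2 / J.+1%:R); first by rewrite divr_gt0.
move=> x x0 xe xq n.
have H i : \sum_(j < J.+1 + i) x j <= eta / 2 + A / (1 - q) * q ^+ J * (1 - q ^+ i).
  elim: i => [|i IH].
    rewrite addn0 expr0 subrr mulr0 addr0.
    apply: le_trans (_ : \sum_(j < J.+1) eta / 2 / J.+1%:R <= _); first exact: ler_sum.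
    by rewrite sumr_const card_ord -[leLHS]mulr_natr divfK // pnatr_eq0.
  rewrite addnS big_ord_recr /=; apply: le_trans (lerD IH (xq _)) _.
  rewrite -addrA lerD2l exprS exprD.
  rewrite le_eqVlt; apply/orP; left; apply/eqP; field.
  by rewrite gt_eqF.
apply: le_trans (_ : \sum_(j < J.+1 + n) x j <= _).
  rewrite addnC big_split_ord /= lerDl; apply: sumr_ge0 => i _; exact: x0.
apply: le_trans (H n) _; rewrite [leRHS](splitr eta) lerD2l.
apply: le_trans hJ.
have p0 : 0 <= A / (1 - q) * q ^+ J by rewrite mulr_ge0 ?exprn_ge0 // divr_ge0 // ltW.
by apply: ler_piMr p0 _; rewrite gerBl exprn_ge0.
Qed.

Lemma pseudohyp_real (s t u : R) : `|u| = 1 -> 0 <= t -> t <= s -> s < 1 ->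
  pseudohyp (s * u)%:C (t * u)%:C = (s - t) / (1 - t * s).
Proof.
move=> u1 t0 ts s1; have uu : u * u = 1 by rewrite -expr2 -real_normK ?num_real // u1 expr1n.
have -> : pseudohyp (s * u)%:C (t * u)%:C = cabs ((s - t) * u)%:C / cabs (1 - t * s)%:C.
  rewrite /pseudohyp conjcR; congr (cabs _ / cabs _); first by rewrite -rmorphB; congr _%:C; ring.
  rewrite -rmorphM -[1 in LHS]/(1%:C) -rmorphB; congr _%:C.
  by rewrite mulrACA uu mulr1.
rewrite !cabsR normrM u1 mulr1 !ger0_norm // subr_ge0 //.
apply: le_trans (_ : 1 * s <= 1); last by rewrite mul1r ltW.
by rewrite ler_wpM2r ?(le_trans t0) // ltW // (le_lt_trans ts).
Qed.

(** With x = 16^-n the extreme case s = 1 - x/16 has numerator 15x/16 and denominator x + (x -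
    x^2)/16, which is at least x. *)
Lemma ray_pt_step (n : nat) (s : R) : ray_pt R n <= s -> s <= ray_pt R n.+1 ->
  (s - ray_pt R n) / (1 - ray_pt R n * s) <= 15 / 16.
Proof.
rewrite /ray_pt exprS invfM; set x := (16 ^+ n)^-1 => h1 h2.
have x0 : 0 < x by rewrite invr_gt0 exprn_gt0.
have x1 : x <= 1 by rewrite invf_le1 ?exprn_gt0 // exprn_ege1 // ler1n.
rewrite ler_pdivrMr; first by nra.
by nra.
Qed.

Lemma ray_pt_cofinal (s : R) : s < 1 -> exists n, s <= ray_pt R n.
Proof.
move=> s1; have h : 0 < 1 - s by rewrite subr_gt0.
have [||n hn] := @geometric_small 1 (16%:R^-1) (1 - s) ler01 _ _ h.
- by rewrite invr_ge0.
- by rewrite invf_lt1 // ltr1n.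
by exists n; move: hn; rewrite mul1r exprVn /ray_pt; lra.
Qed.

(** A telescoping sum over the ray points, each increment being estimated by [holo_dist_le] from its
    inner end. The end s of the segment need not be a ray point, so the last step may be partial. *)
Lemma ray_bound (O : set (cvec R d)) (phi : C -> cvec R d) (u beta K mu : R) (E : nat -> R) :
  eopen O -> rconvex O -> C_proper O -> holo_map O phi -> `|u| = 1 -> beta < 1 -> 0 <= K -> 0 <= mu ->
  (forall t v, 0 <= t -> t <= beta -> v <> @vzero R d ->
     delta_dir O (phi (t * u)%:C) v <= K * powR (delta O (phi (t * u)%:C)) mu) ->
  (forall k, ray_pt R k <= beta -> delta O (phi (ray_pt R k * u)%:C) <= E k) ->
  forall n s, 0 <= s -> s <= beta -> s <= ray_pt R n ->
    vnorm (vsub (phi (s * u)%:C) (phi 0)) <= 30 * K * \sum_(j < n) powR (E j) mu.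
Proof.
move=> opO cvO prO hphi u1 b1 K0 mu0 hK hE; elim=> [|n IH] s s0 sb sn.
  rewrite big_ord0 mulr0; have -> : s = 0 by apply/eqP; rewrite eq_le s0 andbT; move: sn; rewrite /ray_pt expr0 invr1 subrr.
  by rewrite mul0r vsubvv vnorm0.
rewrite big_ord_recr /= mulrDr.
have [h|/ltW h] := leP s (ray_pt R n).
  by apply: le_trans (IH s s0 sb h) _; rewrite lerDl !mulr_ge0 ?powR_ge0.
have t0 := ray_pt_ge0 R n; have tb := le_trans h sb.
have cu r : 0 <= r -> r <= beta -> cabs (r * u)%:C < 1.
  by move=> r0 rb; rewrite cabsR normrM u1 mulr1 ger0_norm // (le_lt_trans rb).
apply: le_trans (vnorm_tri (phi (ray_pt R n * u)%:C) _ _) _; rewrite addrC; apply: lerD.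
  exact: IH.
have [->|vn] := pselect (vsub (phi (s * u)%:C) (phi (ray_pt R n * u)%:C) = @vzero R d).
  by rewrite vnorm0 !mulr_ge0 ?powR_ge0.
apply: le_trans (holo_dist_le opO cvO prO hphi (cu _ s0 sb) (cu _ t0 tb)) _.
have s1 : s < 1 by exact: le_lt_trans sb b1.
rewrite pseudohyp_real //.
have := ray_pt_step h sn.
have : 0 <= (s - ray_pt R n) / (1 - ray_pt R n * s).
  by rewrite -(pseudohyp_real u1) //; exact: pseudohyp_ge0.
set r := (s - ray_pt R n) / (1 - ray_pt R n * s) => r0 r1.
have hd := hK _ _ t0 tb vn.
have hdE : delta_dir O (phi (ray_pt R n * u)%:C) (vsub (phi (s * u)%:C) (phi (ray_pt R n * u)%:C)) <= K * powR (E n) mu.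
  apply: le_trans hd _; rewrite ler_wpM2l //.
  have dn0 : 0 <= delta O (phi (ray_pt R n * u)%:C) by apply: inf_ge0 => _ [q _ <-]; exact: vnorm_ge0.
  apply: ge0_ler_powR => //; rewrite ?nnegrE //; last exact: hE.
  by apply: le_trans dn0 _; exact: hE.
(* The value at r = 15/16. *)
have c30 : 2 * r / (1 - r) <= 30.
  by move: r r0 r1 => r' r0' r1'; rewrite ler_pdivrMr; lra.
have dd0 : 0 <= delta_dir O (phi (ray_pt R n * u)%:C) (vsub (phi (s * u)%:C) (phi (ray_pt R n * u)%:C)).
  by apply: inf_ge0 => _ [q _ <-]; exact: vnorm_ge0.
apply: le_trans (_ : 30 * delta_dir O (phi (ray_pt R n * u)%:C) (vsub (phi (s * u)%:C) (phi (ray_pt R n * u)%:C)) <= _).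
  exact: ler_wpM2r.
by rewrite -[leRHS]mulrA ler_wpM2l.
Qed.

End Ray.

(** * Upper semicontinuity of chain lengths *)

Section Shrinking.
Variable R : realType.
Local Notation C := (R[i]).
Variable d : nat.
Implicit Types (O : set (cvec R d)).

Lemma pdist_small (t : R) : 0 < t -> t <= 2^-1 -> pdist t <= 2 * t.
Proof.
move=> t0 t1; have t2 : 0 < 1 - t by lra.
have -> : pdist t = 2^-1 * ln (1 + 2 * t / (1 - t)).
  by rewrite /pdist; congr (_ * ln _); field; rewrite gt_eqF.
have h : 0 <= 2 * t / (1 - t) by rewrite divr_ge0 ?mulr_ge0 // ltW.
have h1 : ln (1 + 2 * t / (1 - t)) <= 2 * t / (1 - t).
  by apply: le_ln1Dx; apply: lt_le_trans h; lra.
have h2 : 2 * t / (1 - t) <= 4 * t by rewrite ler_pdivrMr //; nra.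
lra.
Qed.

Lemma ler_pdist (r s : R) : 0 <= r -> r <= s -> s < 1 -> pdist r <= pdist s.
Proof.
move=> r0 rs s1; rewrite /pdist ler_wpM2l ?invr_ge0 //.
have h1 : 0 < 1 - s by lra.
have h2 : 0 < 1 - r by lra.
rewrite ler_ln ?posrE ?divr_gt0 //; try lra.
rewrite ler_pdivrMr // mulrAC ler_pdivlMr //; nra.
Qed.

(** The fraction is the bound that [poincare_dilate] finds for the pseudo-hyperbolic distance after
    dilation by t. *)
Lemma pdist_cvg (P Q : R) : 0 <= P -> P < Q ->
  pdist (t * P / (Q - (t * t - 1))) @[t --> (1 : R)] --> pdist (P / Q).
Proof.
move=> P0 PQ; have Q0 : 0 < Q by exact: le_lt_trans PQ.
have cr : t * P / (Q - (t * t - 1)) @[t --> (1 : R)] --> P / Q.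
  have -> : P / Q = 1 * P / (Q - (1 * 1 - 1)) by rewrite !mul1r subrr subr0.
  apply: cvgM; first by apply: cvgM; [exact: cvg_id|exact: cvg_cst].
  apply: cvgV; first by rewrite mul1r subrr subr0 gt_eqF.
  apply: cvgB; first exact: cvg_cst.
  by apply: cvgB; [apply: cvgM; exact: cvg_id|exact: cvg_cst].
have r1 : P / Q < 1 by rewrite ltr_pdivrMr // mul1r.
have r0 : 0 <= P / Q by rewrite divr_ge0 // ltW.
apply: cvgM; first exact: cvg_cst.
apply: (@continuous_cvg _ _ _ _ _ _ (@ln R)); first by apply: continuous_ln; rewrite divr_gt0 //; lra.
apply: cvgM; first by apply: cvgD => //; exact: cvg_cst.
apply: cvgV; first by rewrite subr_eq0 gt_eqF.
by apply: cvgB => //; exact: cvg_cst.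
Qed.

(** Dilation by t multiplies the numerator |a - b| by t and lowers the denominator by at most t^2 -
    1, so the distance varies continuously at t = 1. *)
Lemma poincare_dilate (a b : C) (e : R) : cabs a < 1 -> cabs b < 1 -> 0 < e ->
  exists t : R, [/\ 1 < t, t * cabs a < 1, t * cabs b < 1 &
     poincare (t%:C * a) (t%:C * b) <= poincare a b + e].
Proof.
move=> a1 b1 e0; set P := cabs (a - b); set Q := cabs (1 - conjc b * a).
have P0 : 0 <= P by exact: cabs_ge0.
have PQ : P < Q by exact: pseudohyp_num.
have := pdist_cvg P0 PQ => /cvgrPdist_lt /(_ _ e0) /nbhs_ballP [d1 /= d10 hd].
(* In order: continuity of the bound, t <= 2, both dilated points in the disc, and a bounding
   fraction below 1, as s P + 2 s + s^2 <= 5 s < Q - P. *)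
pose s := Num.min (Num.min (d1 / 2) 1) (Num.min (Num.min ((1 - cabs a) / 2) ((1 - cabs b) / 2)) ((Q - P) / 8)).
have s0 : 0 < s by rewrite !lt_min !divr_gt0 ?subr_gt0 //= ltr01.
have : s <= s by [].
rewrite {2}/s !le_min => /andP[/andP[s1 s2] /andP[/andP[s3 s4] s5]].
exists (1 + s); have ca := cabs_ge0 a; have cb := cabs_ge0 b.
have ta : (1 + s) * cabs a < 1 by nra.
have tb : (1 + s) * cabs b < 1 by nra.
split=> //; first by rewrite ltrDl.
have hb : ball (1 : R) d1 (1 + s).
  by rewrite -ball_normE /ball_ /= opprD addrA subrr sub0r normrN gtr0_norm //; lra.
have := hd _ hb; rewrite /= ltr_norml => /andP[h _].
have e1 : poincare a b = pdist (P / Q) by [].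
apply: le_trans (_ : pdist ((1 + s) * P / (Q - ((1 + s) * (1 + s) - 1))) <= _); last first.
  by rewrite e1; lra.
have den : 0 < Q - ((1 + s) * (1 + s) - 1) by nra.
rewrite poincareE; apply: ler_pdist; first exact: pseudohyp_ge0.
  rewrite /pseudohyp -mulrBr cabsM cabsR ger0_norm; last by lra.
  rewrite -/P; apply: ler_wpM2l; first by rewrite mulr_ge0 //; lra.
  have hQ : Q - ((1 + s) * (1 + s) - 1) <= cabs (1 - conjc ((1 + s)%:C * b) * ((1 + s)%:C * a)).
    have ab : cabs (conjc b * a) <= 1 by rewrite cabsM cabsJ mulr_ile1 // ltW.
    have h2 : cabs (((1 + s) * (1 + s) - 1)%:C * (conjc b * a)) <= (1 + s) * (1 + s) - 1.
      rewrite cabsM cabsR ger0_norm; last by nra.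
      rewrite -[leRHS]mulr1; apply: ler_wpM2l => //; nra.
    have := cabsD (1 - conjc ((1 + s)%:C * b) * ((1 + s)%:C * a)) (((1 + s) * (1 + s) - 1)%:C * (conjc b * a)).
    have -> : 1 - conjc ((1 + s)%:C * b) * ((1 + s)%:C * a) + ((1 + s) * (1 + s) - 1)%:C * (conjc b * a) = 1 - conjc b * a.
      by rewrite conjcM conjcR rmorphB rmorphM rmorph1; ring.
    by rewrite -/Q; lra.
  by rewrite lef_pV2 ?posrE // (lt_le_trans den).
have P2 : P <= 2.
  by apply: le_trans (cabsD _ _) _; rewrite cabsN; have := ltW a1; have := ltW b1; lra.
have sP : s * P <= s * 2 by rewrite ler_wpM2l // ltW.
have ss : s * s <= s * 1 by rewrite ler_wpM2l // ltW.
by rewrite ltr_pdivrMr // mul1r; lra.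
Qed.

Lemma ucvg_holo O (f : C -> cvec R d) (z : C) (x : nat -> C) : holo_map O f -> disc z ->
  ucvg x z -> vcvg (fun n => f (x n)) (f z).
Proof.
move=> hf dz xz; apply/vcvgP => i.
exact: (ucvg_comp (holo_comp_hol i hf dz) xz).
Qed.

(** Compactness of the closed disc again; one integer N controls both the distance to the complement
    and the norm. *)
Lemma holo_compact O (f : C -> cvec R d) (r : R) : eopen O -> holo_map O f -> r < 1 ->
  exists2 N : nat, (0 < N)%N & forall w, cabs w <= r -> vball (f w) (N%:R^-1) `<=` O /\ vnorm (f w) <= N%:R.
Proof.
move=> opO hf r1; apply: contrapT => nh.
have H n : exists w, cabs w <= r /\ ~ (vball (f w) (n.+1%:R^-1) `<=` O /\ vnorm (f w) <= n.+1%:R).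
  apply: contrapT => h; apply: nh; exists n.+1 => // w wr.
  by apply: contrapT => h2; apply: h; exists w.
have [x hx] := choice H.
have [|z xz] := @ucvg_ex _ x r; first by apply: filterS filterT => n _; case: (hx n).
have zr : cabs z <= r by apply: (ucvg_cabs xz); apply: filterS filterT => n _; case: (hx n).
have dz : disc z by exact: le_lt_trans r1.
have Ofz : O (f z) by case: hf => _; exact.
have [rho rho0 hrho] := opO _ Ofz.
have rho2 : 0 < rho / 2 by rewrite divr_gt0.
have fx := ucvg_holo hf dz xz.
have [N HN] := inv_succ_small rho2.
have [n [nN [h1 h2]]] := Ufree_unbounded (N + trunc (vnorm (f z) + 1)) (filterI (fx _ rho2) (vcvg_norm fx ltr01)).
have [_] := hx n; apply; split.
  move=> y; rewrite /vball /= => hy; apply: hrho.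
  apply: le_lt_trans (vnorm_tri (f (x n)) _ _) _; rewrite [ltRHS](splitr rho) ltrD //.
  by apply: lt_trans hy _; apply: HN; apply: leq_trans nN; rewrite leq_addr.
move: h2; rewrite ltr_norml => /andP[_ h2].
have h3 := truncnS_gt (vnorm (f z) + 1).
have h4 : ((trunc (vnorm (f z) + 1)).+1%:R : R) <= n.+1%:R.
  by rewrite ler_nat ltnS; apply: leq_trans nN; rewrite leq_addl.
lra.
Qed.

Variables (Om : nat -> set (cvec R d)) (O : set (cvec R d)).
Hypothesis hOm : forall n, [/\ eopen (Om n), rconvex (Om n) & Om n !=set0].
Hypothesis opO : eopen O.
Hypothesis cvg : local_hausdorff_cvg Om O.

(** The disc z -> f (z / t) has image in a compact part of O, hence in [Om n]; it meets f a and f b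
    at the dilated parameters t a and t b. *)
Lemma shrink_disc f (a b : C) (e : R) : holo_map O f -> disc a -> disc b -> 0 < e ->
  exists2 l : R, l <= poincare a b + e & \forall n \near Ufree, disc_chain (Om n) (f a) (f b) l.
Proof.
move=> hf da db e0; have [t [t1 ta tb hp]] := poincare_dilate da db e0.
have t0 : 0 < t by lra.
have tn : t%:C != 0 :> C by rewrite -cabs_eq0 cabsR normr_eq0 gt_eqF.
exists (poincare (t%:C * a) (t%:C * b)) => //.
have ti : t^-1 < 1 by rewrite invf_lt1.
have [N N0 HN] := holo_compact opO hf ti.
have N0R : (0 : R) < N%:R by rewrite ltr0n.
have NV : (0 : R) < N%:R^-1 by rewrite invr_gt0.
have [M HM] := hausdorff_inner hOm cvg N0R NV.
apply: (@Ufree_inf _ M) => n /HM hn.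
pose g (z : C) := f ((t^-1)%:C * z).
have inr z : cabs z < 1 -> cabs ((t^-1)%:C * z) <= t^-1.
  move=> z1; rewrite cabsM cabsR ger0_norm ?invr_ge0 ?(ltW t0) //.
  by apply: ler_piMr; [rewrite invr_ge0 ltW|exact: ltW].
have hg : holo_map (Om n) g.
  split=> [z dz i|z dz].
    apply/derivable1_diffP; apply: (@hol_comp _ (fun w : C => f w i) (fun z : C => (t^-1)%:C * z)).
      by apply: holM; [exact: hol_cst|exact: hol_id].
    by apply: (holo_comp_hol i hf); exact: le_lt_trans (inr _ dz) ti.
  by have [h1 h2] := HN _ (inr _ dz); apply: hn.
have ga c : g (t%:C * c) = f c by rewrite /g mulrA -rmorphM mulVf ?gt_eqF // mul1r.
have dta : cabs (t%:C * a) < 1 by rewrite cabsM cabsR gtr0_norm.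
have dtb : cabs (t%:C * b) < 1 by rewrite cabsM cabsR gtr0_norm.
by have := disc_chain1 hg dta dtb; rewrite !ga.
Qed.

Lemma shrink_chain p q (l e : R) : disc_chain O p q l -> 0 < e ->
  exists2 l' : R, l' <= l + e & \forall n \near Ufree, disc_chain (Om n) p q l'.
Proof.
move=> h; elim: h e => {p q l} [p|f a b q l hf da db _ IH] e e0.
  by exists 0; [rewrite add0r ltW|apply: filterS filterT => n _; exact: disc_chain_nil].
have e20 : 0 < e / 2 by rewrite divr_gt0.
have [l1 h1 h2] := shrink_disc hf da db e20.
have [l2 h3 h4] := IH _ e20.
exists (l1 + l2); first by lra.
by apply: filterS2 h2 h4 => n; exact: disc_chain_cat.
Qed.

(** Joins a limit point to its approximants at arbitrarily small cost; the cap 1/2 is for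
    [pdist_small]. *)
Lemma chain_near p (x : nat -> cvec R d) (e : R) : O p -> vcvg x p -> 0 < e ->
  \forall n \near Ufree, disc_chain (Om n) p (x n) (pdist (Num.min 2^-1 (e / 2))) .
Proof.
move=> Op xp e0; have [rho rho0 hrho] := opO Op.
set t := Num.min _ _; have t0 : 0 < t by rewrite lt_min invr_gt0 ltr0n divr_gt0.
have t1 : t < 1 by apply: le_lt_trans (_ : t <= 2^-1) _; [rewrite ge_min lexx|rewrite invf_lt1 // ltr1n].
have r20 : 0 < rho / 2 by rewrite divr_gt0.
have P1 : 0 < vnorm p + rho by rewrite ltr_wpDl ?vnorm_ge0.
have [N HN] := hausdorff_inner hOm cvg P1 r20.
have h1 : \forall n \near Ufree, vball p (rho / 2) `<=` Om n.
  apply: (@Ufree_inf _ N) => n /HN hn q; rewrite /vball /= => hq; apply: hn.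
    move=> y; rewrite /vball /= => hy; apply: hrho.
    by apply: le_lt_trans (vnorm_tri q _ _) _; rewrite [ltRHS](splitr rho) ltrD.
  by have := vnorm_triD q p; lra.
have tr : 0 < t * (rho / 2) by rewrite mulr_gt0.
by apply: filterS2 h1 (xp _ tr) => n h2 h3; exact: disc_chain_ball h3.
Qed.

End Shrinking.

(** * The limiting geodesic *)

Section Main.
Variable R : realType.
Local Notation C := (R[i]).
Variables (d : nat) (m : R) (Om : nat -> set (cvec R d)) (O : set (cvec R d)).
Variables (phi : nat -> C -> cvec R d) (Rad : R).
Hypothesis m0 : 0 < m.
Hypothesis hOm : forall n, eopen (Om n) /\ rconvex (Om n) /\ C_proper (Om n).
Hypothesis hm : loc_m_convex m Om.
Hypotheses (opO : eopen O) (cvO : rconvex O) (prO : C_proper O).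
Hypothesis cvg : local_hausdorff_cvg Om O.
Hypothesis geo : forall n, complex_geodesic (Om n) (phi n).
Hypothesis Rad0 : 0 < Rad.
Hypothesis phi0 : forall n, vnorm (phi n 0) < Rad.
Hypothesis v_neq0 : exists v : cvec R d, v <> @vzero R d.

Let hphi n : holo_map (Om n) (phi n). Proof. by case: (geo n). Qed.

Let Omphi n (z : C) : cabs z < 1 -> Om n (phi n z).
Proof. by case: (hphi n) => _; exact. Qed.

Let c01 : cabs (0 : C) < 1. Proof. by rewrite cabs0. Qed.

Let hOm3 n : [/\ eopen (Om n), rconvex (Om n) & Om n !=set0].
Proof. by have [h1 [h2 _]] := hOm n; split => //; exists (phi n 0); exact: Omphi. Qed.

Let O_ne : O !=set0.
Proof.
have [N HN] := cvg Rad0 ltr01.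
have [H _] := HN N (leqnn N).
have [|b [bcl _] _] := H (phi N 0).
  by split; [apply: in_eclosure; exact: Omphi|exact: ltW].
by have [a Oa _] := bcl 1 ltr01; exists a.
Qed.

Let O_neT : exists x, ~ O x.
Proof.
apply: contrapT => h; apply: prO; have [v v0] := v_neq0; exists v, v; split => // l.
by apply: contrapT => h2; apply: h; exists (vadd v (vscale l v)).
Qed.

Lemma ball_near p : O p -> exists2 rho : R, 0 < rho & \forall n \near Ufree, vball p rho `<=` Om n.
Proof.
move=> Op; have [rho rho0 hrho] := opO Op.
have r20 : 0 < rho / 2 by rewrite divr_gt0.
have P1 : 0 < vnorm p + rho by rewrite ltr_wpDl ?vnorm_ge0.
have [N HN] := hausdorff_inner hOm3 cvg P1 r20.
exists (rho / 2) => //; apply: (@Ufree_inf _ N) => n /HN hn q; rewrite /vball /= => hq; apply: hn.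
  move=> y; rewrite /vball /= => hy; apply: hrho.
  by apply: le_lt_trans (vnorm_tri q _ _) _; rewrite [ltRHS](splitr rho) ltrD.
by have := vnorm_triD q p; lra.
Qed.

(** A point x outside O has, for most n, a point outside [Om n] within distance 1; otherwise
    [hausdorff_outer] would put x in O. *)
Lemma delta_near : exists B : R, 0 <= B /\ \forall n \near Ufree, forall p, delta (Om n) p <= B + vnorm p.
Proof.
have [x nx] := O_neT; exists (1 + vnorm x); split; first by rewrite addr_ge0 ?vnorm_ge0.
case: (Ufree_em (fun n => vball x 1 `<=` Om n)) => h.
  by case: nx; exact: (hausdorff_outer opO cvO O_ne cvg ltr01 h).
apply: filterS h => n hn p.
have [y yx ny] : exists2 y, vnorm (vsub y x) < 1 & ~ Om n y.
  by apply: contrapT => h2; apply: hn => y yx; apply: contrapT => ny; apply: h2; exists y.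
apply: le_trans (delta_le p ny) _.
have := vnorm_subD y p; have := vnorm_triD y x; lra.
Qed.

Let delta_ge0 n p : 0 <= delta (Om n) p.
Proof. by apply: inf_ge0 => _ [q _ <-]; exact: vnorm_ge0. Qed.

(** * The depth of phi_n(0) stays bounded below *)

Section Lower.
Variables (a b : nat -> R) (L : R).
Hypothesis ab1 : forall n, -1 < a n < 1 /\ -1 < b n < 1.
Hypothesis ab0 : forall n, a n <= 0 <= b n.
Hypothesis phiR : forall n (t : R), a n <= t <= b n -> vnorm (phi n t%:C) < Rad.
Hypothesis L0 : 0 < L.
Hypothesis phiL : \forall n \near Ufree, L / 2 < vnorm (vsub (phi n (a n)%:C) (phi n (b n)%:C)).
Hypothesis phid : forall n (t : R), a n <= t <= b n ->
     delta (Om n) (phi n t%:C) <= delta (Om n) (phi n 0).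

(** If the depth at 0 tended to 0, [ray_bound] and [small_sum] would bring both endpoints within L/8
    of phi_n(0), although they are more than L/2 apart. *)
Lemma delta_center_lower : exists2 e : R, 0 < e & \forall n \near Ufree, e <= delta (Om n) (phi n 0).
Proof.
have quarter : L / 8 + L / 8 <= L / 2 by have := L0; lra.
apply: contrapT => nh.
have small e : 0 < e -> \forall n \near Ufree, delta (Om n) (phi n 0) < e.
  move=> e0; case: (Ufree_em (fun n => delta (Om n) (phi n 0) < e)) => // h.
  by case: nh; exists e => //; apply: filterS h => n /negP; rewrite -leNgt.
have [p Op] := O_ne.
have [rho rho0 hball] := ball_near Op.
set D := vnorm p + Rad.
have D0 : 0 < D by rewrite ltr_wpDl ?vnorm_ge0.
(* Chosen for [tau = 1 - del] to satisfy (1 - tau) D < rho / 2, as [disc_chain_center] requires. *)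
pose del := Num.min 2^-1 (rho / (4 * D)).
have del0 : 0 < del by rewrite lt_min invr_gt0 ltr0n divr_gt0 // mulr_gt0.
have del1 : del <= 2^-1 by rewrite ge_min lexx.
have delD : del * D < rho / 2.
  apply: le_lt_trans (_ : rho / (4 * D) * D < _).
    by rewrite ler_wpM2r ?(ltW D0) // ge_min lexx orbT.
  by have -> : rho / (4 * D) * D = rho / 4; [field; rewrite gt_eqF|lra].
pose tau := 1 - del.
have tau0 : 0 < tau by rewrite /tau; lra.
have tau1 : tau < 1 by rewrite /tau; lra.
have htau : (1 - tau) * D < rho / 2 by rewrite /tau opprB addrC subrK.
have [N [K K0 HK]] := hm Rad0.
pose mu := m^-1.
have mu0 : 0 < mu by rewrite invr_gt0.
pose A := powR (2 * D) mu; pose q := powR tau mu.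
have q0 : 0 <= q by exact: powR_ge0.
have q1 : q < 1.
  have p1 : powR 1 mu = 1 by rewrite powR1.
  rewrite -[ltRHS]p1; apply: gt0_ltr_powR => //; rewrite nnegrE //; exact: ltW.
(* The factor [30 * K] of [ray_bound] turns this into L/8. *)
have eta0 : 0 < L / 8 / (30 * K) by rewrite !divr_gt0 // mulr_gt0.
have [e1 e10 He1] := small_sum (powR_ge0 (2 * D) mu) q0 q1 eta0.
(* The power 1/m brings this threshold back to [e1]. *)
have eps0 : 0 < powR e1 m by rewrite powR_gt0.
have [n [nN [h1 [h2 h3]]]] := Ufree_unbounded N.+1 (filterI (small _ eps0) (filterI hball phiL)).
have [opn [cvn prn]] := hOm n.
pose d0 := delta (Om n) (phi n 0).
(* At [ray_pt 0], which is 0, there is only the bound [d0]; at the later points [geodesic_delta]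
   adds the geometric one. *)
pose E (j : nat) := if j is J.+1 then Num.min d0 (2 * D * tau ^+ J) else d0.
have DtJ J : 0 <= 2 * D * tau ^+ J by rewrite mulr_ge0 ?exprn_ge0 ?mulr_ge0 // ltW.
have E0 j : 0 <= E j by case: j => [|J] /=; rewrite ?le_min ?delta_ge0 ?DtJ.
have Ed j : E j <= d0 by case: j => [|J] /=; rewrite ?ge_min lexx.
have sumE k : \sum_(j < k) powR (E j) mu <= L / 8 / (30 * K).
  apply: (He1 (fun j => powR (E j) mu)) => [j|j|j]; first exact: powR_ge0.
    apply: le_trans (_ : powR (powR e1 m) mu <= _).
      apply: ge0_ler_powR; rewrite ?nnegrE ?E0 ?powR_ge0 ?(ltW mu0) //.
      by apply: le_trans (Ed j) _; exact: ltW.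
    by rewrite -powRrM divff ?gt_eqF // powRr1 // ltW.
  apply: le_trans (_ : powR (2 * D * tau ^+ j) mu <= _).
    by apply: ge0_ler_powR; rewrite ?nnegrE ?E0 ?DtJ ?(ltW mu0) //= ge_min lexx orbT.
  have D20 : 0 <= 2 * D by rewrite mulr_ge0 // ltW.
  have tj0 : 0 <= tau ^+ j by rewrite exprn_ge0 // ltW.
  rewrite (powRM mu D20 tj0) -(powR_mulrn j (ltW tau0)) -powRrM (mulrC _ mu) powRrM.
  by rewrite (powR_mulrn j q0).
(* Both halves of the segment at once: u = 1 with beta = b n, and u = -1 with beta = - a n. *)
have side (u beta : R) : `|u| = 1 -> 0 <= beta -> beta < 1 ->
    (forall t, 0 <= t -> t <= beta -> a n <= t * u <= b n) ->
    vnorm (vsub (phi n (beta * u)%:C) (phi n 0)) <= L / 8.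
  move=> u1 b0 b1 hab; have [k hk] := ray_pt_cofinal b1.
  have := @ray_bound R d (Om n) (phi n) u beta K mu E opn cvn prn (hphi n) u1 b1 (ltW K0) (ltW mu0).
  move=> /(_ _ _ k beta b0 (lexx _) hk) H.
  apply: le_trans (H _ _) _.
  - move=> t v t0 tb v0; apply: HK => //; last exact: (phiR (hab _ t0 tb)).
    by apply: Omphi; rewrite cabsR normrM u1 mulr1 ger0_norm // (le_lt_trans tb).
  - move=> [|J] hJ /=; first by apply: phid; exact: hab (ray_pt_ge0 R 0) hJ.
    have habJ := hab _ (ray_pt_ge0 R J.+1) hJ.
    rewrite le_min phid //=.
    have Db s : vnorm s < Rad -> vnorm (vsub p s) <= D.
      by move=> sR; apply: le_trans (vnorm_subD _ _) _; rewrite lerD2l ltW.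
    apply: (geodesic_delta cvn (geo n) h2 _ (Db _ (phi0 n)) (Db _ (phiR habJ)) tau0 tau1 htau (phid habJ)).
    by rewrite normrM u1 mulr1 ger0_norm // ray_pt_ge0.
  apply: le_trans (_ : 30 * K * (L / 8 / (30 * K)) <= _).
    by rewrite ler_wpM2l // mulr_ge0 // ltW.
  by rewrite mulrC divfK // gt_eqF // mulr_gt0.
have /andP[an0 bn0] := ab0 n; have [/andP[an1 _] /andP[_ bn1]] := ab1 n.
have s1 : vnorm (vsub (phi n (b n)%:C) (phi n 0)) <= L / 8.
  have := side 1 (b n); rewrite normr1 mulr1; apply => // t t0 tb.
  by rewrite mulr1 tb (le_trans an0).
have s2 : vnorm (vsub (phi n (a n)%:C) (phi n 0)) <= L / 8.
  have := side (-1) (- a n); rewrite normrN1 mulrN1 opprK; apply => //.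
  - by rewrite oppr_ge0.
  - by rewrite ltrNl.
  by move=> t t0 tb; rewrite mulrN1; apply/andP; split; [rewrite lerNr|rewrite (le_trans _ bn0) // oppr_le0].
have := vnorm_tri (phi n 0) (phi n (a n)%:C) (phi n (b n)%:C).
rewrite [vnorm (vsub (phi n 0) _)]vnormBC => h4.
have h5 := lt_le_trans h3 (le_trans h4 (lerD s2 s1)).
by have := quarter; rewrite leNgt h5.
Qed.
End Lower.

(** * Equicontinuity, the limit and its properties *)

Variable eps : R.
Hypothesis eps0 : 0 < eps.
Hypothesis heps : \forall n \near Ufree, eps <= delta (Om n) (phi n 0).

Let pseudohyp_le (r : R) (z w : C) : r < 1 -> cabs z <= r -> cabs w <= r ->
  pseudohyp z w <= cabs (z - w) / (1 - r).
Proof.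
move=> r1 zr wr; have r0 : 0 <= r by exact: le_trans (cabs_ge0 _) zr.
have h : 1 - r <= cabs (1 - conjc w * z).
  have : cabs (conjc w * z) <= r.
    rewrite cabsM cabsJ; apply: le_trans (_ : 1 * r <= _); last by rewrite mul1r.
    by apply: ler_pM; rewrite ?cabs_ge0 // (le_trans wr) // ltW.
  by have := cabs_tri (conjc w * z) 1 0; rewrite !subr0 cabs1; lra.
rewrite /pseudohyp ler_wpM2l ?cabs_ge0 // lef_pV2 ?posrE ?subr_gt0 //.
by apply: lt_le_trans h; rewrite subr_gt0.
Qed.

Let two_pseudohyp (s t : R) : 0 <= s -> s <= t -> t < 1 -> 2 * s / (1 - s) <= 2 * t / (1 - t).
Proof.
move=> s0 st t1; rewrite ler_pdivrMr ?subr_gt0 ?(le_lt_trans st) //.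
rewrite mulrAC ler_pdivlMr ?subr_gt0 //; nra.
Qed.

(** Only the value at w has to be bounded beforehand. With w = 0 this bounds phi_n on smaller discs,
    and those bounds then allow any w there. *)
Lemma phi_dist_near (M : R) : 0 < M -> exists2 K : R, 0 < K & \forall n \near Ufree,
  forall z w : C, cabs z < 1 -> cabs w < 1 -> vnorm (phi n w) < M ->
    vnorm (vsub (phi n z) (phi n w)) <= 2 * pseudohyp z w / (1 - pseudohyp z w) * K.
Proof.
move=> M0; have [N [K K0 HK]] := hm M0; have [B [B0 HB]] := delta_near.
have mu0 : 0 <= m^-1 by rewrite invr_ge0 ltW.
exists (K * powR (B + M) m^-1); first by rewrite mulr_gt0 // powR_gt0 // ltr_wpDl.
apply: filterS2 (@Ufree_inf (fun n => (N < n)%N) N.+1 (fun n h => h)) HB => n nN hB z w z1 w1 wM.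
have [opn [cvn prn]] := hOm n.
have p1 := pseudohyp_lt1 z1 w1; have p0 := pseudohyp_ge0 z w.
have c0 : 0 <= 2 * pseudohyp z w / (1 - pseudohyp z w) by apply: divr_ge0; [exact: mulr_ge0|rewrite subr_ge0 ltW].
have [->|v0] := pselect (vsub (phi n z) (phi n w) = @vzero R d).
  by rewrite vnorm0 mulr_ge0 // mulr_ge0 ?powR_ge0 // ltW.
apply: le_trans (holo_dist_le opn cvn prn (hphi n) z1 w1) _.
apply: ler_wpM2l => //; apply: le_trans (HK _ nN _ _ (Omphi n w1) wM v0) _.
rewrite ler_pM2l //; apply: ge0_ler_powR; rewrite ?nnegrE ?delta_ge0 ?addr_ge0 ?(ltW M0) //.
by apply: le_trans (hB _) _; rewrite lerD2l ltW.
Qed.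

Lemma phi_bounded (r : R) : 0 <= r -> r < 1 -> exists2 M : R, 0 < M &
  \forall n \near Ufree, forall z : C, cabs z <= r -> vnorm (phi n z) < M.
Proof.
move=> r0 r1; have [K K0 HK] := phi_dist_near Rad0.
exists (2 * r / (1 - r) * K + Rad + 1).
  rewrite ltr_wpDl // addr_ge0 ?(ltW Rad0) // mulr_ge0 ?(ltW K0) //.
  by apply: divr_ge0; [exact: mulr_ge0|rewrite subr_ge0 ltW].
apply: filterS HK => n H z zr; have z1 := le_lt_trans zr r1.
have := H z 0 z1 c01 (phi0 n); rewrite pseudohypC pseudohyp0 => h.
have h2 : 2 * cabs z / (1 - cabs z) * K <= 2 * r / (1 - r) * K.
  by apply: ler_wpM2r; [exact: ltW|apply: two_pseudohyp; rewrite ?cabs_ge0].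
have := vnorm_triD (phi n z) (phi n 0); have := phi0 n; lra.
Qed.

Lemma phi_equicont (r e : R) : 0 <= r -> r < 1 -> 0 < e -> exists2 dl : R, 0 < dl &
  \forall n \near Ufree, forall z w : C, cabs z <= r -> cabs w <= r -> cabs (z - w) < dl ->
    vnorm (vsub (phi n z) (phi n w)) <= e.
Proof.
move=> r0 r1 e0; have [M M0 HM] := phi_bounded r0 r1; have [K K0 HK] := phi_dist_near M0.
have r1' : 0 < 1 - r by rewrite subr_gt0.
(* For x <= 1/2 the factor 2x/(1 - x) is at most 4x. *)
pose x := Num.min 2^-1 (e / (4 * K)).
have x0 : 0 < x by rewrite lt_min invr_gt0 ltr0n divr_gt0 // mulr_gt0.
have x1 : x <= 2^-1 by rewrite ge_min lexx.
have x2 : x * (4 * K) <= e by rewrite -ler_pdivlMr ?mulr_gt0 // ge_min lexx orbT.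
exists (x * (1 - r)); first by rewrite mulr_gt0.
apply: filterS2 HM HK => n hM hK z w zr wr zw.
apply: le_trans (hK z w (le_lt_trans zr r1) (le_lt_trans wr r1) (hM _ wr)) _.
have px : pseudohyp z w <= x.
  by apply: le_trans (pseudohyp_le r1 zr wr) _; rewrite ler_pdivrMr // ltW.
apply: le_trans (_ : 2 * x / (1 - x) * K <= _).
  by apply: ler_wpM2r; [exact: ltW|apply: two_pseudohyp; rewrite ?pseudohyp_ge0 //; lra].
apply: le_trans x2; rewrite [x * _]mulrA ler_pM2r // ler_pdivrMr; [nra|lra].
Qed.

Lemma limit_ex : exists psi : C -> cvec R d, forall z, cabs z < 1 -> vcvg (fun n => phi n z) (psi z).
Proof.
have H (z : C) : exists l, cabs z < 1 -> vcvg (fun n => phi n z) l.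
  have [z1|nz] := pselect (cabs z < 1); last by exists (@vzero R d).
  have [M M0 HM] := phi_bounded (cabs_ge0 z) z1.
  have [|l hl] := @vcvg_ex _ _ (fun n => phi n z) M; last by exists l.
  by apply: filterS HM => n h; exact/ltW/h.
by have [psi hp] := choice H; exists psi.
Qed.

Variable psi : C -> cvec R d.
Hypothesis hpsi : forall z, cabs z < 1 -> vcvg (fun n => phi n z) (psi z).

Lemma psi_equicont (r e : R) : 0 <= r -> r < 1 -> 0 < e -> exists2 dl : R, 0 < dl &
  forall z w : C, cabs z <= r -> cabs w <= r -> cabs (z - w) < dl ->
    vnorm (vsub (psi z) (psi w)) <= e.
Proof.
move=> r0 r1 e0; have [dl dl0 H] := phi_equicont r0 r1 e0; exists dl => // z w zr wr zw.
apply: (vcvg_norm_le (vcvgB (hpsi (le_lt_trans zr r1)) (hpsi (le_lt_trans wr r1)))).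
by apply: filterS H => n; exact.
Qed.

(** If it failed for most n, the bad points would converge to some z in the closed disc, where
    equicontinuity and pointwise convergence contradict them. *)
Lemma psi_unif (r e : R) : 0 <= r -> r < 1 -> 0 < e -> \forall n \near Ufree,
  forall z : C, cabs z <= r -> vnorm (vsub (phi n z) (psi z)) <= e.
Proof.
move=> r0 r1 e0.
case: (Ufree_em (fun n => forall z : C, cabs z <= r -> vnorm (vsub (phi n z) (psi z)) <= e)) => // h.
exfalso.
(* For indices without a bad point, 0 is a placeholder that makes the choice total. *)
have H n : exists z : C, cabs z <= r /\ ((~ forall z : C, cabs z <= r -> vnorm (vsub (phi n z) (psi z)) <= e) ->
    e < vnorm (vsub (phi n z) (psi z))).
  have [hn|hn] := pselect (forall z : C, cabs z <= r -> vnorm (vsub (phi n z) (psi z)) <= e).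
    by exists 0; rewrite cabs0; split.
  apply: contrapT => h2; apply: hn => z zr; rewrite leNgt; apply/negP => h3.
  by apply: h2; exists z.
have [x hx] := choice H.
have [|z xz] := @ucvg_ex _ x r; first by apply: filterS filterT => n _; case: (hx n).
have zr : cabs z <= r by apply: (ucvg_cabs xz); apply: filterS filterT => n _; case: (hx n).
have e30 : 0 < e / 3 by rewrite divr_gt0.
have [d1 d10 H1] := phi_equicont r0 r1 e30.
have [d2 d20 H2] := psi_equicont r0 r1 e30.
have [n [[/= g1 g2] [[/= g3 g4] g5]]] :=
  filter_ex (filterI (filterI h H1) (filterI (filterI (xz _ d10) (xz _ d20)) (hpsi (le_lt_trans zr r1) e30))).
have [xr /(_ g1)] := hx n; apply/negP; rewrite -leNgt.
have k1 := g2 _ _ xr zr g3.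
have k2 := H2 _ _ xr zr g4; rewrite vnormBC in k2.
have := vnorm_tri (phi n z) (phi n (x n)) (psi (x n)).
have := vnorm_tri (psi z) (phi n z) (psi (x n)).
lra.
Qed.

Let mid_r (z : C) : cabs z < 1 -> exists r : R, [/\ 0 < r, r < 1 & cabs z < r].
Proof.
move=> z1; exists ((1 + cabs z) / 2); have := cabs_ge0 z.
by split; lra.
Qed.

Lemma psi_hol (z : C) (i : 'I_d) : cabs z < 1 -> hol (fun w : C => psi w i) z.
Proof.
move=> z1; have [r [r0 r1 zr]] := mid_r z1.
apply: (@hol_ulim _ r (fun n (w : C) => phi n w i)) => //.
  apply: filterS filterT => n _ w wr.
  by apply: (holo_comp_hol i (hphi n)); exact: le_lt_trans r1.
move=> e e0; apply: filterS (psi_unif (ltW r0) r1 e0) => n h w wr.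
by apply: le_trans (h w wr); exact: (vcomp_le (vsub (phi n w) (psi w))).
Qed.

Let psi_cl (z : C) : cabs z < 1 -> eclosure O (psi z).
Proof.
move=> z1; apply: (hausdorff_closure cvg _ (hpsi z1)).
by apply: filterS filterT => n _; exact: Omphi.
Qed.

(** This is where the lower bound on the depth enters: the [Om n] contain a common ball around psi
    0. *)
Let psi0_in : O (psi 0).
Proof.
have e20 : 0 < eps / 2 by rewrite divr_gt0.
apply: (hausdorff_outer opO cvO O_ne cvg e20).
apply: filterS2 heps (hpsi c01 e20) => n h1 h2 y hy; apply: delta_ball.
apply: lt_le_trans h1; apply: le_lt_trans (vnorm_tri (psi 0) _ _) _.
by rewrite [ltRHS](splitr eps) ltrD // vnormBC.
Qed.

Lemma psi_in (z : C) : cabs z < 1 -> O (psi z).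
Proof.
move=> z1; apply: contrapT => nz.
have [c [c1 hc]] := sep_open opO cvO O_ne nz.
pose F (y : C) := - hdot (vsub (psi y) (psi z)) c.
have holF (y : C) : cabs y < 1 -> hol F y.
  by move=> y1; apply: holN; apply: hol_hdot => i; exact: psi_hol.
have posF (y : C) : cabs y < 1 -> 0 <= Re (F y).
  move=> y1; rewrite /F ReN oppr_ge0; apply/ler_eps => e e0; rewrite add0r.
  have [q Oq hq] := psi_cl y1 e0.
  have e1 : vsub (psi y) (psi z) = vadd (vsub (psi y) q) (vsub q (psi z)) by vec_ring.
  have := hc _ Oq; have := rdot_le (vsub (psi y) q) c.
  rewrite c1 mulr1 ler_norml => /andP[_ h1] h2.
  rewrite -[X in X <= _]/(rdot (vsub (psi y) (psi z)) c) e1 (rdotDl (vsub (psi y) q)); lra.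
have Fz : F z = 0.
  by rewrite /F vsubvv /hdot big1 ?oppr0 // => i _; rewrite mul0r.
have := halfplane_schwarz c01 z1 holF posF.
rewrite Fz /= mulr0 subr0 => h.
(* The Schwarz estimate based at z has [Re (F z) = 0] on the right; strict separation at psi 0
   excludes the conclusion. *)
have F0 : F 0 = 0 by apply/eqP; rewrite -cabs_eq0 eq_le cabs_ge0 h.
have := hc _ psi0_in; rewrite /rdot -[hdot _ _]opprK -/(F 0) F0 oppr0 /= ltxx.
by [].
Qed.

Lemma psi_geodesic : complex_geodesic O psi.
Proof.
have hpsiO : holo_map O psi.
  split=> [z dz i|z dz]; last exact: psi_in.
  by apply/derivable1_diffP; exact: psi_hol.
split=> // z w dz dw; apply/eqP; rewrite eq_le; apply/andP; split.
  (* The disc psi is itself a chain from psi z to psi w. *)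
  by apply: disc_chain_kob; exact: disc_chain1.
apply: le_ereal_inf_tmp => x hx.
have [l lE] : exists l : R, x = l%:E by case: hx => N [pts [f [a' [b' [_ _ _ ->]]]]]; eexists.
rewrite lE in hx *; rewrite lee_fin; move/disc_chainP: hx => hch.
(* One third for shrinking the chain, one for each junction with phi_n z and phi_n w. *)
apply/ler_eps => e e0; have e30 : 0 < e / 3 by rewrite divr_gt0.
have [l' hl' H1] := shrink_chain hOm3 opO cvg hch e30.
have H2 := chain_near hOm3 opO cvg (psi_in dz) (hpsi dz) e30.
have H3 := chain_near hOm3 opO cvg (psi_in dw) (hpsi dw) e30.
have [n [/= g1 [/= g2 g3]]] := filter_ex (filterI H1 (filterI H2 H3)).
have := geodesic_le (geo n) dz dw (disc_chain_cat (disc_chain_sym g2) (disc_chain_cat g1 g3)).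
set t := Num.min _ _ => ht.
have t0 : 0 < t by rewrite lt_min invr_gt0 ltr0n divr_gt0.
have t1 : t <= 2^-1 by rewrite ge_min lexx.
have t2 : t <= e / 3 / 2 by rewrite ge_min lexx orbT.
have := pdist_small t0 t1; lra.
Qed.

(** The first component of the pair sets the radius 1 - 1/(k+1) and the precision 1/(k+1), the
    second a lower bound on the index that makes [nk] increase. *)
Lemma subsequence_ex : exists nk : nat -> nat, (forall k, (nk k < nk k.+1)%N) /\
  loc_unif_cvg (fun k => phi (nk k)) psi.
Proof.
have H (p : nat * nat) : exists n, (p.2 <= n)%N /\ forall z : C, cabs z <= 1 - p.1.+1%:R^-1 ->
    vnorm (vsub (phi n z) (psi z)) <= p.1.+1%:R^-1.
  apply: Ufree_unbounded; apply: psi_unif; last by rewrite invr_gt0.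
    by rewrite subr_ge0 invf_le1 // ler1n.
  by rewrite gtrBl invr_gt0.
have [g hg] := choice H.
pose nk := fix nk k := if k is k'.+1 then g (k, (nk k').+1) else g (0%N, 0%N).
exists nk; split=> [k|r /andP[r0 r1] e e0].
  by have [] := hg (k.+1, (nk k).+1).
have hk k (z : C) : cabs z <= 1 - k.+1%:R^-1 -> vnorm (vsub (phi (nk k) z) (psi z)) <= k.+1%:R^-1.
  by case: k => [|k]; [have [_] := hg (0%N, 0%N)|have [_] := hg (k.+1, (nk k).+1)]; exact.
have [N1 H1] := inv_succ_small e0.
have r10 : 0 < 1 - r by rewrite subr_gt0.
have [N2 H2] := inv_succ_small r10.
exists (N1 + N2)%N => k hkN z zr.
have k1 : (N1 <= k)%N by apply: leq_trans hkN; rewrite leq_addr.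
have k2 : (N2 <= k)%N by apply: leq_trans hkN; rewrite leq_addl.
apply: le_lt_trans (H1 k k1); apply: hk; apply: le_trans zr _.
by rewrite lerBrDr addrC -lerBrDr ltW ?H2.
Qed.

End Main.
Theorem theorem7p4 (R : realType) (d : nat) (m : R)
  (Om : nat -> set (cvec R d)) (O : set (cvec R d))
  (phi : nat -> R[i] -> cvec R d) (Rad : R) (a b : nat -> R) :
  0 < m ->
  (forall n, eopen (Om n) /\ rconvex (Om n) /\ C_proper (Om n)) ->
  loc_m_convex m Om ->
  eopen O -> rconvex O -> C_proper O ->
  local_hausdorff_cvg Om O ->
  (forall n, complex_geodesic (Om n) (phi n)) ->
  0 < Rad ->
  (forall n, -1 < a n < 1 /\ -1 < b n < 1) ->
  (forall n, a n <= 0 <= b n) ->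
  (forall n (t : R), a n <= t <= b n -> vnorm (phi n t%:C) < Rad) ->
  (exists2 L : R, 0 < L &
     (fun n => vnorm (vsub (phi n (a n)%:C) (phi n (b n)%:C))) @ \oo --> L) ->
  (forall n (t : R), a n <= t <= b n ->
     delta (Om n) (phi n t%:C) <= delta (Om n) (phi n 0)) ->
  exists (nk : nat -> nat) (psi : R[i] -> cvec R d),
    (forall k, (nk k < nk k.+1)%N) /\
    loc_unif_cvg (fun k => phi (nk k)) psi /\
    complex_geodesic O psi.
Proof.
move=> m0 hOm hm opO cvO prO cvg geo Rad0 ab1 ab0 phiR [L L0 phiL] phid.
have c0 : (0 : R)%:C = 0 :> R[i] by [].
have phi0 n : vnorm (phi n 0) < Rad by rewrite -c0; apply: phiR; exact: ab0.
have phiL' : \forall n \near Ufree, L / 2 < vnorm (vsub (phi n (a n)%:C) (phi n (b n)%:C)).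
  have L20 : 0 < L / 2 by rewrite divr_gt0.
  move: phiL => /cvgrPdist_lt /(_ _ L20) [N _ HN]; apply: (@Ufree_inf _ N) => n /HN /=.
  by rewrite ltr_norml => /andP[_]; lra.
(* The endpoints are distinct by (3), which excludes dimension 0. *)
have v0 : exists v : cvec R d, v <> @vzero R d.
  have [n hn] := filter_ex phiL'.
  exists (vsub (phi n (a n)%:C) (phi n (b n)%:C)) => h.
  by move: hn; rewrite h vnorm0; apply/negP; rewrite -leNgt divr_ge0 // ltW.
have [e e0 he] := delta_center_lower m0 hOm hm opO cvg geo Rad0 phi0 ab1 ab0 phiR L0 phiL' phid.
have [psi hpsi] := limit_ex m0 hOm hm opO cvO prO cvg geo Rad0 phi0 v0.
have [nk [h1 h2]] := subsequence_ex m0 hOm hm opO cvO prO cvg geo Rad0 phi0 v0 hpsi.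
exists nk, psi; split=> //; split=> //.
exact: (psi_geodesic m0 hOm hm opO cvO prO cvg geo Rad0 phi0 v0 e0 he hpsi).
Qed.
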